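(* Let $(P_{(\vartheta)})_{\vartheta\in[0,\infty)}$ be a family of continuous probability distributions on $[0,\infty)$ with Radon-Nikodym densities $$\frac{dP_{(\vartheta)}}{dP_{(0)}}=C(\vartheta)\exp(\vartheta T)$$ for functions $T:[0,\infty)\to\mathbb{R}$ and $C:[0,\infty)\to(0,\infty)$ with $C(0)=1$. Assume that the (finite) variance of $T$ satisfies $\mathrm{Var}_{P_{(0)}}(T)>0$. Consider the noise distribution $P_0=P_{(0)}$ and the signal distribution $\mu_n=P_{(\vartheta_n)}$ with $$\varepsilon_n=n^{-\beta},\ \beta\in(0,\tfrac12),\qquad \vartheta_n=n^{-r},\ r>0,$$ and let $Q_n=(1-\varepsilon_n)P_0+\varepsilon_n\mu_n$. Then the detection boundary for the parameter $r$ is given by $\rho^*(\beta)=\frac12-\beta$. In particular, for all $s\in\mathbb{R}$: (a) If $r<\rho^*(\beta)$, then there is a sequence $(c_n(s))_{n\in\mathbb{N}}$ of critical values such that $\varphi_n=\mathbf{1}\{S_n(s)>c_n(s)\}$ completely separates $P_0^n$ and $Q_n^n$ asymptotically. (b) If $r=\rho^*(\beta)$, then $$2\,N(0,1)\Bigl(\bigl(\tfrac12\mathrm{Var}_{P_{(0)}}(T)^{1/2},\infty\bigr)\Bigr)$$ is the sharp lower bound for the limit of the sum of type 1 and type 2 error probabilities over all tests of $P_0^n$ versus $Q_n^n$, i.e. the infimum over all tests of this sum converges to this value as $n\to\infty$. But all tests of the form $\varphi_n=\mathbf{1}\{S_n(s)>c_n(s)\}$ (for any sequence of critical values $c_n(s)$)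 cannot distinguish between $P_0^n$ and $Q_n^n$ asymptotically. (c) If $r>\rho^*(\beta)$, then no sequence of tests $\varphi_n$ can distinguish between $P_0^n$ and $Q_n^n$ asymptotically.
   Context: $P_0^n$ and $Q_n^n$ denote $n$-fold product measures; the observations $X_{n,1},\ldots,X_{n,n}$ are i.i.d. $\sim P_0$ under the null and i.i.d. $\sim Q_n$ under the alternative. $F_0$ is the distribution function of $P_0$. $N(0,1)(A)$ is the standard normal probability of the set $A$. A sequence of tests $\varphi_n$ (measurable functions of the sample with values in $[0,1]$) has sum of type 1 and type 2 error probabilities $E_{P_0^n}(\varphi_n)+E_{Q_n^n}(1-\varphi_n)$. It completely separates $P_0^n$ and $Q_n^n$ asymptotically if this sum tends to $0$; it cannot distinguish between them asymptotically if this sum tends to $1$. The detection boundary for $r$ is the value $\rho^*(\beta)$ such that complete separation by some sequence of tests is possible for $r<\rho^*(\beta)$, while for $r>\rho^*(\beta)$ no sequence of tests can distinguish between $P_0^n$ and $Q_n^n$ asymptotically. For $s\in\mathbb{R}$ define $\phi_s:[0,\infty)\to\mathbb{R}\cup\{\infty\}$ by $\phi_0(x)=x-\log(x)-1$, $\phi_1(x)=x(\log(x)-1)+1$, and $\phi_s(x)=\dfrac{1-s+sx-x^s}{s(1-s)}$ for $s\neq0,1$. For $u,v\in(0,1)$ put $K_s(u,v)=v\,\phi_s(u/v)+(1-v)\,\phi_s((1-u)/(1-v))$. Let $\mathbb{F}_n(x)=n^{-1}\sum_{i=1}^n\mathbf{1}\{X_{n,i}\le x\}$ and let $X_{1:n}\le\ldots\le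 X_{n:n}$ be the order statistics. The test statistic is $S_n(s)=\sup_{X_{1:n}\le x<X_{n:n}}K_s(\mathbb{F}_n(x),F_0(x))$. *)

(* Defs.v *)
From HB Require Import structures.
From mathcomp Require Import all_boot all_order all_algebra.
From mathcomp Require Import all_classical all_reals all_analysis.
Set Implicit Arguments.
Unset Strict Implicit.
Unset Printing Implicit Defensive.
Import Order.TTheory GRing.Theory Num.Theory.
Import numFieldNormedType.Exports.
Local Open Scope classical_set_scope.
Local Open Scope ring_scope.

(* Mixtures (1 - e) P + e M.  The definition is totalised: for e outside
   [0, 1] the value is P.  With e = n^-beta, beta > 0, this junk branch is
   never used, since powR 0 (- beta) = 0. *)

Definition mixture d (T : measurableType d) (R : realType) (e : R)
    (P M : probability T R) : set T -> \bar R := fun A =>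
  if 0 <= e <= 1 then ((1 - e)%:E * P A + e%:E * M A)%E else P A.

Lemma mixture_measure_add d (T : measurableType d) (R : realType) (e : R)
    (P M : probability T R) (e0 : 0 <= e) (e1 : 0 <= 1 - e) :
  mixture e P M = measure_add (mscale (NngNum e1) P) (mscale (NngNum e0) M).
Proof.
apply/funext => A; rewrite measure_addE /mixture.
by rewrite e0 /= -subr_ge0 e1.
Qed.

Lemma mixture0 d (T : measurableType d) (R : realType) (e : R)
  (P M : probability T R) : mixture e P M set0 = 0%E.
Proof. by rewrite /mixture !measure0 !mule0 adde0 if_same. Qed.

Lemma mixture_ge0 d (T : measurableType d) (R : realType) (e : R)
  (P M : probability T R) (A : set T) : (0 <= mixture e P M A)%E.
Proof.
rewrite /mixture; case: ifPn => [/andP[e0 e1]|_]; last exact: measure_ge0.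
by rewrite adde_ge0// mule_ge0// lee_fin// subr_ge0.
Qed.

Lemma mixture_sigma_additive d (T : measurableType d) (R : realType) (e : R)
  (P M : probability T R) : semi_sigma_additive (mixture e P M).
Proof.
case: (boolP (0 <= e <= 1)) => [/andP[e0 e1]|/negbTE e01].
  have e1' : 0 <= 1 - e by rewrite subr_ge0.
  rewrite (mixture_measure_add P M e0 e1').
  exact: measure_semi_sigma_additive.
have -> : mixture e P M = P by apply/funext => A; rewrite /mixture e01.
exact: measure_semi_sigma_additive.
Qed.

HB.instance Definition _ d (T : measurableType d) (R : realType) (e : R)
    (P M : probability T R) :=
  isMeasure.Build d T R (mixture e P M) (mixture0 e P M) (mixture_ge0 e P M)
    (@mixture_sigma_additive d T R e P M).

Lemma mixture_setT d (T : measurableType d) (R : realType) (e : R)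
  (P M : probability T R) : mixture e P M setT = 1%E.
Proof.
rewrite /mixture !probability_setT; case: ifP => // _.
by rewrite !mule1 -EFinD subrK.
Qed.

HB.instance Definition _ d (T : measurableType d) (R : realType) (e : R)
    (P M : probability T R) :=
  Measure_isProbability.Build d T R (mixture e P M) (mixture_setT e P M).

(* The n-fold product probability P^n on n.-tuple T, built by
   P^0 = Dirac mass at the empty tuple and P^(n+1) = image of P \x P^n
   under (t, x) |-> t :: x; it is characterised by power_prob_rect. *)

Definition tuple_cons d (T : measurableType d) n (u : T * n.-tuple T) :
  n.+1.-tuple T := [the n.+1.-tuple T of u.1 :: u.2].

Lemma measurable_tuple_cons d (T : measurableType d) n :
  measurable_fun [set: T * n.-tuple T] (@tuple_cons d T n).
Proof. exact: measurable_cons. Qed.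

HB.instance Definition _ d (T : measurableType d) n :=
  isMeasurableFun.Build _ _ _ _ (@tuple_cons d T n)
    (@measurable_tuple_cons d T n).

Fixpoint power_prob d (T : measurableType d) (R : realType)
    (P : probability T R) (n : nat) : probability (n.-tuple T) R :=
  match n return probability (n.-tuple T) R with
  | 0%N => \d_([tuple] : 0.-tuple T)
  | m.+1 => distribution (P \x power_prob P m)%E (@tuple_cons d T m)
  end.

Lemma power_prob_rect d (T : measurableType d) (R : realType)
    (P : probability T R) n (A : 'I_n -> set T) :
  (forall i, measurable (A i)) ->
  power_prob P n [set x | forall i, A i (tnth x i)] = (\prod_(i < n) P (A i))%E.
Proof.
elim: n A => [|n IHn] A mA /=.
  by rewrite big_ord0 diracE mem_set// => -[].
rewrite big_ord_recl -(IHn (fun i => A (lift ord0 i)))//.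
rewrite /distribution /pushforward.
rewrite (_ : _ @^-1` _ = A ord0 `*`
    [set x : n.-tuple T | forall i, A (lift ord0 i) (tnth x i)]); last first.
  apply/seteqP; split => -[t x] /=.
    move=> h; split; first exact: (h ord0).
    by move=> i; have := h (lift ord0 i); rewrite tnthS.
  move=> [h0 h] i; case: (unliftP ord0 i) => [j|] ->; last exact: h0.
  by rewrite tnthS.
rewrite product_measure1E//.
have -> : [set x : n.-tuple T | forall i, A (lift ord0 i) (tnth x i)] =
    \bigcap_(i in [set: 'I_n]) ((@tnth n T)^~ i @^-1` A (lift ord0 i)).
  by apply/seteqP; split => x h i //=; exact: h.
apply: fin_bigcap_measurable => [|i _]; first exact: finite_finset.
by rewrite -[X in measurable X]setTI; exact: measurable_tnth.
Qed.

(* The observation of a real-valued model: the identity random variable. *)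

Definition observation (R : realType) : R -> R := idfun.

HB.instance Definition _ (R : realType) :=
  isMeasurableFun.Build _ _ R R (@observation R) (@measurable_id _ R setT).

Definition dist_fun (R : realType) (P : probability R R) (t : R) : R :=
  fine (cdf (observation (R := R) : {RV P >-> R}) t).

Definition phi_div (R : realType) (s x : R) : \bar R :=
  if s == 0 then (if x == 0 then +oo%E else (x - ln x - 1)%:E)
  else if s == 1 then (x * (ln x - 1) + 1)%:E
  else if (s < 0) && (x == 0) then +oo%E
  else ((1 - s + s * x - x `^ s) / (s * (1 - s)))%:E.

(* K_s(u, v), meant for u, v in (0, 1). *)
Definition K_div (R : realType) (s u v : R) : \bar R :=
  (v%:E * phi_div s (u / v) + (1 - v)%:E * phi_div s ((1 - u) / (1 - v)))%E.

Definition emp_dist_fun (R : realType) n (x : n.-tuple R) (t : R) : R :=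
  n%:R^-1 * \sum_(i < n) \1_([set y : R | y <= t]) (tnth x i).

(* X_{k:n} for 1 <= k <= n. *)
Definition order_stat (R : realType) n (x : n.-tuple R) (k : nat) : R :=
  nth 0 (sort <=%O x) k.-1.

(* S_n(s).  The arguments F_n(t) and F_0(t) lie in (0, 1) for all t in the
   range of the supremum, outside a set of samples that is null under the
   n-fold product of P0 and of every distribution dominated by P0. *)
Definition S_stat (R : realType) (P0 : probability R R) (s : R) n
    (x : n.-tuple R) : \bar R :=
  ereal_sup [set K_div s (emp_dist_fun x t) (dist_fun P0 t) |
    t in [set t : R | order_stat x 1 <= t < order_stat x n]].

Definition S_test (R : realType) (P0 : probability R R) (s : R) (c : nat -> R)
    n : n.-tuple R -> R :=
  \1_([set x : n.-tuple R | ((c n)%:E < S_stat P0 s x)%E]).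

Definition is_test d (T : measurableType d) (R : realType) (f : T -> R) :=
  measurable_fun setT f /\ forall x, 0 <= f x <= 1.

Definition error_sum (R : realType) (P Q : probability R R) n
    (f : n.-tuple R -> R) : \bar R :=
  ('E_(power_prob P n)[f] + 'E_(power_prob Q n)[cst 1%R \- f])%E.

Definition test_sequence (R : realType) (f : forall n, n.-tuple R -> R) :=
  forall n, is_test (f n).
Arguments test_sequence {R} f.

Definition completely_separates (R : realType) (P : probability R R)
    (Q : nat -> probability R R) (f : forall n, n.-tuple R -> R) :=
  error_sum P (Q n) (f n) @[n --> \oo] --> 0%E.

Definition cannot_distinguish (R : realType) (P : probability R R)
    (Q : nat -> probability R R) (f : forall n, n.-tuple R -> R) :=
  error_sum P (Q n) (f n) @[n --> \oo] --> 1%E.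

(* Q r n is the alternative at sample size n when the parameter is r > 0. *)
Definition is_detection_boundary (R : realType) (P : probability R R)
    (Q : R -> nat -> probability R R) (rho : R) :=
  (forall r, 0 < r -> r < rho -> exists f : forall n, n.-tuple R -> R,
     test_sequence f /\ completely_separates P (Q r) f) /\
  (forall r, 0 < r -> rho < r -> forall f : forall n, n.-tuple R -> R,
     test_sequence f -> cannot_distinguish P (Q r) f).

(* Distributions on [0, oo) are encoded as probabilities on R giving mass 1
   to [0, oo); likewise T is a function on R of which only the restriction
   to [0, oo) matters, and P, C are only constrained at theta >= 0. *)
Definition is_exponential_family (R : realType) (P : R -> probability R R)
    (C : R -> R) (T : R -> R) :=
  [/\ forall theta, 0 <= theta -> P theta `[0, +oo[%classic = 1%E,
      forall theta, 0 <= theta -> continuous (dist_fun (P theta)),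
      C 0 = 1,
      forall theta, 0 <= theta -> 0 < C theta &
      forall theta, 0 <= theta -> P theta `<< P 0 /\
        ae_eq (P 0) setT
          (Radon_Nikodym (charge_of_finite_measure (P theta)) (P 0))
          (fun x => (C theta * expR (theta * T x))%:E)].

(* Q_n = (1 - n^-beta) P_(0) + n^-beta P_(n^-r). *)
Definition signal_alternative (R : realType) (P : R -> probability R R)
    (beta r : R) (n : nat) : probability R R :=
  mixture (n%:R `^ (- beta)) (P 0) (P (n%:R `^ (- r))).

(* Main.v *)
Require Import Defs.
From HB Require Import structures.
From mathcomp Require Import all_boot all_order all_algebra.
From mathcomp Require Import all_classical all_reals all_analysis.
From mathcomp Require Import measurable_realfun.
From mathcomp Require Import ring lra.
Set Implicit Arguments.
Unset Strict Implicit.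
Unset Printing Implicit Defensive.
Import Order.TTheory GRing.Theory Num.Theory.
Import numFieldNormedType.Exports.
Local Open Scope classical_set_scope.
Local Open Scope ring_scope.

(** Write [P] for the null law, [F] for its distribution function, [h] for the
    centred statistic [T - E T] and [L] for the likelihood ratio of the
    [n]-sample. Near the parameter 0 the family has densities
    [1 + theta * G], where [G] tends to [h] and its square is dominated by an
    integrable function. The alternatives thus have densities
    [1 + a n * G n] with [a n = n ^ (- beta - r)]: they are local alternatives
    of size [a n] ([exponential_alternatives]), and everything depends on the
    limit of [n * a n ^ 2 = n ^ (2 * (rho - r))].

    Above the boundary [E L ^ 2 = (1 + a n ^ 2 * E (G n ^ 2)) ^ n] tends to 1,
    so [L] tends to 1 in mean square and all tests fail ([indistinguishable]).

    On the boundary the smallest sum of error probabilities is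
    [E (min 1 L)], attained by the Neyman-Pearson test ([neyman_pearson]). It
    converges to its value for a Gaussian shift experiment
    ([bayes_risk_cvg]): replace the minimum by a smooth function of [L],
    uniformly close to it and twice differentiable in relative increments of
    [L], and swap the factors of [L] one at a time for log-normal factors with
    the same first two moments. Log-normal laws form a convolution semigroup,
    so the product of the new factors is explicit, and a third-order remainder
    bounds each swap.

    On the boundary the statistic itself fails, for a different reason
    ([S_test_indistinguishable]). Up to powers of likelihood ratios, the
    divergence [K_div s u v] is the chi-square distance
    [(u - v) ^ 2 / (v * (1 - v))] ([K_div_bounds]). Under the null the
    fluctuations of the empirical distribution function are of order
    [n ^ (- 1 / 2)] uniformly (chaining, [rare_sup_deviation]), so that points
    where [F] lies in [[del, 1 - del[] contribute [O (1 / n)]. Near the end of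
    the range, however, arbitrarily many points carry almost independent
    normalised fluctuations, and one of them exceeds any given multiple of
    [1 / n] ([rare_flat_tail]). The statistic is therefore decided in the
    tails ([exceeds_tails_rare]); by contiguity this also holds under the
    alternatives ([rare_contiguous]). The tails only involve the sample in
    which all observations from the middle are identified, and for such
    censored samples the chi-square distance of the alternatives is about
    [n * a n ^ 2] times the integral of [h ^ 2] over the tails, which is small
    with [del].

    Below the boundary the statistic succeeds ([S_test_separates]) with
    critical value [n ^ (rho - r - 1)]. Under the null it is at most
    [n ^ (o (1) - 1)], by exponential bounds on a grid of [n ^ 2] levels
    ([null_rare]). Under the alternatives a single point [t] suffices: since
    half-lines generate the Borel sets there is a [t] for which the integral
    [m] of [h] over the points up to [t] does not vanish
    ([halfline_mean_neq0]); there the empirical distribution function is off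
    by [a n * m], which is [n ^ (rho - r)] times larger than its standard
    deviation. *)

(** * Integration against product measures *)

Section power_prob_integral.
Local Open Scope ereal_scope.
Context d (T : measurableType d) (R : realType).
Implicit Types (P Q : probability T R).

Lemma power_prob_integralS P n (f : n.+1.-tuple T -> \bar R) :
  measurable_fun [set: n.+1.-tuple T] f -> (forall x, 0 <= f x) ->
  \int[power_prob P n.+1]_x f x =
  \int[P]_t \int[power_prob P n]_x f (tuple_cons (t, x)).
Proof.
move=> mf f0 /=; rewrite ge0_integral_distribution//.
rewrite (fubini_tonelli1 (fun z => f (tuple_cons z)))//=.
exact: measurableT_comp mf (@measurable_tuple_cons d T n).
Qed.

Lemma power_prob_integral0 P (f : 0.-tuple T -> \bar R) :
  measurable_fun [set: 0.-tuple T] f ->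
  \int[power_prob P 0]_x f x = f [tuple].
Proof. by move=> mf /=; rewrite integral_dirac// diracT mul1e. Qed.

Lemma measurable_tuple_prod n (f : T -> R) : measurable_fun setT f ->
  measurable_fun setT (fun x : n.-tuple T => \prod_(i < n) f (tnth x i))%R.
Proof.
move=> mf; apply: measurable_prod => i _.
by apply: measurableT_comp => //; exact: measurable_tnth.
Qed.

Lemma measurable_map_tuple n (k : T -> T) : measurable_fun setT k ->
  measurable_fun setT (fun x : n.-tuple T => map_tuple k x).
Proof.
move=> mk; apply/measurable_fun_tnthP => i.
rewrite (_ : _ \o _ = k \o (@tnth n T)^~ i); last first.
  by apply/funext => x /=; rewrite tnth_map.
by apply: measurableT_comp => //; exact: measurable_tnth.
Qed.

Lemma prod_tuple_cons n (f : T -> R) (t : T) (x : n.-tuple T) :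
  (\prod_(i < n.+1) f (tnth (tuple_cons (t, x)) i) =
   f t * \prod_(i < n) f (tnth x i))%R.
Proof.
rewrite big_ord_recl; congr (_ * _)%R.
by apply: eq_bigr => i _; rewrite tnthS.
Qed.

(** The transport principle behind every likelihood-ratio argument below: it
    only asks that [l] be the density of the image of [Q] under [k] in terms
    of that of [P], so it covers both the full observations ([k] the identity)
    and observations that are coarsened coordinate by coordinate. *)
Lemma power_prob_change P Q (k : T -> T) (l : T -> R) n
    (g : n.-tuple T -> \bar R) :
  measurable_fun setT k -> measurable_fun setT l -> (forall x, 0 <= l x)%R ->
  (forall f : T -> \bar R, measurable_fun setT f -> (forall x, 0 <= f x) ->
     \int[Q]_x f (k x) = \int[P]_x ((l x)%:E * f (k x))) ->
  measurable_fun [set: n.-tuple T] g -> (forall x, 0 <= g x) ->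
  \int[power_prob Q n]_x g (map_tuple k x) =
  \int[power_prob P n]_x
    ((\prod_(i < n) l (tnth x i))%:E * g (map_tuple k x)).
Proof.
move=> mk ml l0 PQ.
have mgk m (h : m.-tuple T -> \bar R) : measurable_fun [set: m.-tuple T] h ->
    measurable_fun [set: m.-tuple T] (fun x => h (map_tuple k x)).
  by move=> mh; apply: measurableT_comp => //; exact: measurable_map_tuple.
elim: n g => [g mg g0|n IHn g mg g0].
  under [RHS]eq_integral do rewrite big_ord0 mul1e.
  by rewrite !power_prob_integral0//; exact: mgk.
have mcons (t : T) : measurable_fun setT (fun x : n.-tuple T => tuple_cons (t, x)).
  exact: (@measurable_cons _ _ (n.-tuple T) T (fun=> t) n (fun x => x)).
rewrite power_prob_integralS//; last exact: mgk.
rewrite power_prob_integralS//; last 2 first.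
- apply: emeasurable_funM; last exact: mgk.
  apply/measurable_EFinP. exact: measurable_tuple_prod.
- by move=> x; rewrite mule_ge0// lee_fin prodr_ge0.
have mapE (t : T) (x : n.-tuple T) :
    map_tuple k (tuple_cons (t, x)) = tuple_cons (k t, map_tuple k x).
  exact: val_inj.
pose G (u : T) := \int[power_prob P n]_x
  ((\prod_(i < n) l (tnth x i))%:E * g (tuple_cons (u, map_tuple k x))).
have mG2 : measurable_fun setT (fun z : T * n.-tuple T =>
    (\prod_(i < n) l (tnth z.2 i))%:E * g (tuple_cons (z.1, map_tuple k z.2))).
  apply: emeasurable_funM.
    apply/measurable_EFinP; apply: (measurableT_comp (measurable_tuple_prod ml)).
    exact: measurable_snd.
  apply: (measurableT_comp mg); apply: measurable_cons => /=.
    exact: measurable_fst.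
  apply: (@measurableT_comp _ _ _ _ _ _ (fun y : n.-tuple T => map_tuple k y)).
    exact: measurable_map_tuple.
  exact: measurable_snd.
have G20 (z : T * n.-tuple T) : 0 <=
    (\prod_(i < n) l (tnth z.2 i))%:E * g (tuple_cons (z.1, map_tuple k z.2)).
  by rewrite mule_ge0// lee_fin prodr_ge0.
have mG : measurable_fun setT G.
  exact: (measurable_fun_fubini_tonelli_F (m2 := power_prob P n) _ mG2 G20).
have G0 u : 0 <= G u by apply: integral_ge0 => x _; exact: (G20 (u, x)).
transitivity (\int[Q]_t G (k t)).
  apply: eq_integral => t _.
  under eq_integral do rewrite mapE.
  rewrite (IHn (fun x => g (tuple_cons (k t, x))))//.
  exact: measurableT_comp.
rewrite PQ//; apply: eq_integral => t _.
rewrite -ge0_integralZl//; last 3 first.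
- exact: (measurableT_comp mG2 (measurable_pair1 (k t))).
- by move=> x _; exact: (G20 (k t, x)).
- by rewrite lee_fin.
by apply: eq_integral => x _; rewrite prod_tuple_cons EFinM muleA mapE.
Qed.

Lemma power_prob_prod P n (f : T -> R) (c : R) :
  measurable_fun setT f -> (forall x, 0 <= f x)%R ->
  \int[P]_x (f x)%:E = c%:E ->
  \int[power_prob P n]_x (\prod_(i < n) f (tnth x i))%:E = (c ^+ n)%:E.
Proof.
move=> mf f0 fc; elim: n => [|n IHn].
  under eq_integral do rewrite big_ord0.
  by rewrite power_prob_integral0.
rewrite power_prob_integralS//; last 2 first.
- by apply/measurable_EFinP; exact: measurable_tuple_prod.
- by move=> x; rewrite lee_fin prodr_ge0.
under eq_integral => t _.
  under eq_integral do rewrite prod_tuple_cons EFinM.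
  rewrite ge0_integralZl// ?IHn; first over.
  - by apply/measurable_EFinP; exact: measurable_tuple_prod.
  - by move=> x _; rewrite lee_fin prodr_ge0.
  - by rewrite lee_fin.
have c0 : (0 <= c)%R by rewrite -lee_fin -fc integral_ge0// => x _; rewrite lee_fin.
rewrite ge0_integralZr//; last 3 first.
- exact/measurable_EFinP.
- by move=> x _; rewrite lee_fin.
- by rewrite lee_fin exprn_ge0.
by rewrite fc -EFinM exprS.
Qed.

End power_prob_integral.

(** * Bounded means and rare events *)

Section rare_events.
Context d (T : measurableType d) (R : realType) (P : probability T R).
Implicit Types (f g : T -> R) (E : set T) (a b c : R).

Definition mean_le f c :=
  [/\ measurable_fun setT f, forall x, 0 <= f x &
      (\int[P]_x (f x)%:E <= c%:E)%E].

(** Controlling an event through a measurable majorant of its indicator avoids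
    all questions about the measurability of the event itself, and lets union
    bounds be carried out on sums of exponential moments. *)
Definition rare E c := exists2 f, mean_le f c & forall x, E x -> 1 <= f x.

Lemma mean_le_fin f c : mean_le f c ->
  exists2 e, 0 <= e <= c & (\int[P]_x (f x)%:E = e%:E)%E.
Proof.
case=> mf f0; case E : (\int[P]_x (f x)%:E)%E => [e| |]//= ec; last first.
  have : (0 <= \int[P]_x (f x)%:E)%E.
    by apply: integral_ge0 => x _; rewrite lee_fin.
  by rewrite E.
exists e => //; apply/andP; split; last by rewrite -lee_fin.
by rewrite -lee_fin -E integral_ge0// => x _; rewrite lee_fin.
Qed.

Lemma mean_le_ge0 f c : mean_le f c -> 0 <= c.
Proof. by case/mean_le_fin => e /andP[+ +] _; exact: le_trans. Qed.

Lemma mean_leW f c c' : c <= c' -> mean_le f c -> mean_le f c'.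
Proof. by move=> cc' [mf f0 fc]; split=> //; rewrite (le_trans fc)// lee_fin. Qed.

Lemma mean_leD f g a b : mean_le f a -> mean_le g b ->
  mean_le (fun x => f x + g x) (a + b).
Proof.
move=> [mf f0 fa] [mg g0 gb]; split; first exact: measurable_funD.
  by move=> x; rewrite addr_ge0.
under eq_integral do rewrite EFinD.
rewrite ge0_integralD//; first by rewrite EFinD leeD.
- by move=> x _; rewrite lee_fin.
- exact/measurable_EFinP.
- by move=> x _; rewrite lee_fin.
- exact/measurable_EFinP.
Qed.

Lemma mean_leZ k f a : 0 <= k -> mean_le f a ->
  mean_le (fun x => k * f x) (k * a).
Proof.
move=> k0 [mf f0 fa]; split; first exact: measurable_funM.
  by move=> x; rewrite mulr_ge0.
under eq_integral do rewrite EFinM.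
rewrite ge0_integralZl//; first by rewrite EFinM lee_wpmul2l.
- exact/measurable_EFinP.
- by move=> x _; rewrite lee_fin.
Qed.

Lemma mean_le_cst a : 0 <= a -> mean_le (fun=> a) a.
Proof.
move=> a0; split => //.
by rewrite integral_cst//= probability_setT mule1.
Qed.

Lemma rareW E c c' : c <= c' -> rare E c -> rare E c'.
Proof. by move=> cc' [f fc Ef]; exists f => //; exact: mean_leW fc. Qed.

Lemma rareS E E' c : E `<=` E' -> rare E' c -> rare E c.
Proof. by move=> EE' [f fc Ef]; exists f => // x /EE'; exact: Ef. Qed.

Lemma rareU E E' a b : rare E a -> rare E' b -> rare (E `|` E') (a + b).
Proof.
move=> [f fa Ef] [g gb Eg]; exists (fun x => f x + g x); first exact: mean_leD.
case: fa gb => _ f0 _ [_ g0 _] x [/Ef|/Eg] h.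
  by rewrite -[1]addr0 lerD.
by rewrite -[1]add0r lerD.
Qed.

Lemma rare0 : rare set0 0.
Proof. by exists (fun=> 0) => //; exact: mean_le_cst. Qed.

Lemma rare_bigU N (E : nat -> set T) (c : nat -> R) :
  (forall j, (j < N)%N -> rare (E j) (c j)) ->
  rare [set x | exists2 j, (j < N)%N & E j x] (\sum_(j < N) c j).
Proof.
elim: N => [|N IHN] h.
  by rewrite big_ord0; apply: rareS rare0 => x [].
rewrite big_ord_recr/=; apply: (@rareS _ _ _ _ (rareU (IHN _) (h N _))) => //.
  move=> x [j]; rewrite ltnS leq_eqVlt => /predU1P[->|jN] Ej; first by right.
  by left; exists j.
by move=> j jN; apply: h; rewrite ltnS ltnW.
Qed.

Lemma rare_markov f c a : 0 < a -> mean_le f c -> rare [set x | a <= f x] (c / a).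
Proof.
move=> a0 fc; exists (fun x => a^-1 * f x).
  by rewrite mulrC; apply: mean_leZ => //; rewrite invr_ge0 ltW.
by move=> x /= af; rewrite mulrC ler_pdivlMr// mul1r.
Qed.

End rare_events.

Lemma mean_le_prod d (T : measurableType d) (R : realType)
    (P : probability T R) n (f : T -> R) c : mean_le P f c ->
  mean_le (power_prob P n) (fun x => \prod_(i < n) f (tnth x i)) (c ^+ n).
Proof.
move=> fc; have [e /andP[e0 ec] fe] := mean_le_fin fc; case: fc => mf f0 fc.
split; first exact: measurable_tuple_prod.
  by move=> x; rewrite prodr_ge0.
by rewrite (power_prob_prod _ mf f0 fe) lee_fin lerXn2r// nnegrE (le_trans e0).
Qed.

Section chernoff.
Context (R : realType).
Implicit Types (l y : R).

Lemma expR_le_quadratic (x : R) : x <= 2^-1 -> expR x <= 1 + x + 2 * x ^+ 2.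
Proof.
move=> x2; have x1 : 0 < 1 - x by lra.
have : expR x <= (1 - x)^-1.
  rewrite -[expR x]invrK -expRN lef_pV2 ?posrE ?expR_gt0//.
  by have := expR_ge1Dx (- x).
move/le_trans; apply; rewrite -[X in X <= _]mul1r ler_pdivrMr//.
have : 0 <= x ^+ 2 * (1 - 2 * x) by rewrite mulr_ge0 ?sqr_ge0//; lra.
by move=> h; nra.
Qed.

Context d (T : measurableType d) (P : probability T R).

Definition hits n (A : set T) (x : n.-tuple T) : R :=
  \sum_(i < n) \1_A (tnth x i).

Lemma hits_exp n (A : set T) l p (x : n.-tuple T) :
  \prod_(i < n) expR (l * (\1_A (tnth x i) - p)) =
  expR (l * (hits A x - n%:R * p)).
Proof.
rewrite -expR_sum -mulr_sumr; congr (expR (l * _)).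
by rewrite sumrB sumr_const card_ord -[p *+ n]mulr_natl.
Qed.

(** Exponential moments of a binomial count, from a quadratic bound on the
    exponential: the linear terms cancel in the mean. *)
Lemma mean_le_exp_hits n (A : set T) l : measurable A -> `|l| <= 2^-1 ->
  let p := fine (P A) in
  mean_le (power_prob P n) (fun x => expR (l * (hits A x - n%:R * p)))
          (expR (2 * l ^+ 2 * (n%:R * (p * (1 - p))))).
Proof.
move=> mA l2 p.
have p01 : 0 <= p <= 1.
  by rewrite fine_ge0// -lee_fin fineK ?fin_num_measure// probability_le1.
have PA : P A = p%:E by rewrite fineK// fin_num_measure.
have PAC : P (~` A) = (1 - p)%:E by rewrite probability_setC// PA.
have -> : (fun x : n.-tuple T => expR (l * (hits A x - n%:R * p))) =
    (fun x => \prod_(i < n) expR (l * (\1_A (tnth x i) - p))).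
  by apply/funext => x; rewrite hits_exp.
set c := expR (2 * l ^+ 2 * (p * (1 - p))).
have -> : expR (2 * l ^+ 2 * (n%:R * (p * (1 - p)))) = c ^+ n.
  by rewrite -expRM_natl; congr expR; ring.
apply: (@mean_le_prod _ _ _ P n (fun t => expR (l * (\1_A t - p))) c); split.
- by apply: measurableT_comp => //; apply: measurable_funM => //; exact: measurable_funB.
- by move=> x; exact: expR_ge0.
rewrite (eq_integral (fun x => (expR (l * (1 - p)) * \1_A x)%:E +
    (expR (l * (0 - p)) * \1_(~` A) x)%:E)%E); last first.
  move=> x _; rewrite -EFinD; congr EFin; rewrite !indicE in_setC.
  by case: (x \in A); rewrite /= ?mulr1 ?mulr0 ?addr0 ?add0r.
rewrite ge0_integralD//=; last 2 first.
- by apply/measurable_EFinP; exact: measurable_funM.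
- apply/measurable_EFinP; apply: measurable_funM => //.
  exact/measurable_indic/measurableC.
under eq_integral do rewrite EFinM.
under [X in (_ + X)%E]eq_integral do rewrite EFinM.
rewrite !ge0_integralZl ?lee_fin ?expR_ge0//; last 2 first.
- exact/measurable_EFinP/measurable_indic/measurableC.
- exact/measurable_EFinP.
rewrite !integral_indic ?setIT//; last exact: measurableC.
rewrite [P]lock /= -lock PA PAC -!EFinM -EFinD lee_fin.
apply: (@le_trans _ _ (1 + 2 * l ^+ 2 * (p * (1 - p)))); last exact: expR_ge1Dx.
move: l2 p01; rewrite ler_norml => /andP[l1 l2] /andP[p0 p1].
have := @expR_le_quadratic (l * (1 - p)).
have := @expR_le_quadratic (l * (0 - p)).
set e1 := expR _; set e2 := expR _.
move=> /(_ ltac:(nra)) h1 /(_ ltac:(nra)) h2.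
have : e2 * p + e1 * (1 - p) <=
    (1 + l * (1 - p) + 2 * (l * (1 - p)) ^+ 2) * p +
    (1 + l * (0 - p) + 2 * (l * (0 - p)) ^+ 2) * (1 - p).
  by apply: lerD; apply: ler_wpM2r => //; rewrite subr_ge0.
move/le_trans; apply.
rewrite -subr_ge0; set e := (X in 0 <= X).
have -> : e = 0 by rewrite /e; ring.
by [].
Qed.

(** The variance factor [p * (1 - p)] makes the bound equally sharp for sets of
    probability close to 0 and close to 1. *)
Lemma rare_hits n (A : set T) l y : measurable A -> 0 <= l <= 2^-1 ->
  let p := fine (P A) in
  rare (power_prob P n) [set x | y <= `|hits A x - n%:R * p|]
       (2 * expR (2 * l ^+ 2 * (n%:R * (p * (1 - p))) - l * y)).
Proof.
move=> mA /andP[l0 l2] p.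
have := @mean_le_exp_hits n A l mA; have := @mean_le_exp_hits n A (- l) mA.
rewrite normrN ger0_norm// sqrrN => /(_ l2) /= h1 /(_ l2) /= h2.
set c := expR (2 * _ * _) in h1 h2.
have e0 : 0 < expR (l * y) by exact: expR_gt0.
have h := rareU (rare_markov e0 h1) (rare_markov e0 h2).
have -> : 2 * expR (2 * l ^+ 2 * (n%:R * (p * (1 - p))) - l * y) =
    c / expR (l * y) + c / expR (l * y).
  by rewrite expRD expRN /c; ring.
apply: rareS h => x /=; rewrite -/p => yh.
have [h0|h0] := leP 0 (hits A x - n%:R * p).
  by right; rewrite /= ler_expR ler_wpM2l// -(ger0_norm h0).
by left; rewrite /= ler_expR mulNr -mulrN ler_wpM2l// -(ltr0_norm h0).
Qed.

End chernoff.

(** * Densities and the standard normal law *)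

Lemma ge0_integral_density d (T : measurableType d) (R : realType)
    (nu : {finite_measure set T -> \bar R})
    (mu : {sigma_finite_measure set T -> \bar R}) (f : T -> R)
    (g : T -> \bar R) :
  measurable_fun setT f -> (forall x, 0 <= f x) ->
  (forall A, measurable A -> nu A = (\int[mu]_(x in A) (f x)%:E)%E) ->
  measurable_fun setT g -> (forall x, (0 <= g x)%E) ->
  (\int[nu]_x g x = \int[mu]_x ((f x)%:E * g x))%E.
Proof.
move=> mf f0 nuf mg g0.
have mfE : measurable_fun setT (EFin \o f) by exact/measurable_EFinP.
have numu : nu `<< mu.
  apply/null_content_dominatesP => A mA A0.
  by rewrite nuf// null_set_integral//; exact: measurable_funTS.
have intf : mu.-integrable setT (EFin \o f).
  apply/integrableP; split => //.
  under eq_integral do rewrite /= ger0_norm//.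
  by rewrite -nuf// ltey_eq fin_num_measure.
rewrite -(Radon_Nikodym_SigmaFinite.change_of_variables numu g0)//.
apply: ge0_ae_eq_integral => //.
- apply: emeasurable_funM => //.
  exact: measurable_int (Radon_Nikodym_SigmaFinite.f_integrable numu).
- exact: emeasurable_funM.
- by move=> x _; rewrite mule_ge0//; exact: Radon_Nikodym_SigmaFinite.f_ge0.
- by move=> x _; rewrite mule_ge0// lee_fin.
have := @integral_ae_eq _ _ _ mu setT measurableT (EFin \o f)
  (Radon_Nikodym_SigmaFinite.f nu mu)
  (Radon_Nikodym_SigmaFinite.f_integrable numu) mfE.
have h : (forall E : set T, E `<=` setT -> measurable E ->
   \int[mu]_(x in E) Radon_Nikodym_SigmaFinite.f nu mu x =
   \int[mu]_(x in E) (EFin \o f) x)%E.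
  by move=> E _ mE; rewrite -Radon_Nikodym_SigmaFinite.f_integral// nuf.
move=> /(_ h) [N [mN N0 sN]]; exists N; split => // x /= nfx; apply: sN => /= nfx'.
by apply: nfx => _; rewrite nfx'// muleC.
Qed.

Section affine_change_of_variable.
Context (R : realType).
Local Notation mu := (@lebesgue_measure R).

(** Uniqueness of Lebesgue measure: the right-hand side is a measure that agrees
    with it on intervals. *)
Lemma lebesgue_measure_affine (m c : R) (c0 : 0 < c) (A : set R) : measurable A ->
  mu A = (c%:E * mu ((fun z : R => m + c * z)%R @^-1` A))%E.
Proof.
move=> mA.
have mphi : measurable_fun [set: measurableTypeR R]
    (fun z : measurableTypeR R => (m + c * z : measurableTypeR R)).
  by apply: measurable_funD => //; exact: measurable_funM.
pose phi : {mfun measurableTypeR R >-> measurableTypeR R} :=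
  HB.pack (fun z : measurableTypeR R => (m + c * z : measurableTypeR R))
    (isMeasurableFun.Build _ _ _ _ _ mphi).
pose nu : {measure set (measurableTypeR R) -> \bar R} :=
  mscale (NngNum (ltW c0)) (pushforward mu phi).
rewrite (_ : (_ * _)%E = nu mphi A)//.
apply: lebesgue_measure_unique => // _ [[a b]] _ <-.
pose J := `](a - m) / c, (b - m) / c]%classic.
have E : (fun z : R => m + c * z) @^-1` `]a, b] = J.
  apply/seteqP; split => z; rewrite /J/= !in_itv/= ltr_pdivrMr// ler_pdivlMr//;
    by rewrite ltrBlDl lerBrDl [z * c]mulrC.
transitivity (c%:E * mu J)%E; last by rewrite -E.
rewrite /J !lebesgue_measure_itv/= !lte_fin.
rewrite ltr_pM2r ?invr_gt0// ltrD2r.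
case: ifP => _; last by rewrite mule0.
by rewrite -!EFinD -EFinM; congr EFin; field; rewrite gt_eqF.
Qed.

Lemma ge0_integral_affine (m c : R) (g : R -> \bar R) : 0 < c ->
  measurable_fun setT g -> (forall x, (0 <= g x)%E) ->
  (\int[mu]_x g x = c%:E * \int[mu]_z g (m + c * z)%R)%E.
Proof.
move=> c0 mg g0.
have mphi : measurable_fun [set: measurableTypeR R]
    (fun z : measurableTypeR R => (m + c * z : measurableTypeR R)).
  by apply: measurable_funD => //; exact: measurable_funM.
pose phi : {mfun measurableTypeR R >-> measurableTypeR R} :=
  HB.pack (fun z : measurableTypeR R => (m + c * z : measurableTypeR R))
    (isMeasurableFun.Build _ _ _ _ _ mphi).
pose nu : {measure set (measurableTypeR R) -> \bar R} :=
  mscale (NngNum (ltW c0)) (pushforward mu phi).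
transitivity (\int[nu mphi]_x g x)%E.
  by apply: eq_measure_integral => A mA _; exact: (lebesgue_measure_affine m c0 mA).
rewrite /nu ge0_integral_mscale//= ge0_integral_pushforward//.
Qed.

End affine_change_of_variable.

Section standard_normal.
Context (R : realType).
Local Notation mu := (@lebesgue_measure R).
Local Notation N := (@normal_prob R 0 1).
Local Notation pdf := (@normal_pdf R 0 1).

Lemma ge0_integral_normal (m s : R) (g : R -> \bar R) :
  measurable_fun setT g -> (forall x, (0 <= g x)%E) ->
  (\int[normal_prob m s]_x g x = \int[mu]_x ((normal_pdf m s x)%:E * g x))%E.
Proof.
move=> mg g0; apply: ge0_integral_density => //.
- exact: measurable_normal_pdf.
- exact: normal_pdf_ge0.
Qed.

Lemma normal_pdf_std (x : R) :
  pdf x = (Num.sqrt (pi *+ 2))^-1 * expR (- x ^+ 2 / 2).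
Proof.
rewrite normal_pdfE ?oner_neq0// /normal_peak /normal_fun.
by rewrite expr1n mul1r subr0.
Qed.

Lemma normal_pdf_scale (m s x : R) : 0 < s ->
  normal_pdf m s x = s^-1 * pdf ((x - m) / s).
Proof.
move=> s0; rewrite normal_pdf_std normal_pdfE ?gt_eqF//.
rewrite /normal_peak /normal_fun -mulrnAr sqrtrM ?sqr_ge0// sqrtr_sqr gtr0_norm//.
rewrite invfM mulrA; congr (_ * expR _).
by rewrite exprMn exprVn -mulr_natr; field; rewrite gt_eqF.
Qed.

(** The likelihood ratio of a Gaussian shift. *)
Lemma normal_shift (c : R) (g : R -> \bar R) :
  measurable_fun setT g -> (forall x, (0 <= g x)%E) ->
  (\int[N]_z ((expR (c * z - c ^+ 2 / 2))%:E * g z) = \int[N]_z g (c + z)%R)%E.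
Proof.
move=> mg g0.
have mgc : measurable_fun setT (fun z : R => g (c + z)).
  by apply: (measurableT_comp mg); exact: measurable_funD.
rewrite !ge0_integral_normal//; last 2 first.
- apply: emeasurable_funM => //; apply/measurable_EFinP/measurableT_comp => //.
  by apply: measurable_funB => //; exact: measurable_funM.
- by move=> x; rewrite mule_ge0// lee_fin expR_ge0.
rewrite (@ge0_integral_affine _ c 1)//; last 2 first.
- apply: emeasurable_funM; first by apply/measurable_EFinP; exact: measurable_normal_pdf.
  apply: emeasurable_funM => //; apply/measurable_EFinP/measurableT_comp => //.
  by apply: measurable_funB => //; exact: measurable_funM.
- by move=> x; rewrite mule_ge0 ?mule_ge0// lee_fin ?normal_pdf_ge0 ?expR_ge0.
rewrite mul1e; apply: eq_integral => z _; rewrite mul1r muleA -EFinM.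
congr (_%:E * _)%E; rewrite !normal_pdf_std -mulrA -expRD; congr (_ * expR _).
by field.
Qed.

Lemma normal_mgf (c : R) :
  (\int[N]_z (expR (c * z - c ^+ 2 / 2))%:E = 1)%E.
Proof.
have := @normal_shift c (fun=> 1%E) (measurable_cst _) (fun=> lee01).
under eq_integral do rewrite mule1.
by rewrite integral_cst//= probability_setT mule1.
Qed.

Lemma normal_symmetric (g : R -> \bar R) :
  measurable_fun setT g -> (forall x, (0 <= g x)%E) ->
  (\int[N]_z g (- z)%R = \int[N]_z g z)%E.
Proof.
move=> mg g0.
have mN : measurable_fun [set: measurableTypeR R]
    (fun z : measurableTypeR R => (- z : measurableTypeR R)).
  exact: measurable_funN.
have mgN : measurable_fun setT (fun z : R => g (- z)) by exact: measurableT_comp.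
rewrite !ge0_integral_normal//.
have mF : measurable_fun setT (fun x => (pdf x)%:E * g x)%E.
  by apply: emeasurable_funM => //; by apply/measurable_EFinP; exact: measurable_normal_pdf.
have F0 x : (0 <= (pdf x)%:E * g x)%E.
  by rewrite mule_ge0// lee_fin normal_pdf_ge0.
transitivity (\int[pushforward mu (-%R : R -> measurableTypeR R)]_x
    ((pdf x)%:E * g x))%E.
  have -> := ge0_integral_pushforward mN mu measurableT mF (fun x _ => F0 x).
  by apply: eq_integral => z _ /=; rewrite !normal_pdf_std sqrrN.
by apply: eq_measure_integral => A mA _; exact: lebesgue_measureN.
Qed.

(** Independent centered Gaussians add up to a Gaussian: completing the square
    turns the joint density into that of the sum times a density in the first
    variable alone. *)
Lemma normal_convolution (a b c : R) (g : R -> \bar R) :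
  0 < a -> 0 < b -> 0 < c -> a ^+ 2 + b ^+ 2 = c ^+ 2 ->
  measurable_fun setT g -> (forall x, (0 <= g x)%E) ->
  (\int[N]_z \int[N]_w g (a * z + b * w)%R = \int[N]_u g (c * u)%R)%E.
Proof.
move=> a0 b0 c0 abc mg g0.
pose k (z u : R) : R := pdf z * (b^-1 * pdf ((u - a * z) / b)).
have k0 z u : 0 <= k z u.
  by rewrite /k !mulr_ge0 ?normal_pdf_ge0// invr_ge0 ltW.
have kE z u : k z u = c^-1 * pdf (u / c) * normal_pdf (a * u / c ^+ 2) (b / c) z.
  rewrite /k (normal_pdf_scale _ _ (divr_gt0 b0 c0)) !normal_pdf_std.
  set q := (Num.sqrt _)^-1.
  rewrite [LHS](_ : _ = b^-1 * q * q * expR (- z ^+ 2 / 2 - ((u - a * z) / b) ^+ 2 / 2)); last first.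
    by rewrite expRD !mulNr; ring.
  rewrite [RHS](_ : _ = b^-1 * q * q *
      expR (- (u / c) ^+ 2 / 2 - ((z - a * u / c ^+ 2) / (b / c)) ^+ 2 / 2)); last first.
    rewrite expRD !mulNr invf_div; field.
    by rewrite !gt_eqF.
  congr (_ * expR _); apply/eqP; rewrite -subr_eq0; apply/eqP.
  transitivity ((a ^+ 2 + b ^+ 2 - c ^+ 2) * (u ^+ 2 / c ^+ 2 - z ^+ 2) / b ^+ 2 / 2).
    by field; rewrite !gt_eqF.
  by rewrite abc subrr !mul0r.
have mpdf : measurable_fun setT pdf by exact: measurable_normal_pdf.
have mpdfE : measurable_fun setT (fun x => (pdf x)%:E) by exact/measurable_EFinP.
have mk2 : measurable_fun setT (fun p : R * R => k p.1 p.2).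
  apply: measurable_funM; first exact: measurableT_comp.
  apply: measurable_funM => //; apply: measurableT_comp => //.
  apply: measurable_funM => //; apply: measurable_funB => //.
  exact: measurable_funM.
have mF : measurable_fun setT (fun p : R * R => (k p.1 p.2)%:E * g p.2)%E.
  apply: emeasurable_funM; first exact/measurable_EFinP.
  exact: (measurableT_comp mg measurable_snd).
have F0 (p : R * R) : (0 <= (k p.1 p.2)%:E * g p.2)%E.
  by rewrite mule_ge0// lee_fin.
have mgab z : measurable_fun setT (fun w : R => g (a * z + b * w)).
  by apply: (measurableT_comp mg); exact: measurable_funD.
have mgab2 : measurable_fun setT (fun p : R * R => g (a * p.1 + b * p.2)).
  by apply: (measurableT_comp mg); apply: measurable_funD; exact: measurable_funM.
rewrite ge0_integral_normal//; last 2 first.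
- exact: (measurable_fun_fubini_tonelli_F (m2 := N)
    (fun p : R * R => g (a * p.1 + b * p.2)%R) mgab2).
- by move=> z; exact: integral_ge0.
transitivity (\int[mu]_z \int[mu]_u ((k z u)%:E * g u))%E.
  apply: eq_integral => z _.
  rewrite ge0_integral_normal//.
  rewrite -ge0_integralZl//; last 3 first.
  - by apply: emeasurable_funM; [exact: mpdfE|exact: mgab].
  - by move=> x _; rewrite mule_ge0// lee_fin normal_pdf_ge0.
  - by rewrite lee_fin normal_pdf_ge0.
  rewrite [RHS](@ge0_integral_affine _ (a * z) b)//; last 2 first.
  - exact: (measurableT_comp mF (measurable_pair1 z)).
  - by move=> u; exact: (F0 (z, u)).
  rewrite -ge0_integralZl//; last 3 first.
  - have mh : measurable_fun setT (fun w : R => a * z + b * w).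
      by apply: measurable_funD => //; exact: measurable_funM.
    exact: (measurableT_comp (measurableT_comp mF (measurable_pair1 z)) mh).
  - by move=> u _; exact: (F0 (z, _)).
  - by rewrite lee_fin ltW.
  apply: eq_integral => w _; rewrite !muleA -!EFinM; congr (_%:E * _)%E.
  rewrite /k [_ + b * w]addrC addrK [b * w]mulrC mulfK ?gt_eqF//.
  by field; rewrite gt_eqF.
have /= -> := @fubini_tonelli _ _ _ _ R mu mu _ mF F0.
transitivity (\int[mu]_u ((c^-1 * pdf (u / c))%:E * g u))%E.
  apply: eq_integral => u _.
  rewrite ge0_integralZr//; last 2 first.
  - apply/measurable_EFinP.
    exact: (measurableT_comp mk2 (measurable_pair2 u)).
  - by move=> z _; rewrite lee_fin.
  congr (_ * _)%E.
  under eq_integral do rewrite kE EFinM.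
  rewrite ge0_integralZl//; last 3 first.
  - by apply/measurable_EFinP; exact: measurable_normal_pdf.
  - by move=> z _; rewrite lee_fin normal_pdf_ge0.
  - by rewrite lee_fin mulr_ge0 ?normal_pdf_ge0// invr_ge0 ltW.
  by rewrite integral_normal_pdf mule1.
rewrite (@ge0_integral_affine _ 0 c)//; last 2 first.
- apply: emeasurable_funM => //; apply/measurable_EFinP/measurable_funM => //.
  by apply: measurableT_comp => //; exact: measurable_funM.
- by move=> u; rewrite mule_ge0// lee_fin mulr_ge0 ?normal_pdf_ge0// invr_ge0 ltW.
have mgc : measurable_fun setT (fun u : R => g (c * u)).
  by apply: (measurableT_comp mg); exact: measurable_funM.
rewrite ge0_integral_normal// -ge0_integralZl//; last 3 first.
- apply: emeasurable_funM.
    apply/measurable_EFinP/measurable_funM => //.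
    apply: measurableT_comp => //; apply: measurable_funM => //.
    by apply: measurable_funD => //; exact: measurable_funM.
  apply: (measurableT_comp mg).
  by apply: measurable_funD => //; exact: measurable_funM.
- by move=> u _; rewrite mule_ge0// lee_fin mulr_ge0 ?normal_pdf_ge0// invr_ge0 ltW.
- by rewrite lee_fin ltW.
apply: eq_integral => u _; rewrite !muleA -!EFinM add0r; congr (_%:E * _)%E.
by rewrite [c * u]mulrC mulfK ?gt_eqF//; field; rewrite gt_eqF.
Qed.

End standard_normal.

(** * Signed means *)

Section has_mean.
Context d (T : measurableType d) (R : realType) (P : probability T R).
Implicit Types (f g : T -> R) (a b c k : R).

(** Integrability and the value of the integral in one predicate, so that
    linearity can be used on real numbers without side conditions. *)
Definition has_mean f c :=
  P.-integrable setT (EFin \o f) /\ (\int[P]_x (f x)%:E = c%:E)%E.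

Lemma has_mean_measurable f c : has_mean f c -> measurable_fun setT f.
Proof. by case=> /measurable_int/measurable_EFinP. Qed.

Lemma has_meanD f g a b : has_mean f a -> has_mean g b ->
  has_mean (fun x => f x + g x) (a + b).
Proof.
move=> [mf fa] [mg gb]; split.
  rewrite (_ : _ \o _ = (EFin \o f) \+ (EFin \o g))%E//; exact: integrableD.
under eq_integral do rewrite EFinD.
by rewrite integralD//= fa gb.
Qed.

Lemma has_meanZ k f a : has_mean f a -> has_mean (fun x => k * f x) (k * a).
Proof.
move=> [mf fa]; split.
  rewrite (_ : _ \o _ = fun x => k%:E * (EFin \o f) x)%E//; exact: integrableZl.
under eq_integral do rewrite EFinM.
by rewrite integralZl// fa.
Qed.

Lemma has_mean_cst a : has_mean (fun=> a) a.
Proof.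
split; last by rewrite integral_cst//= probability_setT mule1.
exact: finite_measure_integrable_cst.
Qed.

Lemma has_meanB f g a b : has_mean f a -> has_mean g b ->
  has_mean (fun x => f x - g x) (a - b).
Proof.
move=> fa /(has_meanZ (-1)) gb; rewrite -[- b]mulN1r.
rewrite (_ : (fun x => _) = fun x => f x + -1 * g x); first exact: has_meanD.
by apply/funext => x; rewrite mulN1r.
Qed.

Lemma has_mean_le f g a b : has_mean f a -> has_mean g b ->
  (forall x, f x <= g x) -> a <= b.
Proof.
move=> [mf fa] [mg gb] fg; rewrite -lee_fin -fa -gb; apply: le_integral => //.
by move=> x _; rewrite lee_fin.
Qed.

Lemma has_mean_uniq f a b : has_mean f a -> has_mean f b -> a = b.
Proof. by move=> [_ fa] [_ fb]; apply: EFin_inj; rewrite -fa -fb. Qed.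

Lemma mean_le_has_mean f c : mean_le P f c -> exists2 a, has_mean f a & 0 <= a <= c.
Proof.
move=> fc; have [a ac fa] := mean_le_fin fc; exists a => //; split => //.
case: fc => mf f0 _.
apply/integrableP; split; first exact/measurable_EFinP.
by under eq_integral do rewrite /= ger0_norm//; rewrite fa ltry.
Qed.

Lemma has_mean_mean_le f c : (forall x, 0 <= f x) -> has_mean f c -> mean_le P f c.
Proof.
by move=> f0 fc; split => //; [exact: has_mean_measurable fc|case: fc => _ ->].
Qed.

Lemma has_mean_dominated f g b : measurable_fun setT f ->
  (forall x, `|f x| <= g x) -> has_mean g b -> exists a, has_mean f a.
Proof.
move=> mf fg [ig gb].
have fi : P.-integrable setT (EFin \o f).
  apply: (le_integrable measurableT _ _ ig); first exact/measurable_EFinP.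
  by move=> x _ /=; rewrite lee_fin (le_trans (fg x))// ler_norm.
exists (fine (\int[P]_x (f x)%:E)); split => //.
by rewrite fineK//; exact: integrable_fin_num.
Qed.

Lemma has_mean_bounded f b : measurable_fun setT f ->
  (forall x, `|f x| <= b) -> exists a, has_mean f a.
Proof. by move=> mf fb; apply: has_mean_dominated mf fb (has_mean_cst b). Qed.

Lemma has_mean_indic (A : set T) : measurable A -> has_mean \1_A (fine (P A)).
Proof.
move=> mA; have [a ha] : exists a, has_mean \1_A a.
  apply: (@has_mean_bounded _ 1) => // x.
  by rewrite indicE ger0_norm ?ler0n// lern1; case: (_ \in _).
suff <- : a = fine (P A) by [].
by case: ha => _; rewrite integral_indic// setIT => ->.
Qed.

Lemma eq_has_mean f g c : f =1 g -> has_mean f c -> has_mean g c.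
Proof. by move=> /funext ->. Qed.

Lemma has_mean_eq f g a b : has_mean f a -> f =1 g -> a = b -> has_mean g b.
Proof. by move=> fa /funext <- <-. Qed.

(** Distance at most [c], phrased with additions so that it makes sense for
    infinite values. *)
Definition eclose (c : R) (a b : \bar R) := (a <= b + c%:E /\ b <= a + c%:E)%E.

Lemma eclose_refl (a : \bar R) : eclose 0 a a.
Proof. by rewrite /eclose adde0. Qed.

Lemma eclose_fin (c a b : R) : `|a - b| <= c -> eclose c a%:E b%:E.
Proof. by rewrite ler_norml => /andP[? ?]; split; rewrite -EFinD lee_fin; lra. Qed.

Lemma eclose_trans c c' (x y z : \bar R) :
  eclose c x y -> eclose c' y z -> eclose (c + c') x z.
Proof.
move=> [xy yx] [yz zy]; split; rewrite EFinD.
  by rewrite [(c%:E + _)%E]addeC addeA (le_trans xy)// leeD2r.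
by rewrite addeA (le_trans zy)// leeD2r.
Qed.

Lemma eclose_integral c (u w : T -> \bar R) :
  measurable_fun setT u -> (forall x, (0 <= u x)%E) ->
  measurable_fun setT w -> (forall x, (0 <= w x)%E) -> 0 <= c ->
  (forall x, eclose c (u x) (w x)) ->
  eclose c (\int[P]_x u x)%E (\int[P]_x w x)%E.
Proof.
move=> mu u0 mw w0 c0 uw.
have cE : (c%:E = \int[P]_x (cst c%:E) x)%E.
  by rewrite integral_cst//= probability_setT mule1.
split; rewrite [in X in (_ <= _ + X)%E]cE -ge0_integralD//;
  (apply: ge0_le_integral => //; [exact: emeasurable_funD|]) => x _ /=;
  by case: (uw x).
Qed.

End has_mean.

(** * A smooth substitute for the minimum of 1 and the likelihood ratio *)

Section taylor.
Context (R : realFieldType).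
Implicit Types (u v : R -> R) (K L y p m : R) (k : nat).

(** Second-order expansion at 0 with a remainder and coefficients bounded by
    one constant; keeping that constant explicit is what makes the expansion
    below uniform in the likelihood ratio. *)
Definition expansion K u :=
  exists c0 c1 c2, [/\ `|c0| <= K, `|c1| <= K, `|c2| <= K &
    forall y, `|y| <= 2^-1 ->
      `|u y - (c0 + c1 * y + c2 * y ^+ 2)| <= K * `|y| ^+ 3].

Lemma expansion_ge0 K u : expansion K u -> 0 <= K.
Proof. by move=> [c0 [_ [_ [h _ _ _]]]]; exact: le_trans h. Qed.

Lemma expansionW K K' u : K <= K' -> expansion K u -> expansion K' u.
Proof.
move=> KK' [c0 [c1 [c2 [h0 h1 h2 h]]]]; exists c0, c1, c2; split;
  [exact: le_trans KK'..|].
by move=> y /h /le_trans; apply; rewrite ler_wpM2r// exprn_ge0.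
Qed.

Lemma expansionD K K' u v : expansion K u -> expansion K' v ->
  expansion (K + K') (fun y => u y + v y).
Proof.
move=> [c0 [c1 [c2 [h0 h1 h2 h]]]] [d0 [d1 [d2 [g0 g1 g2 g]]]].
exists (c0 + d0), (c1 + d1), (c2 + d2); split; try exact: le_trans (ler_normD _ _) (lerD _ _).
move=> y y2.
rewrite (_ : _ - _ = (u y - (c0 + c1 * y + c2 * y ^+ 2)) +
   (v y - (d0 + d1 * y + d2 * y ^+ 2))); last by ring.
by rewrite (le_trans (ler_normD _ _))// mulrDl lerD ?h ?g.
Qed.

Lemma expansion_cst K (a : R) : `|a| <= K -> expansion K (fun=> a).
Proof.
move=> aK; have K0 : 0 <= K by exact: le_trans aK.
exists a, 0, 0; rewrite normr0; split => // y _.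
by rewrite !mul0r !addr0 subrr normr0 mulr_ge0// exprn_ge0.
Qed.

Lemma expansion_id : expansion 1 (fun y => y).
Proof.
exists 0, 1, 0; rewrite normr0 normr1; split => // y _.
by rewrite add0r mul1r mul0r addr0 subrr normr0 mulr_ge0// exprn_ge0.
Qed.

Lemma expansion_cubic K u :
  (forall y, `|y| <= 2^-1 -> `|u y| <= K * `|y| ^+ 3) -> 0 <= K -> expansion K u.
Proof.
move=> h K0; exists 0, 0, 0; rewrite normr0; split => // y /h.
by rewrite !mul0r !addr0 subr0.
Qed.

Lemma quadratic_bound K (c0 c1 c2 y : R) : `|c0| <= K -> `|c1| <= K ->
  `|c2| <= K -> `|y| <= 2^-1 -> `|c0 + c1 * y + c2 * y ^+ 2| <= 2 * K.
Proof.
move=> h0 h1 h2 y2.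
have y0 := normr_ge0 y.
have K0 : 0 <= K by exact: le_trans h0.
apply: le_trans (ler_normD _ _) _; apply: le_trans (lerD (ler_normD _ _) (lexx _)) _.
rewrite (normrM c1) (normrM c2) normrX.
have e1 : `|c1| * `|y| <= K * 2^-1 by apply: ler_pM.
have y4 : `|y| ^+ 2 <= 2^-1.
  have : `|y| ^+ 2 <= 2^-1 * `|y| by rewrite expr2 ler_wpM2r.
  by move=> ?; lra.
have e2 : `|c2| * `|y| ^+ 2 <= K * 2^-1 by apply: ler_pM => //; rewrite exprn_ge0.
lra.
Qed.

Lemma expansionM K u v : 1 <= K -> expansion K u -> expansion K v ->
  expansion (20 * K ^+ 2) (fun y => u y * v y).
Proof.
move=> K1 [c0 [c1 [c2 [h0 h1 h2 h]]]] [d0 [d1 [d2 [g0 g1 g2 g]]]].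
have K0 : 0 <= K by lra.
have KK (a b : R) : `|a| <= K -> `|b| <= K -> `|a * b| <= K ^+ 2.
  by move=> ? ?; rewrite normrM expr2 ler_pM.
have KK0 : 0 <= K ^+ 2 by rewrite exprn_ge0.
exists (c0 * d0), (c0 * d1 + c1 * d0), (c0 * d2 + c1 * d1 + c2 * d0); split.
- by have := KK _ _ h0 g0; lra.
- have := ler_normD (c0 * d1) (c1 * d0).
  by have := KK _ _ h0 g1; have := KK _ _ h1 g0; lra.
- have := ler_normD (c0 * d2 + c1 * d1) (c2 * d0).
  have := ler_normD (c0 * d2) (c1 * d1).
  by have := KK _ _ h0 g2; have := KK _ _ h1 g1; have := KK _ _ h2 g0; lra.
move=> y y2; have y0 := normr_ge0 y.
set q := c0 + c1 * y + c2 * y ^+ 2 in h *.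
set q' := d0 + d1 * y + d2 * y ^+ 2 in g *.
pose Q : R -> R := fun z => c0 + c1 * z + c2 * z ^+ 2.
pose Q' : R -> R := fun z => d0 + d1 * z + d2 * z ^+ 2.
have qK : `|Q y| <= 2 * K by exact: quadratic_bound.
have qK' : `|Q' y| <= 2 * K by exact: quadratic_bound.
have y3 : 0 <= `|y| ^+ 3 by rewrite exprn_ge0.
have y31 : `|y| ^+ 3 <= 1 by rewrite exprn_ile1//; lra.
have hu : `|u y - Q y| <= K * `|y| ^+ 3 by exact: h.
have hv : `|v y - Q' y| <= K * `|y| ^+ 3 by exact: g.
rewrite (_ : _ - _ = (u y - Q y) * (v y - Q' y) + (u y - Q y) * Q' y +
   Q y * (v y - Q' y) + ((c1 * d2 + c2 * d1) + c2 * d2 * y) * y ^+ 3); last first.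
  by rewrite /Q /Q'; ring.
have e1 : `|(u y - Q y) * (v y - Q' y)| <= K ^+ 2 * `|y| ^+ 3.
  rewrite normrM (le_trans (ler_pM _ _ hu hv))//.
  rewrite [leLHS](_ : _ = (K ^+ 2 * `|y| ^+ 3) * `|y| ^+ 3); last by ring.
  by rewrite ler_piMr// mulr_ge0.
have e2 : `|(u y - Q y) * Q' y| <= 2 * K ^+ 2 * `|y| ^+ 3.
  rewrite normrM (le_trans (ler_pM _ _ hu qK'))//.
  by rewrite le_eqVlt; apply/orP; left; apply/eqP; ring.
have e3 : `|Q y * (v y - Q' y)| <= 2 * K ^+ 2 * `|y| ^+ 3.
  rewrite normrM (le_trans (ler_pM _ _ qK hv))//.
  by rewrite le_eqVlt; apply/orP; left; apply/eqP; ring.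
have e4 : `|((c1 * d2 + c2 * d1) + c2 * d2 * y) * y ^+ 3| <= 3 * K ^+ 2 * `|y| ^+ 3.
  rewrite normrM normrX ler_wpM2r//.
  apply: le_trans (ler_normD _ _) _; rewrite (normrM _ y).
  have : `|c2 * d2| * `|y| <= K ^+ 2 * 1 by apply: ler_pM => //; [exact: KK|lra].
  have := ler_normD (c1 * d2) (c2 * d1).
  by have := KK _ _ h1 g2; have := KK _ _ h2 g1; lra.
do 3 (apply: le_trans (ler_normD _ _) _; rewrite -?lerBrDr).
by nra.
Qed.

Lemma expansion_expr k : exists K, expansion K (fun y => (1 + y) ^+ k).
Proof.
elim: k => [|k [K hK]].
  by exists 1; apply: expansion_cst; rewrite normr1.
have h1 : expansion (1 + 1) (fun y => 1 + y).
  by apply: expansionD expansion_id; apply: expansion_cst; rewrite normr1.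
have K0 := expansion_ge0 hK.
exists (20 * (K + 2) ^+ 2).
have := @expansionM (K + 2) _ _ _ (expansionW _ h1) (expansionW _ hK).
under [X in expansion _ X]eq_fun do rewrite -exprS.
by apply; lra.
Qed.

Lemma expansion_value K u : expansion K u -> exists c1 c2,
  [/\ `|u 0| <= K, `|c1| <= K, `|c2| <= K &
    forall y, `|y| <= 2^-1 ->
      `|u y - (u 0 + c1 * y + c2 * y ^+ 2)| <= K * `|y| ^+ 3].
Proof.
move=> [c0 [c1 [c2 [h0 h1 h2 h]]]]; exists c1, c2.
suff -> : u 0 = c0 by [].
have := h 0; rewrite normr0 !expr0n/= !mulr0 !addr0 invr_ge0 ler0n => /(_ isT).
by rewrite normr_le0 subr_eq0 => /eqP.
Qed.

Lemma expansion_inv K m : 1 <= K -> 0 < m -> exists K', forall u,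
  expansion K u -> u 0 = 0 -> (forall y, `|y| <= 2^-1 -> m <= 1 + u y) ->
  expansion K' (fun y => (1 + u y)^-1).
Proof.
move=> K1 m0; have K0 : 0 <= K by lra.
exists (2 * K + 20 * K ^+ 2 + 27 * K ^+ 3 / m + 1) => u hu u0 um.
have [c1 [c2 [_ h1 h2 h]]] := expansion_value hu.
have uy y : `|y| <= 2^-1 -> `|u y| <= 3 * K * `|y|.
  move=> y2; have y0 := normr_ge0 y; have := h y y2; rewrite u0 add0r => e.
  have -> : u y = (u y - (c1 * y + c2 * y ^+ 2)) + (c1 * y + c2 * y ^+ 2) by ring.
  apply: le_trans (ler_normD _ _) _.
  have e1 : `|c1 * y + c2 * y ^+ 2| <= K * `|y| + K * `|y| ^+ 2.
    by apply: le_trans (ler_normD _ _) _; rewrite (normrM c1) (normrM c2) normrX lerD// ler_wpM2r// exprn_ge0.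
  have e2 : `|y| ^+ 2 <= 2^-1 * `|y| by rewrite expr2 ler_wpM2r.
  have e3 : `|y| ^+ 3 <= 2^-1 * `|y|.
    by rewrite exprSr (le_trans (ler_wpM2r _ e2))//; nra.
  by nra.
have hc : expansion (27 * K ^+ 3 / m) (fun y => - (u y ^+ 3 * (1 + u y)^-1)).
  apply: expansion_cubic; last by rewrite !mulr_ge0 ?exprn_ge0// invr_ge0 ltW.
  move=> y y2; rewrite normrN normrM normrX.
  have e1 : `|u y| ^+ 3 <= (3 * K * `|y|) ^+ 3 by rewrite lerXn2r ?nnegrE ?mulr_ge0 ?uy.
  have e2 : `|(1 + u y)^-1| <= m^-1.
    rewrite normfV lef_pV2 ?posrE ?(le_trans (um y y2)) ?ler_norm//.
    by rewrite normr_gt0 gt_eqF// (lt_le_trans m0 (um y y2)).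
  rewrite (le_trans (ler_pM _ _ e1 e2)) ?exprn_ge0//.
  by rewrite le_eqVlt; apply/orP; left; apply/eqP; field; rewrite gt_eqF.
have h1u : expansion (1 + K) (fun y => 1 + (-1) * u y).
  apply: expansionD; first by apply: expansion_cst; rewrite normr1.
  move: hu => [a0 [a1 [a2 [b0 b1 b2 b]]]]; exists (- a0), (- a1), (- a2).
  rewrite !normrN; split => // y /b; rewrite -normrN; congr (`|_| <= _); ring.
have := expansionD (expansionD h1u (expansionM K1 hu hu)) hc.
have : forall y, `|y| <= 2^-1 -> (1 + u y)^-1 =
    1 + (-1) * u y + u y * u y + - (u y ^+ 3 * (1 + u y)^-1).
  move=> y /um h1u'; field; rewrite gt_eqF//; exact: lt_le_trans h1u'.
move=> e [a0 [a1 [a2 [b0 b1 b2 b]]]].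
apply: (@expansionW (1 + K + 20 * K ^+ 2 + 27 * K ^+ 3 / m)).
  by lra.
exists a0, a1, a2; split => // y y2; rewrite (e y y2); exact: b.
Qed.

(** A rational function of the likelihood ratio that is uniformly within [1/k]
    of its minimum with 1, while being smooth in relative increments. *)
Definition soft_min k L := (L + L ^+ k) / (1 + L ^+ k).

Let den_gt0 k L : 0 <= L -> 0 < 1 + L ^+ k.
Proof. by move=> L0; rewrite ltr_wpDr// exprn_ge0. Qed.

Lemma soft_min_ge0 k L : 0 <= L -> 0 <= soft_min k L.
Proof.
move=> L0; rewrite divr_ge0 ?addr_ge0 ?exprn_ge0//; exact/ltW/den_gt0.
Qed.

Lemma expr_ge_bernoulli k (x : R) : -1 <= x -> 1 + k%:R * x <= (1 + x) ^+ k.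
Proof.
move=> x1; elim: k => [|k IHk]; first by rewrite mul0r addr0 expr0.
have h : (1 + k%:R * x) * (1 + x) <= (1 + x) ^+ k.+1.
  by rewrite exprSr ler_wpM2r//; lra.
apply: le_trans h.
have := mulr_ge0 (ler0n R k) (sqr_ge0 x); rewrite -natr1 => h.
by rewrite -subr_ge0 (le_trans h)// le_eqVlt; apply/orP; left; apply/eqP; ring.
Qed.

Lemma soft_min_close k L : (0 < k)%N -> 0 <= L ->
  `|soft_min k L - Num.min 1 L| <= k%:R^-1.
Proof.
move=> k0 L0; have kR : 0 < k%:R :> R by rewrite ltr0n.
have d0 := den_gt0 k L0; have Lk0 : 0 <= L ^+ k by rewrite exprn_ge0.
have [L1|L1] := leP 1 L.
- rewrite (_ : _ - _ = (L - 1) / (1 + L ^+ k)); last first.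
    by rewrite /soft_min; field; rewrite gt_eqF.
  rewrite ger0_norm; last by rewrite divr_ge0 ?subr_ge0// ltW.
  rewrite ler_pdivrMr// ler_pdivlMl//.
  have := @expr_ge_bernoulli k (L - 1); rewrite subrKC.
  by move=> /(_ ltac:(lra)); lra.
- rewrite (_ : _ - _ = L ^+ k * (1 - L) / (1 + L ^+ k)); last first.
    by rewrite /soft_min; field; rewrite gt_eqF.
  rewrite ger0_norm; last by rewrite divr_ge0 ?mulr_ge0 ?subr_ge0 ?(ltW L1) ?(ltW d0).
  rewrite ler_pdivrMr// ler_pdivlMl//.
  have [L00|Ln0] := eqVneq L 0.
    by rewrite L00 expr0n eqn0Ngt k0/= mul0r mulr0 addr0 ler01.
  have Lp : 0 < L by rewrite lt_neqAle eq_sym Ln0.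
  have := @expr_ge_bernoulli k (L^-1 - 1); rewrite subrKC exprVn.
  have LV1 : 1 <= L^-1 by rewrite invf_ge1// ltW.
  move=> /(_ ltac:(lra)) h.
  have h2 : L ^+ k * (1 + k%:R * (L^-1 - 1)) <= 1.
    by rewrite -[leRHS](@divff _ (L ^+ k)) ?expf_neq0// ler_wpM2l.
  have : L ^+ k * (k%:R * (1 - L)) <= L ^+ k * (k%:R * (L^-1 - 1)).
    apply: ler_wpM2l => //; apply: ler_wpM2l; first exact: ler0n.
    rewrite -subr_ge0 (_ : _ - _ = (1 - L) ^+ 2 / L); last by field.
    by rewrite divr_ge0 ?sqr_ge0.
  by nra.
Qed.

(** The constant [K] is uniform in [L] because [soft_min k (L * (1 + y))] depends
    on [L] only through [b = L / (1 + L ^ k)] and [p = L ^ k / (1 + L ^ k)], both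
    in [[0, 1]]. For large increments [y] boundedness of [soft_min] suffices. *)
Lemma soft_min_expansion k : (0 < k)%N -> exists2 K, 0 <= K & forall L, 0 <= L ->
  exists c1 c2, forall y, -1 <= y ->
  `|soft_min k (L * (1 + y)) - (soft_min k L + c1 * y + c2 * y ^+ 2)| <=
    K * Num.min (y ^+ 2) (`|y| ^+ 3).
Proof.
move=> k0; have [E hE] := expansion_expr k.
have E0 := expansion_ge0 hE.
pose K1 := 20 * (E + 3) ^+ 2.
have K11 : 1 <= K1 by rewrite /K1; nra.
pose m : R := 2^-1 ^+ k.
have m0 : 0 < m by rewrite exprn_gt0.
have [K2 hK2] := expansion_inv K11 m0.
pose K3 := 20 * (2 * K1 + `|K2| + 1) ^+ 2.
have K30 : 0 <= K3 by rewrite mulr_ge0// exprn_ge0//; have := normr_ge0 K2; lra.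
exists (7 * K3 + 24); first by lra.
move=> L L0; have Lk0 : 0 <= L ^+ k by rewrite exprn_ge0.
have d0 := den_gt0 k L0.
pose b := L / (1 + L ^+ k); pose p := L ^+ k / (1 + L ^+ k).
have p0 : 0 <= p by rewrite divr_ge0// ltW.
have p1 : p <= 1 by rewrite ler_pdivrMr// mul1r; lra.
have b0 : 0 <= b by rewrite divr_ge0// ltW.
have b1 : b <= 1.
  rewrite ler_pdivrMr// mul1r; have [?|L1] := leP L 1; first by lra.
  suff : L <= L ^+ k by lra.
  by rewrite -[leLHS]expr1 ler_weXn2l// ltW.
have hp : expansion K1 (fun y => p * ((1 + y) ^+ k - 1)).
  apply: (@expansionM (E + 3)); first by lra.
    by apply: expansion_cst; rewrite ger0_norm//; lra.
  apply: (@expansionW (E + 1)); first by lra.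
  by apply: expansionD => //; apply: expansion_cst; rewrite normrN1.
have hb : expansion K1 (fun y => b * (1 + y)).
  apply: (@expansionM (E + 3)); first by lra.
    by apply: expansion_cst; rewrite ger0_norm//; lra.
  apply: (@expansionW (1 + 1)); first by lra.
  by apply: expansionD expansion_id; apply: expansion_cst; rewrite normr1.
have hpk : expansion K1 (fun y => p * (1 + y) ^+ k).
  apply: (@expansionM (E + 3)); first by lra.
    by apply: expansion_cst; rewrite ger0_norm//; lra.
  by apply: expansionW hE; lra.
have hv : expansion K2 (fun y => (1 + p * ((1 + y) ^+ k - 1))^-1).
  apply: hK2 => //; first by rewrite addr0 expr1n subrr mulr0.
  move=> y; rewrite ler_norml => /andP[y1 y2].
  have : m <= (1 + y) ^+ k by rewrite lerXn2r ?nnegrE//; lra.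
  have : m <= 1 by rewrite exprn_ile1//; lra.
  by nra.
have hs : expansion K3 (fun y => soft_min k (L * (1 + y))).
  have := @expansionM (2 * K1 + `|K2| + 1) _ _ _
    (expansionW _ (expansionD hb hpk)) (expansionW _ hv).
  have := normr_ge0 K2; have := ler_norm K2 => ? ?.
  move=> /(_ ltac:(lra) ltac:(lra) ltac:(lra)) [c0 [c1 [c2 [h0 h1 h2 h]]]].
  exists c0, c1, c2; split => // y y2.
  suff -> : soft_min k (L * (1 + y)) = (b * (1 + y) + p * (1 + y) ^+ k) *
     (1 + p * ((1 + y) ^+ k - 1))^-1 by exact: h.
  have y1 : 0 <= 1 + y by move: y2; rewrite ler_norml => /andP[]; lra.
  have dy : 0 < 1 + (L * (1 + y)) ^+ k by apply: den_gt0; rewrite mulr_ge0.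
  rewrite /soft_min /b /p; move: dy; rewrite exprMn => dy; field.
  rewrite gt_eqF//= gt_eqF//=.
  suff -> : 1 + L ^+ k + L ^+ k * ((1 + y) ^+ k - 1) = 1 + L ^+ k * (1 + y) ^+ k.
    by [].
  by ring.
have [c1 [c2 [hs0 hc1 hc2 h]]] := expansion_value hs.
have sm L' : 0 <= L' -> soft_min k L' <= 2.
  move=> L'0; have := soft_min_close k0 L'0; rewrite ler_norml => /andP[_].
  have : k%:R^-1 <= 1 :> R by rewrite invf_le1 ?ltr0n// ler1n.
  have := ge_min 1 1 L'; rewrite lexx/=.
  by move=> ? ? ?; lra.
exists c1, c2 => y y1.
rewrite [soft_min k L](_ : _ = soft_min k (L * (1 + 0))); last by rewrite addr0 mulr1.
have y0 := normr_ge0 y.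
(* For [`|y| > 1 / 2], constants and [`|y|] are bounded by multiples of [y ^ 2]. *)
have [y2|y2] := leP `|y| 2^-1.
  have -> : Num.min (y ^+ 2) (`|y| ^+ 3) = `|y| ^+ 3.
    apply/min_idPr; rewrite -[y ^+ 2]real_normK ?num_real// exprSr -[leRHS]mulr1.
    by rewrite ler_wpM2l ?exprn_ge0//; lra.
  by apply: (le_trans (h y y2)); rewrite ler_wpM2r ?exprn_ge0//; lra.
have yy0 : 0 <= y ^+ 2 by rewrite sqr_ge0.
have e1 : `|y| <= 2 * y ^+ 2.
  by rewrite -[y ^+ 2]real_normK ?num_real//; nra.
have e2 : 1 <= 4 * y ^+ 2.
  by rewrite -[y ^+ 2]real_normK ?num_real//; nra.
have hy : `|soft_min k (L * (1 + y)) -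
     (soft_min k (L * (1 + 0)) + c1 * y + c2 * y ^+ 2)| <= (3 * K3 + 8) * y ^+ 2.
  have s1 : 0 <= soft_min k (L * (1 + y)) by apply: soft_min_ge0; rewrite mulr_ge0//; lra.
  have s2 : 0 <= soft_min k (L * (1 + 0)) by apply: soft_min_ge0; rewrite mulr_ge0//; lra.
  have s3 : soft_min k (L * (1 + y)) <= 2 by apply: sm; rewrite mulr_ge0//; lra.
  have s4 : soft_min k (L * (1 + 0)) <= 2 by apply: sm; rewrite mulr_ge0//; lra.
  have t1 : `|c1 * y| <= K3 * `|y| by rewrite normrM ler_wpM2r.
  have t2 : `|c2 * y ^+ 2| <= K3 * y ^+ 2 by rewrite normrM (ger0_norm yy0) ler_wpM2r.
  have t3 : K3 * `|y| <= K3 * (2 * y ^+ 2) by rewrite ler_wpM2l.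
  move: t1 t2; rewrite !ler_norml => /andP[? ?] /andP[? ?].
  by apply/andP; split; lra.
have y3 : y ^+ 2 <= 2 * `|y| ^+ 3.
  have : `|y| ^+ 3 = `|y| * y ^+ 2 by rewrite exprS real_normK ?num_real.
  by move=> ->; nra.
apply: (le_trans hy); rewrite /Num.min; case: ifP => _; nra.
Qed.

End taylor.

(** * Replacing likelihood-ratio factors by log-normal ones *)

Section replacement.
Context (R : realType).
Local Notation N := (@normal_prob R 0 1).

Definition lognormal (t z : R) := expR (Num.sqrt t * z - t / 2).

Lemma lognormal_gt0 t z : 0 < lognormal t z.
Proof. exact: expR_gt0. Qed.

Lemma measurable_lognormal t : measurable_fun setT (lognormal t).
Proof.
apply: measurableT_comp => //.
by apply: measurable_funB => //; exact: measurable_funM.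
Qed.

Context d (T : measurableType d) (P : probability T R) (Y : T -> R) (F : R -> R).
Hypothesis mY : measurable_fun setT Y.
Hypothesis Y1 : forall x, 0 <= 1 + Y x.
Hypothesis mF : measurable_fun setT F.
Hypothesis F0 : forall L, 0 <= F L.

Let mFE : measurable_fun setT (EFin \o F).
Proof. exact/measurable_EFinP. Qed.

Let m1Y : measurable_fun setT (fun x => 1 + Y x).
Proof. exact: measurable_funD. Qed.

(** Swapping one factor at a time: a product of independent factors with mean 1
    may be replaced by a product of log-normal factors, at the price of one
    swapping error per factor, because the log-normal laws form a convolution
    semigroup. *)
Lemma lognormal_replacement (s e : R) : 0 < s -> 0 <= e ->
  (forall L, 0 <= L ->
    eclose e (\int[P]_x (F (L * (1 + Y x)))%:E)%E
             (\int[N]_z (F (L * lognormal s z))%:E)%E) ->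
  forall n L, 0 <= L ->
    eclose (n%:R * e)
      (\int[power_prob P n]_x (F (L * \prod_(i < n) (1 + Y (tnth x i))))%:E)%E
      (\int[N]_z (F (L * lognormal (n%:R * s) z))%:E)%E.
Proof.
move=> s0 e0 step.
have FE0 L : (0 <= (F L)%:E)%E by rewrite lee_fin.
have mprod n : measurable_fun setT
    (fun x : n.-tuple T => \prod_(i < n) (1 + Y (tnth x i))).
  exact: (@measurable_tuple_prod _ _ _ n (fun t => 1 + Y t)).
have mln t L : measurable_fun setT (fun z => (F (L * lognormal t z))%:E).
  apply: (measurableT_comp mFE); apply: measurable_funM => //.
  exact: measurable_lognormal.
elim=> [|n IHn] L L0.
  rewrite mul0r power_prob_integral0; last first.
    apply: (measurableT_comp mFE); apply: measurable_funM => //; exact: mprod.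
  rewrite big_ord0 mulr1.
  under [X in eclose _ _ X]eq_integral => z _.
    rewrite /lognormal !mul0r sqrtr0 mul0r subr0 expR0 mulr1; over.
  rewrite integral_cst//= probability_setT mule1; exact: eclose_refl.
pose G : R := n%:R * s.
have G0 : 0 <= G by rewrite mulr_ge0// ltW.
have mjoint : measurable_fun setT
    (fun p : T * R => (F (L * (1 + Y p.1) * lognormal G p.2))%:E).
  apply: (measurableT_comp mFE); apply: measurable_funM.
    by apply: measurable_funM => //; apply: (measurableT_comp m1Y).
  exact: (measurableT_comp (measurable_lognormal G) measurable_snd).
have mA1 : measurable_fun setT (fun t : T => (\int[power_prob P n]_x
    (F (L * (1 + Y t) * \prod_(i < n) (1 + Y (tnth x i))))%:E)%E).
  apply: (measurable_fun_fubini_tonelli_F (m2 := power_prob P n)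
    (fun p : T * n.-tuple T =>
      (F (L * (1 + Y p.1) * \prod_(i < n) (1 + Y (tnth p.2 i))))%:E)) => //.
  apply: (measurableT_comp mFE); apply: measurable_funM.
    by apply: measurable_funM => //; apply: (measurableT_comp m1Y).
  exact: (measurableT_comp (mprod n) measurable_snd).
have mA2 : measurable_fun setT (fun t : T =>
    (\int[N]_z (F (L * (1 + Y t) * lognormal G z))%:E)%E).
  exact: (measurable_fun_fubini_tonelli_F (m2 := N) _ mjoint (fun=> FE0 _)).
have mA3 : measurable_fun setT (fun z : R =>
    (\int[P]_x (F (L * (1 + Y x) * lognormal G z))%:E)%E).
  exact: (measurable_fun_fubini_tonelli_G (m1 := P) _ mjoint (fun=> FE0 _)).
have mjoint2 : measurable_fun setT
    (fun p : R * R => (F (L * lognormal G p.1 * lognormal s p.2))%:E).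
  apply: (measurableT_comp mFE); apply: measurable_funM.
    apply: measurable_funM => //.
    exact: (measurableT_comp (measurable_lognormal G) measurable_fst).
  exact: (measurableT_comp (measurable_lognormal s) measurable_snd).
have mA4 : measurable_fun setT (fun z : R =>
    (\int[N]_w (F (L * lognormal G z * lognormal s w))%:E)%E).
  exact: (measurable_fun_fubini_tonelli_F (m2 := N) _ mjoint2 (fun=> FE0 _)).
have E1 : (\int[power_prob P n.+1]_x
    (F (L * \prod_(i < n.+1) (1 + Y (tnth x i))))%:E =
  \int[P]_t \int[power_prob P n]_x
    (F (L * (1 + Y t) * \prod_(i < n) (1 + Y (tnth x i))))%:E)%E.
  rewrite power_prob_integralS; last 2 first.
  - by apply: (measurableT_comp mFE); apply: measurable_funM => //; exact: mprod.
  - by move=> x; exact: FE0.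
  apply: eq_integral => t _; apply: eq_integral => x _.
  by rewrite (prod_tuple_cons (fun t => 1 + Y t)) mulrA.
have E2 : (\int[N]_z (F (L * lognormal (n.+1%:R * s) z))%:E =
    \int[N]_z \int[N]_w (F (L * lognormal G z * lognormal s w))%:E)%E.
  have [n0|n0] := posnP n.
    rewrite [RHS](_ : _ = \int[N]_z \int[N]_w (F (L * lognormal s w))%:E)%E.
      rewrite n0 mul1r integral_cst//=.
      by rewrite probability_setT mule1.
    apply: eq_integral => z _; rewrite /G n0 mul0r.
    by rewrite {1}/lognormal !mul0r sqrtr0 mul0r subr0 expR0 mulr1.
  have Gp : 0 < G by rewrite mulr_gt0// ltr0n.
  have Sp : 0 < n.+1%:R * s by rewrite mulr_gt0// ltr0n.
  pose h (x : R) : \bar R := (F (L * expR (x - (n.+1%:R * s) / 2)))%:E.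
  have mh : measurable_fun setT h.
    apply: (measurableT_comp mFE); apply: measurable_funM => //.
    by apply: measurableT_comp => //; exact: measurable_funB.
  transitivity (\int[N]_z h (Num.sqrt (n.+1%:R * s) * z)%R)%E.
    by apply: eq_integral => z _.
  have sG : 0 < Num.sqrt G by rewrite sqrtr_gt0.
  have ss : 0 < Num.sqrt s by rewrite sqrtr_gt0.
  have sS : 0 < Num.sqrt (n.+1%:R * s) by rewrite sqrtr_gt0.
  have sq : Num.sqrt G ^+ 2 + Num.sqrt s ^+ 2 = Num.sqrt (n.+1%:R * s) ^+ 2.
    rewrite (sqr_sqrtr G0) (sqr_sqrtr (ltW s0)) (sqr_sqrtr (ltW Sp)).
    by rewrite /G -natr1; ring.
  rewrite -(normal_convolution sG ss sS sq mh (fun=> FE0 _)).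
  apply: eq_integral => z _; apply: eq_integral => w _.
  rewrite /h /lognormal -[L * _ * _]mulrA -expRD; congr (F (L * expR _))%:E.
  by rewrite /G -natr1; ring.
rewrite E1 E2 -natr1 mulrDl mul1r.
apply: (@eclose_trans _ _ _ _ (\int[P]_t \int[N]_z
    (F (L * (1 + Y t) * lognormal G z))%:E)%E).
  apply: eclose_integral => //.
  - by move=> t; apply: integral_ge0 => x _; rewrite lee_fin.
  - by move=> t; apply: integral_ge0 => x _; rewrite lee_fin.
  - by rewrite mulr_ge0.
  - by move=> t; apply: IHn; rewrite mulr_ge0.
have E3 : (\int[P]_t \int[N]_z (F (L * (1 + Y t) * lognormal G z))%:E =
    \int[N]_z \int[P]_t (F (L * (1 + Y t) * lognormal G z))%:E)%E.
  by apply: (@fubini_tonelli _ _ _ _ R P N _ mjoint) => p; rewrite lee_fin.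
rewrite E3; apply: eclose_integral => //.
- by move=> t; apply: integral_ge0 => x _; rewrite lee_fin.
- by move=> t; apply: integral_ge0 => x _; rewrite lee_fin.
move=> z; under eq_integral do rewrite mulrAC.
by apply: step; rewrite mulr_ge0// ltW// lognormal_gt0.
Qed.

End replacement.

(** Two independent factors with the same mean 0 and the same variance act
    alike on a function with a second-order expansion. *)
Lemma has_mean_expansion d (T : measurableType d) (R : realType)
    (P : probability T R) (Y F : T -> R) (c0 c1 c2 v rho K e : R) :
  has_mean P Y 0 -> has_mean P (fun x => Y x ^+ 2) v ->
  has_mean P (fun x => Num.min (Y x ^+ 2) (`|Y x| ^+ 3)) rho ->
  has_mean P F e ->
  (forall x, `|F x - (c0 + c1 * Y x + c2 * Y x ^+ 2)| <=
     K * Num.min (Y x ^+ 2) (`|Y x| ^+ 3)) ->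
  `|e - (c0 + c2 * v)| <= K * rho.
Proof.
move=> h1 h2 h3 hF FY.
have hq : has_mean P (fun x => c0 + c1 * Y x + c2 * Y x ^+ 2) (c0 + c2 * v).
  rewrite (_ : c0 + c2 * v = c0 + c1 * 0 + c2 * v); last by rewrite mulr0 addr0.
  apply: has_meanD; last exact: has_meanZ.
  by apply: has_meanD; [exact: has_mean_cst|exact: has_meanZ].
have hd := has_meanB hF hq; have hr := has_meanZ K h3.
rewrite ler_norml; apply/andP; split.
  have := has_meanZ (-1) hr; rewrite !mulN1r => hr'.
  apply: (has_mean_le hr' hd) => x; rewrite mulN1r.
  by have := FY x; rewrite ler_norml => /andP[].
by apply: (has_mean_le hd hr) => x; have := FY x; rewrite ler_norml => /andP[].
Qed.

Section bayes_risk.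
Context (R : realType).
Local Notation N := (@normal_prob R 0 1).

Lemma has_mean_lognormal (t : R) : 0 <= t -> has_mean N (lognormal t) 1.
Proof.
move=> t0; have E : (\int[N]_z (lognormal t z)%:E = 1)%E.
  rewrite -(normal_mgf (Num.sqrt t)); apply: eq_integral => z _.
  by rewrite /lognormal sqr_sqrtr.
split => //; apply/integrableP; split.
  by apply/measurable_EFinP; exact: measurable_lognormal.
under eq_integral do rewrite /= ger0_norm ?expR_ge0//.
by rewrite E ltry.
Qed.

(** Powers of a log-normal variable are log-normal up to a constant. *)
Lemma has_mean_lognormalX (s : R) j : 0 <= s ->
  has_mean N (fun z => lognormal s z ^+ j) (expR ((j%:R ^+ 2 - j%:R) * s / 2)).
Proof.
move=> s0; have js0 : 0 <= j%:R ^+ 2 * s by rewrite mulr_ge0// sqr_ge0.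
have := has_meanZ (expR ((j%:R ^+ 2 - j%:R) * s / 2)) (has_mean_lognormal js0).
rewrite mulr1; apply: eq_has_mean => z.
rewrite /lognormal sqrtrM ?sqr_ge0// sqrtr_sqr ger0_norm// -expRM_natl -expRD.
by congr expR; ring.
Qed.

Lemma lognormal_moments (s : R) : 0 <= s ->
  let Y z := lognormal s z - 1 in let X := expR s in
  [/\ has_mean N Y 0, has_mean N (fun z => Y z ^+ 2) (X - 1) &
      has_mean N (fun z => Y z ^+ 4) (X ^+ 6 - 4 * X ^+ 3 + 6 * X - 3)].
Proof.
move=> s0 Y X.
have h1 : has_mean N (lognormal s) 1 by exact: has_mean_lognormal.
have h2 : has_mean N (fun z => lognormal s z ^+ 2) X.
  by have := has_mean_lognormalX 2 s0; congr has_mean; congr expR; field.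
have h3 : has_mean N (fun z => lognormal s z ^+ 3) (X ^+ 3).
  have := has_mean_lognormalX 3 s0; rewrite /X -expRM_natl.
  by congr has_mean; congr expR; field.
have h4 : has_mean N (fun z => lognormal s z ^+ 4) (X ^+ 6).
  have := has_mean_lognormalX 4 s0; rewrite /X -expRM_natl.
  by congr has_mean; congr expR; field.
split.
- have e : (1 : R) - 1 = 0 by rewrite subrr.
  exact: (has_mean_eq (has_meanB h1 (has_mean_cst N 1)) (fun=> erefl) e).
- have a1 := has_meanD (has_meanB h2 (has_meanZ 2 h1)) (has_mean_cst N 1).
  have e z : lognormal s z ^+ 2 - 2 * lognormal s z + 1 = (lognormal s z - 1) ^+ 2 by ring.
  by apply: (has_mean_eq a1 e); ring.
- have a1 := has_meanB h4 (has_meanZ 4 h3).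
  have a2 := has_meanD a1 (has_meanZ 6 h2).
  have a3 := has_meanD (has_meanB a2 (has_meanZ 4 h1)) (has_mean_cst N 1).
  have e z : lognormal s z ^+ 4 - 4 * lognormal s z ^+ 3 + 6 * lognormal s z ^+ 2 -
    4 * lognormal s z + 1 = (lognormal s z - 1) ^+ 4 by ring.
  by apply: (has_mean_eq a3 e); ring.
Qed.

Lemma measurable_min_sqr_cube d (T : measurableType d) (Y : T -> R) :
  measurable_fun setT Y ->
  measurable_fun setT (fun x => Num.min (Y x ^+ 2) (`|Y x| ^+ 3)).
Proof.
move=> mY; apply: measurable_minr; first exact: measurable_funX.
by apply: measurable_funX; exact: measurableT_comp.
Qed.

(** The parameter [ln (1 + v)] gives the centred log-normal factor variance [v].
    Its truncated third moment is negligible with respect to [v], by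
    [`|y| ^ 3 <= eta * y ^ 2 + y ^ 4 / eta]. *)
Lemma lognormal_min_sqr_cube (v eta : R) : 0 < v <= 1 -> 0 < eta ->
  exists2 rho, has_mean N (fun z => Num.min ((lognormal (ln (1 + v)) z - 1) ^+ 2)
      (`|lognormal (ln (1 + v)) z - 1| ^+ 3)) rho &
    rho <= eta * v + 44 * v ^+ 2 / eta.
Proof.
move=> /andP[v0 v1] e0; set s := ln (1 + v).
have s0 : 0 <= s by rewrite ln_ge0// lerDl ltW.
have sX : expR s = 1 + v by rewrite lnK// posrE; lra.
have [_ h2 h4] := lognormal_moments s0.
have hb := has_meanD (has_meanZ eta h2) (has_meanZ eta^-1 h4).
have my : measurable_fun [set: measurableTypeR R]
    (fun z : measurableTypeR R => lognormal s z - 1).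
  by apply: measurable_funB => //; exact: measurable_lognormal.
have le z : Num.min ((lognormal s z - 1) ^+ 2) (`|lognormal s z - 1| ^+ 3) <=
    eta * (lognormal s z - 1) ^+ 2 + eta^-1 * (lognormal s z - 1) ^+ 4.
  set y := lognormal s z - 1.
  rewrite ge_min; apply/orP; right.
  rewrite exprSr real_normK ?num_real//.
  rewrite (_ : y ^+ 4 = y ^+ 2 * `|y| ^+ 2); last first.
    by rewrite real_normK ?num_real//; ring.
  rewrite (_ : _ + _ = y ^+ 2 * (eta + `|y| ^+ 2 / eta)); last by field; rewrite gt_eqF.
  rewrite ler_wpM2l ?sqr_ge0// -subr_ge0.
  rewrite (_ : _ - _ = ((eta - `|y|) ^+ 2 + eta * `|y|) / eta); last by field; rewrite gt_eqF.
  by rewrite divr_ge0 ?addr_ge0 ?sqr_ge0 ?mulr_ge0// ltW.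
have len (z : measurableTypeR R) :
    `|Num.min ((lognormal s z - 1) ^+ 2) (`|lognormal s z - 1| ^+ 3)| <=
    eta * (lognormal s z - 1) ^+ 2 + eta^-1 * (lognormal s z - 1) ^+ 4.
  by rewrite ger0_norm; [exact: le|rewrite le_min sqr_ge0 exprn_ge0].
have [rho hr] := has_mean_dominated (measurable_min_sqr_cube my) len hb.
exists rho => //; apply: (le_trans (has_mean_le hr hb le)).
rewrite sX; set X := 1 + v.
have -> : X ^+ 6 - 4 * X ^+ 3 + 6 * X - 3 =
    v ^+ 2 * (X ^+ 4 + 2 * X ^+ 3 + 3 * X ^+ 2 - 3) by rewrite /X; ring.
rewrite (_ : X - 1 = v); last by rewrite /X; ring.
rewrite lerD2l mulrC ler_pM2r ?invr_gt0// [44 * _]mulrC ler_wpM2l ?sqr_ge0//.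
have X0 : 0 <= X by rewrite /X; lra.
have X2 : X <= 2 by rewrite /X; lra.
have h k : X ^+ k <= 2 ^+ k by rewrite lerXn2r// nnegrE.
have := h 4%N; have := h 3%N; have := h 2%N.
by rewrite !exprS !expr0; lra.
Qed.

(** On negative arguments [soft_min] may have a pole; the absolute value removes
    it. *)
Let F k (L : R) := soft_min k `|L|.

Let measurable_F k : measurable_fun setT (F k).
Proof.
rewrite (_ : F k = fun L => (`|L| + `|L| ^+ k) * expR (- ln (1 + `|L| ^+ k))).
  have mk : measurable_fun setT (fun L : R => `|L| ^+ k).
    by apply: measurable_funX; exact: normr_measurable.
  apply: measurable_funM; first by apply: measurable_funD => //; exact: normr_measurable.
  apply: measurableT_comp => //; apply: measurable_funN.
  by apply: measurableT_comp => //; exact: measurable_funD.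
apply/funext => L; rewrite /F /soft_min expRN lnK// posrE.
by rewrite ltr_wpDr// exprn_ge0.
Qed.

Let F_ge0 k L : 0 <= F k L.
Proof. exact: soft_min_ge0. Qed.

Let F_bound k (k0 : (0 < k)%N) L : `|F k L| <= 2.
Proof.
rewrite ger0_norm//; have := @soft_min_close _ k `|L| k0 (normr_ge0 L).
rewrite ler_norml => /andP[_].
have : k%:R^-1 <= 1 :> R by rewrite invf_le1 ?ltr0n// ler1n.
have := ge_min 1 1 `|L|; rewrite lexx/= /F.
by move=> ? ? ?; lra.
Qed.

Let F_close k (k0 : (0 < k)%N) L : 0 <= L ->
  eclose k%:R^-1 (F k L)%:E (Num.min 1 L)%:E.
Proof.
move=> L0; have := soft_min_close k0 L0.
rewrite /F (ger0_norm L0) ler_norml => /andP[h1 h2].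
by split; rewrite -EFinD lee_fin; lra.
Qed.

Lemma eclose_sym c (a b : \bar R) : eclose c a b -> eclose c b a.
Proof. by case. Qed.

(** One swap: both factors have mean 0 increments of variance [v], so that the
    two expansions agree up to their third-order remainders. *)
Let soft_min_step k : (0 < k)%N -> exists2 K, 0 <= K &
  forall d (T : measurableType d) (P : probability T R) (Y : T -> R) (v rho eta : R),
  measurable_fun setT Y -> (forall x, -1 <= Y x) -> has_mean P Y 0 ->
  has_mean P (fun x => Y x ^+ 2) v ->
  has_mean P (fun x => Num.min (Y x ^+ 2) (`|Y x| ^+ 3)) rho ->
  0 < v <= 1 -> 0 < eta -> forall L, 0 <= L ->
  eclose (K * (rho + eta * v + 44 * v ^+ 2 / eta))
    (\int[P]_x (F k (L * (1 + Y x)))%:E)%E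
    (\int[N]_z (F k (L * lognormal (ln (1 + v)) z))%:E)%E.
Proof.
move=> k0; have [K K0 hK] := @soft_min_expansion R k k0; exists K => //.
move=> d T P Y v rho eta mY Y1 h1 h2 h3 v01 e0 L L0.
have [c1 [c2 h]] := hK L L0.
have [v0 v1] := andP v01.
set s := ln (1 + v).
have s0 : 0 <= s by rewrite ln_ge0// lerDl ltW.
have [g1 g2 _] := lognormal_moments s0.
rewrite lnK ?posrE ?addr_gt0// [1 + v]addrC addrK in g2.
have [rho' g3 rho'le] := lognormal_min_sqr_cube v01 e0.
have mF1 : measurable_fun setT (fun x => F k (L * (1 + Y x))).
  apply: (measurableT_comp (measurable_F k)); apply: measurable_funM => //.
  exact: measurable_funD.
have mF2 : measurable_fun setT (fun z => F k (L * lognormal s z)).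
  apply: (measurableT_comp (measurable_F k)); apply: measurable_funM => //.
  exact: measurable_lognormal.
have [e he] := has_mean_bounded P mF1 (fun x => F_bound k0 _).
have [e' he'] := has_mean_bounded N mF2 (fun x => F_bound k0 _).
have b1 : `|e - (soft_min k L + c2 * v)| <= K * rho.
  apply: (has_mean_expansion (c1 := c1) h1 h2 h3 he) => x.
  have pos : 0 <= L * (1 + Y x) by rewrite mulr_ge0//; have := Y1 x; lra.
  by rewrite /F (ger0_norm pos); exact: h.
have b2 : `|e' - (soft_min k L + c2 * v)| <= K * rho'.
  apply: (has_mean_expansion (c1 := c1) g1 g2 g3 he') => z.
  have pos : 0 <= L * lognormal s z by rewrite mulr_ge0// ltW// lognormal_gt0.
  rewrite /F (ger0_norm pos).
  have := h (lognormal s z - 1); rewrite [1 + (_ - 1)]addrC subrK; apply.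
  by have := lognormal_gt0 s z; lra.
case: he he' => _ -> [_ ->]; rewrite /eclose -!EFinD !lee_fin.
have : K * rho' <= K * (eta * v + 44 * v ^+ 2 / eta) by rewrite ler_wpM2l.
move: b1 b2; rewrite !ler_norml => /andP[? ?] /andP[? ?] ?.
by split; lra.
Qed.

(** The minimum is 1 beyond the point [sqrt t / 2] and the likelihood ratio below
    it; shifting and reflecting the second part gives the first one. *)
Lemma min_lognormal (t : R) : 0 <= t ->
  (\int[N]_z (Num.min 1 (lognormal t z))%:E =
   2%:E * N `](2^-1 * Num.sqrt t)%R, +oo[%classic)%E.
Proof.
move=> t0; set c := Num.sqrt t.
have ct : t = c ^+ 2 by rewrite sqr_sqrtr.
have c0 : 0 <= c by exact: sqrtr_ge0.
pose up := `]2^-1 * c, +oo[%classic; pose dn := `]-oo, 2^-1 * c]%classic.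
have mup : measurable up by exact: measurable_itv.
have mdn : measurable dn by exact: measurable_itv.
have mdnE : measurable_fun setT (fun z => (\1_dn z)%:E : \bar R).
  by apply/measurable_EFinP; exact: measurable_indic.
have mlE : measurable_fun setT (fun z => (expR (c * z - c ^+ 2 / 2))%:E).
  apply/measurable_EFinP; apply: measurableT_comp => //.
  by apply: measurable_funB => //; exact: measurable_funM.
have E z : (Num.min 1 (lognormal t z))%:E =
    ((\1_up z)%:E + (expR (c * z - c ^+ 2 / 2))%:E * (\1_dn z)%:E)%E.
  rewrite /lognormal -/c ct -EFinM -EFinD; congr EFin.
  rewrite !indicE !mem_setE !in_itv/= andbT.
  have -> : c * z - c ^+ 2 / 2 = c * (z - 2^-1 * c) by field.
  have [zc|zc] := ltP (2^-1 * c) z; rewrite /= ?mulr0 ?addr0 ?mulr1 ?add0r.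
    by apply/min_idPl; rewrite -[leLHS]expR0 ler_expR mulr_ge0// subr_ge0 ltW.
  by apply/min_idPr; rewrite -[leRHS]expR0 ler_expR mulr_ge0_le0// subr_le0.
under eq_integral do rewrite E.
rewrite ge0_integralD//; last 2 first.
- by apply/measurable_EFinP; exact: (@measurable_indic _ (measurableTypeR R)).
- exact: emeasurable_funM.
rewrite integral_indic// setIT normal_shift//.
rewrite mule_natl mule2n; congr (_ + _)%E.
have mi A : measurable A -> measurable_fun setT (fun z : R => (\1_A z)%:E : \bar R).
  by move=> mA; apply/measurable_EFinP; exact: measurable_indic.
pose cl := `[2^-1 * c, +oo[%classic.
have mcl : measurable cl by exact: measurable_itv.
transitivity (N cl).
  have g0 z : (0 <= (\1_cl z)%:E :> \bar R)%E by rewrite lee_fin.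
  rewrite -(setIT cl) -integral_indic// -(normal_symmetric (mi _ mcl) g0).
  apply: eq_integral => z _.
  rewrite !indicE !mem_setE !in_itv/= andbT.
  by rewrite (_ : (2^-1 * c <= - z) = (c + z <= 2^-1 * c))//; apply/idP/idP; lra.
have -> : cl = [set 2^-1 * c] `|` up by rewrite setU1itv.
rewrite measureU//; last first.
  by apply/seteqP; split => // x [] /= ->; rewrite /up/= in_itv/= ltxx.
rewrite [X in (X + _)%E = _](_ : _ = 0%E) ?add0e//.
apply: null_set_integral => //; last exact: lebesgue_measure_set1.
apply/measurable_funTS/measurable_EFinP; exact: measurable_normal_pdf.
Qed.

Lemma normal_tail_lipschitz (a b : R) :
  `|fine (N `]a, +oo[%classic) - fine (N `]b, +oo[%classic)| <= `|a - b|.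
Proof.
wlog ab : a b / a <= b.
  move=> h; have [/h//|/ltW/h] := leP a b.
  by rewrite distrC [`|b - a|]distrC.
have -> : N `]a, +oo[%classic = (N `]a, b]%classic + N `]b, +oo[%classic)%E.
  rewrite -measureU//; last first.
    by apply/seteqP; split => // x [] /=; rewrite !in_itv/= andbT => /andP[_] /le_lt_trans h /h; rewrite ltxx.
  by congr (N _); rewrite -itv_bndbnd_setU.
rewrite fineD ?fin_num_measure// addrK ger0_norm ?fine_ge0//.
rewrite distrC ger0_norm ?subr_ge0//.
rewrite -lee_fin fineK ?fin_num_measure//.
rewrite /normal_prob.
apply: (@le_trans _ _ (\int[@lebesgue_measure R]_(x in `]a, b]) cst 1%E x)%E).
  apply: ge0_le_integral => //.
  - by move=> x _; rewrite lee_fin normal_pdf_ge0.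
  - by apply/measurable_funTS/measurable_EFinP; exact: measurable_normal_pdf.
  - move=> x _; rewrite lee_fin (le_trans (normal_pdf_ub _ _ _)) ?oner_neq0//.
    have p2 : 1 <= pi *+ 2 :> R by have := pi_ge2 R; rewrite mulr2n; lra.
    rewrite /normal_peak expr1n mul1r invf_le1.
      by rewrite -[leLHS]sqrtr1; exact: ler_wsqrtr.
    by rewrite sqrtr_gt0; exact: lt_le_trans p2.
rewrite integral_cst//= mul1e lebesgue_measure_itv/= lte_fin.
by case: ifP => // _; rewrite lee_fin subr_ge0.
Qed.

Lemma ecloseW c c' (a b : \bar R) : eclose c a b -> c <= c' -> eclose c' a b.
Proof.
by move=> [ab ba] cc'; split; [apply: (le_trans ab)|apply: (le_trans ba)];
  rewrite leeD2l// lee_fin.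
Qed.

Lemma eclose_cvg (u : nat -> \bar R) (l : R) :
  (forall e, 0 < e -> \forall n \near \oo, eclose e (u n) l%:E) ->
  u n @[n --> \oo] --> l%:E.
Proof.
move=> h; apply/fine_cvgP; split.
  near=> n.
  have [] : eclose 1 (u n) l%:E by near: n; exact: h.
  by case: (u n).
apply/cvgrPdist_le => e e0; near=> n.
have [] : eclose e (u n) l%:E by near: n; exact: h.
have : (u n) \is a fin_num.
  have [] : eclose 1 (u n) l%:E by near: n; exact: h.
  by case: (u n).
rewrite /=; case: (u n) => //= r _; rewrite -!EFinD !lee_fin => h1 h2.
by rewrite ler_norml; apply/andP; split; lra.
Unshelve. all: by end_near. Qed.

(** The minimal Bayes risk of a triangular array of small likelihood ratios
    converges to that of a Gaussian shift: [lognormal_replacement] with [n] swaps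
    of cost [o (1 / n)] each, then continuity in the shift. *)
Theorem bayes_risk_cvg d (T : measurableType d) (P : probability T R)
    (Y : nat -> T -> R) (v rho : nat -> R) (sg : R) :
  (\forall n \near \oo, [/\ measurable_fun setT (Y n), forall x, -1 <= Y n x,
     has_mean P (Y n) 0, has_mean P (fun x => Y n x ^+ 2) (v n) &
     has_mean P (fun x => Num.min (Y n x ^+ 2) (`|Y n x| ^+ 3)) (rho n)]) ->
  0 < sg ->
  n%:R * v n @[n --> \oo] --> sg ^+ 2 -> n%:R * rho n @[n --> \oo] --> 0 ->
  (\int[power_prob P n]_x
     (Num.min 1 (\prod_(i < n) (1 + Y n (tnth x i))))%:E)%E @[n --> \oo] -->
  (2%:E * N `](2^-1 * sg)%R, +oo[%classic)%E.
Proof.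
move=> hY sg0 hv hrho.
pose tail x := N `]2^-1 * x, +oo[%classic.
rewrite -/(tail sg).
have tf x : (2%:E * tail x = (2 * fine (tail x))%:E)%E.
  by rewrite EFinM fineK// fin_num_measure.
rewrite tf; apply: eclose_cvg => e e0.
have [k0' ke'] : exists k', k'.+1%:R^-1 < e / 8.
  by have /ltr_add_invr[k'] : 0 < e / 8 by [rewrite divr_gt0|]; rewrite add0r; exists k'.
pose k := k0'.+1; have k0 : (0 < k)%N by [].
have ke : k%:R^-1 <= e / 8 by exact: ltW.
have [K K0 hK] := soft_min_step k0.
pose eta := e / 8 / (K + 1) / (sg ^+ 2 + 1).
have sg1 : 0 < sg ^+ 2 + 1 by rewrite ltr_wpDl// sqr_ge0.
have K1 : 0 < K + 1 by rewrite ltr_wpDl.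
have eta0 : 0 < eta by rewrite !divr_gt0.
have n0 : (n%:R : R)^-1 @[n --> \oo] --> 0.
  by rewrite -cvg_shiftS; exact: cvg_harmonic.
have v0 : v n @[n --> \oo] --> 0.
  rewrite -(mulr0 (sg ^+ 2)); apply: cvg_trans (cvgM hv n0).
  apply: near_eq_cvg; near=> n => /=.
  by rewrite mulrAC divff ?mul1r// pnatr_eq0 -lt0n; near: n; exact: nbhs_infty_gt.
have err : n%:R * (K * (rho n + eta * v n + 44 * v n ^+ 2 / eta)) @[n --> \oo] -->
    K * (0 + eta * sg ^+ 2 + 44 / eta * (sg ^+ 2 * 0)).
  rewrite (_ : (fun n => _) = fun n => K * (n%:R * rho n + eta * (n%:R * v n) +
      44 / eta * ((n%:R * v n) * v n))); last first.
    by apply/funext => n; ring.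
  apply: cvgM; first exact: cvg_cst.
  apply: cvgD.
    by apply: cvgD => //; apply: cvgM => //; exact: cvg_cst.
  by apply: cvgM; [exact: cvg_cst|exact: cvgM].
have vhalf : \forall n \near \oo, `|v n| <= 2^-1.
  have /cvgr0Pnorm_le := v0; apply; first by rewrite invr_gt0.
have v1 : 1 + v n @[n --> \oo] --> (1 : R).
  by rewrite -[X in _ --> X]addr0; apply: cvgD => //; exact: cvg_cst.
have st0 : n%:R * ln (1 + v n) @[n --> \oo] --> sg ^+ 2.
  apply: (@squeeze_cvgr _ _ _ _ (fun n => n%:R * v n / (1 + v n)) (fun n => n%:R * v n)) => //.
    near=> n; have : `|v n| <= 2^-1 by near: n.
    rewrite ler_norml => /andP[vl vu].
    have v1p : 0 < 1 + v n by lra.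
    apply/andP; split; last by rewrite ler_wpM2l//; apply: le_ln1Dx; lra.
    rewrite -mulrA ler_wpM2l// -lerN2 -lnV ?posrE//.
    have vE : 1 + - (v n / (1 + v n)) = (1 + v n)^-1 by field; rewrite gt_eqF.
    have := @le_ln1Dx _ (- (v n / (1 + v n))); rewrite vE; apply.
    by rewrite ltrN2 ltr_pdivrMr//; lra.
  rewrite -[X in _ --> X]divr1; apply: cvgM => //.
  by apply: cvgV => //; rewrite oner_neq0.
have st : Num.sqrt (n%:R * ln (1 + v n)) @[n --> \oo] --> sg.
  rewrite -[X in _ --> X](gtr0_norm sg0) -sqrtr_sqr.
  by apply: continuous_cvg => //; exact: sqrt_continuous.
near=> n.
have [mY Y1 h1 h2 h3] : [/\ measurable_fun setT (Y n), forall x, -1 <= Y n x,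
     has_mean P (Y n) 0, has_mean P (fun x => Y n x ^+ 2) (v n) &
     has_mean P (fun x => Num.min (Y n x ^+ 2) (`|Y n x| ^+ 3)) (rho n)] by near: n.
have npos : (0 < n)%N by near: n; exact: nbhs_infty_gt.
have vle : v n <= 1.
  have : `|v n| <= 2^-1 by near: n.
  by rewrite ler_norml => /andP[]; lra.
have vpos : 0 < v n.
  rewrite -(@pmulr_rgt0 _ n%:R) ?ltr0n//; near: n.
  by apply: (cvgr_gt (sg ^+ 2)) => //; rewrite exprn_gt0.
have v01 : 0 < v n <= 1 by rewrite vpos.
have sn0 : 0 < ln (1 + v n) by rewrite ln_gt0// ltrDl.
have tn0 : 0 <= n%:R * ln (1 + v n) by rewrite mulr_ge0// ltW.
set del := K * (rho n + eta * v n + 44 * v n ^+ 2 / eta).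
have rho0 : 0 <= rho n.
  apply: (has_mean_le (has_mean_cst P 0) h3) => x.
  by rewrite le_min sqr_ge0 exprn_ge0.
have del0 : 0 <= del.
  have e1 : 0 <= eta * v n by rewrite mulr_ge0// ltW.
  have e2 : 0 <= 44 * v n ^+ 2 / eta.
    by rewrite divr_ge0 ?(ltW eta0)// mulr_ge0// sqr_ge0.
  by rewrite mulr_ge0//; lra.
have ndel : n%:R * del <= e / 4.
  have : n%:R * del <= K * (0 + eta * sg ^+ 2 + 44 / eta * (sg ^+ 2 * 0)) + e / 8.
    rewrite /del; near: n; apply: cvgr_le; first exact: err.
    by rewrite ltrDl; lra.
  have : K * eta * sg ^+ 2 <= e / 8.
    have -> : K * eta * sg ^+ 2 = e / 8 * ((K / (K + 1)) * (sg ^+ 2 / (sg ^+ 2 + 1))).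
      by rewrite /eta; field; rewrite !gt_eqF.
    rewrite ler_piMr ?divr_ge0 ?(ltW e0)// -[leRHS]mulr1 ler_pM ?divr_ge0 ?sqr_ge0 ?(ltW K1) ?(ltW sg1)//.
      by rewrite ler_pdivrMr// mul1r lerDl.
    by rewrite ler_pdivrMr// mul1r lerDl.
  by rewrite mulr0 mulr0; lra.
have Y10 x : 0 <= 1 + Y n x by have := Y1 x; lra.
have R1 := @lognormal_replacement _ _ _ P (Y n) (F k) mY Y10 (measurable_F k)
  (F_ge0 k) (ln (1 + v n)) del sn0 del0
  (fun L L0 => hK _ _ P (Y n) (v n) (rho n) eta mY Y1 h1 h2 h3 v01 eta0 L L0) n 1 ler01.
have mprod : measurable_fun setT
    (fun x : n.-tuple T => \prod_(i < n) (1 + Y n (tnth x i))).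
  by apply: (@measurable_tuple_prod _ _ _ n (fun t => 1 + Y n t)); exact: measurable_funD.
have mlog := measurable_lognormal (n%:R * ln (1 + v n)).
have R0 : eclose k%:R^-1
    (\int[power_prob P n]_x (Num.min 1 (\prod_(i < n) (1 + Y n (tnth x i))))%:E)%E
    (\int[power_prob P n]_x (F k (1 * \prod_(i < n) (1 + Y n (tnth x i))))%:E)%E.
  apply: eclose_integral => //.
  - by apply/measurable_EFinP; exact: measurable_minr.
  - by move=> x; rewrite lee_fin le_min ler01 prodr_ge0.
  - apply/measurable_EFinP; apply: (measurableT_comp (measurable_F k)).
    exact: measurable_funM.
  - by move=> x; rewrite lee_fin.
  - by move=> x; rewrite mul1r; apply/eclose_sym/F_close => //; rewrite prodr_ge0.
have R2 : eclose k%:R^-1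
    (\int[N]_z (F k (1 * lognormal (n%:R * ln (1 + v n)) z))%:E)%E
    (\int[N]_z (Num.min 1 (lognormal (n%:R * ln (1 + v n)) z))%:E)%E.
  apply: eclose_integral => //.
  - apply/measurable_EFinP; apply: (measurableT_comp (measurable_F k)).
    exact: measurable_funM.
  - by move=> x; rewrite lee_fin.
  - by apply/measurable_EFinP; exact: measurable_minr.
  - by move=> x; rewrite lee_fin le_min ler01 ltW// lognormal_gt0.
  - by move=> x; rewrite mul1r; apply: F_close => //; rewrite ltW// lognormal_gt0.
have R3 : eclose (e / 4)
    (\int[N]_z (Num.min 1 (lognormal (n%:R * ln (1 + v n)) z))%:E)%E (2 * fine (tail sg))%:E.
  rewrite min_lognormal// -/(tail _) tf.
  have := normal_tail_lipschitz (2^-1 * Num.sqrt (n%:R * ln (1 + v n))) (2^-1 * sg).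
  rewrite -/(tail _) -/(tail sg) -mulrBr normrM (@ger0_norm _ 2^-1)//.
  have : `|sg - Num.sqrt (n%:R * ln (1 + v n))| <= e / 4.
    by near: n; move/cvgrPdist_le : st; apply; lra.
  rewrite distrC => u1 u2.
  have : `|fine (tail (Num.sqrt (n%:R * ln (1 + v n)))) - fine (tail sg)| <= 2^-1 * (e / 4).
    by apply: (le_trans u2); rewrite ler_wpM2l.
  by move=> u3; apply: eclose_fin; rewrite -mulrBr normrM gtr0_norm// -ler_pdivlMl.
apply: (ecloseW (eclose_trans R0 (eclose_trans R1 (eclose_trans R2 R3)))).
by clear -e0 ke ndel; lra.
Unshelve. all: by end_near. Qed.

End bayes_risk.

(** * Continuous distribution functions and uniform chains of sets *)

Section continuous_cdf.
Context (R : realType) (P : probability R R).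
Local Notation F := (dist_fun P).

Lemma dist_funE t : P [set y | y <= t] = (F t)%:E.
Proof. by rewrite /dist_fun fineK ?fin_num_measure. Qed.

Lemma dist_fun_ge0 t : 0 <= F t.
Proof. by rewrite fine_ge0. Qed.

Lemma measurable_halfline (t : R) : measurable [set y : R | y <= t].
Proof. exact: (measurable_itv `]-oo, t]). Qed.

Lemma dist_fun_le1 t : F t <= 1.
Proof.
by rewrite -lee_fin -dist_funE probability_le1//; exact: measurable_halfline.
Qed.

Lemma dist_fun_le s t : s <= t -> F s <= F t.
Proof.
move=> st; rewrite -lee_fin -!dist_funE le_measure ?inE//; try exact: measurable_halfline.
by move=> y /= /le_trans; apply.
Qed.

Lemma dist_fun_lt s t : F s < F t -> s < t.
Proof. by move=> st; rewrite ltNge; apply/negP => /dist_fun_le; rewrite leNgt st. Qed.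

Hypothesis cF : continuous F.

Lemma dist_fun_surj v : 0 < v < 1 -> exists t, F t = v.
Proof.
move=> /andP[v0 v1].
pose X : {RV P >-> R} := observation (R := R).
have [a av] : exists a, F a < v.
  have /fine_cvgP[_ h] := cvg_cdfNy0 X.
  near (ninfty_nbhs R) => a; exists a; near: a.
  by apply: cvgr_lt; [exact: h|].
have [b bv] : exists b, v < F b.
  have /fine_cvgP[_ h] := cvg_cdfy1 X.
  near (pinfty_nbhs R) => b; exists b; near: b.
  by apply: cvgr_gt; [exact: h|].
have ab : a <= b by apply/ltW/dist_fun_lt; exact: lt_trans bv.
have [c _ <-] := @IVT R F a b v ab (continuous_subspaceT cF) ltac:(
  by rewrite ge_min le_max (ltW av) (ltW bv) orbT).
by exists c.
Unshelve. all: by end_near. Qed.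

(** [chain v] has probability [v]: these sets play the role of the intervals
    [[0, v[] for the probability integral transform of the observations. *)
Definition chain v : set R := if 1 <= v then setT else [set x | F x < v].

Lemma chain_sub v w : v <= w -> chain v `<=` chain w.
Proof.
move=> vw x; rewrite /chain; have [//|w1] := leP 1 w.
by have [v1|v1 /= /lt_le_trans] := leP 1 v; [lra|apply].
Qed.

Lemma chain0 : chain 0 = set0.
Proof.
by rewrite /chain lt_geF// -subset0 => x /=; rewrite ltNge dist_fun_ge0.
Qed.

Lemma measurable_dist_fun : measurable_fun setT F.
Proof. by apply: nondecreasing_measurable => // s t; exact: dist_fun_le. Qed.

Lemma measurable_chain v : measurable (chain v).
Proof.
rewrite /chain; case: ifP => // _.
have := measurable_dist_fun measurableT (measurable_itv `]-oo, v[).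
by rewrite setTI; congr measurable; apply/seteqP; split => x /=; rewrite in_itv.
Qed.

Lemma chainE v : 0 <= v <= 1 -> P (chain v) = v%:E.
Proof.
move=> /andP[]; rewrite le_eqVlt => /predU1P[<- _|v0]; first by rewrite chain0 measure0.
rewrite le_eqVlt => /predU1P[->|v1]; first by rewrite /chain lexx probability_setT.
have chv : chain v = [set x | F x < v] by rewrite /chain lt_geF.
apply/eqP; rewrite eq_le; apply/andP; split.
  have [q qv] : exists t, F t = v by apply: dist_fun_surj; rewrite v0.
  rewrite -[in leRHS]qv -dist_funE le_measure ?inE//.
  - exact: measurable_chain.
  - exact: measurable_halfline.
  - by rewrite chv -{1}qv => x /= /dist_fun_lt /ltW.
apply/lee_subgt0Pr => e e0; rewrite -EFinB.
have [ev|ev] := leP v e.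
  by apply: (@le_trans _ _ 0%E); rewrite ?measure_ge0// lee_fin subr_le0.
have [q qv] : exists t, F t = v - e by apply: dist_fun_surj; lra.
rewrite -qv -dist_funE le_measure ?inE//.
- exact: measurable_halfline.
- exact: measurable_chain.
- by rewrite chv => x /= /dist_fun_le; lra.
Qed.

Lemma halfline_sub_chain t v : F t < v -> [set y | y <= t] `<=` chain v.
Proof.
move=> tv x /= /dist_fun_le xt; rewrite /chain; case: ifP => // _ /=.
exact: le_lt_trans tv.
Qed.

Lemma chain_sub_halfline t v : v <= F t -> v < 1 -> chain v `<=` [set y | y <= t].
Proof.
move=> vt v1 x; rewrite /chain lt_geF// => /= xv.
by apply/ltW/dist_fun_lt; exact: lt_le_trans vt.
Qed.

End continuous_cdf.

Section hits_theory.
Context (R : realType) d (T : measurableType d).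
Implicit Types (A B : set T).

Lemma hits_le n A B (x : n.-tuple T) : A `<=` B -> hits R A x <= hits R B x :> R.
Proof.
move=> AB; apply: ler_sum => i _; rewrite !indicE ler_nat.
by case: (boolP (_ \in A)) => // /set_mem/AB/mem_set ->.
Qed.

Lemma hitsD n A B (x : n.-tuple T) : A `<=` B ->
  hits R B x = hits R A x + hits R (B `\` A) x :> R.
Proof.
move=> AB; rewrite /hits -big_split/=; apply: eq_bigr => i _.
rewrite !indicE in_setD; case: (boolP (_ \in A)) => [/set_mem/AB/mem_set ->|_] /=.
  by rewrite addr0.
by rewrite andbT add0r.
Qed.

Lemma hits0 n (x : n.-tuple T) : hits R set0 x = 0 :> R.
Proof. by rewrite /hits big1// => i _; rewrite indicE in_set0. Qed.

Lemma hits_setT n (x : n.-tuple T) : hits R setT x = n%:R :> R.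
Proof.
rewrite /hits (eq_bigr (fun=> 1)) ?sumr_const ?card_ord// => i _.
by rewrite indicE in_setT.
Qed.

Lemma hits_lern n A (x : n.-tuple T) : hits R A x <= n%:R :> R.
Proof. by rewrite -(hits_setT x) hits_le. Qed.

End hits_theory.

Lemma emp_dist_funE (R : realType) n (x : n.-tuple R) t :
  emp_dist_fun x t = n%:R^-1 * hits R [set y | y <= t] x.
Proof. by []. Qed.

(** * The fluctuations of the empirical distribution function *)

Section chaining.
Context (R : realType) d (T : measurableType d) (P : probability T R).
Variable A : R -> set T.
Hypothesis mA : forall v, measurable (A v).
Hypothesis PA : forall v, 0 <= v <= 1 -> P (A v) = v%:E.
Hypothesis subA : forall v w, v <= w -> A v `<=` A w.
Hypothesis A0 : A 0 = set0.

Definition deviation n v (x : n.-tuple T) : R := hits R (A v) x - n%:R * v.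

Let grid m j : R := j%:R / 2 ^+ m.

Let grid01 m j : (j <= 2 ^ m)%N -> 0 <= grid m j <= 1.
Proof.
move=> jm; rewrite /grid divr_ge0//= ler_pdivrMr ?exprn_gt0// mul1r.
by rewrite -natrX ler_nat.
Qed.

(* The increments at level [m] are controlled by [scale m * sqrt n]; with ratio
   5/7 these bounds are summable, whereas 7/5 squared is below 2, so that the
   exponential moments at level [m] stay bounded. *)
Let scale (M : R) m : R := M * m.+1%:R * (5 / 7) ^+ m.

Let increment n m j (x : n.-tuple T) : R :=
  hits R (A (grid m j.*2.+1) `\` A (grid m j.*2)) x - n%:R * 2 ^- m.

Let rare_increment n m j (M : R) : (0 < n)%N -> (0 < m)%N -> (j < 2 ^ m.-1)%N ->
  (7 / 5) ^+ m <= Num.sqrt n%:R / 2 :> R ->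
  rare (power_prob P n)
    [set x | Num.sqrt n%:R * scale M m <= `|increment m j x|]
    (2 * expR (4 - M * m.+1%:R)).
Proof.
move=> n0 m0 jm hm.
have n0R : 0 < n%:R :> R by rewrite ltr0n.
set sn := Num.sqrt n%:R in hm *.
have sn0 : 0 < sn by rewrite sqrtr_gt0.
have sn2 : sn ^+ 2 = n%:R by rewrite sqr_sqrtr// ltW.
have j2 : (j.*2.+1 <= 2 ^ m)%N.
  by rewrite -[m]prednK// expnS mul2n ltn_double.
rewrite /increment; set B := (X in hits _ X).
have sub : A (grid m j.*2) `<=` A (grid m j.*2.+1).
  by apply: subA; rewrite ler_pM2r ?invr_gt0 ?exprn_gt0// ler_nat.
have mB : measurable B by exact: measurableD.
have PB : fine (P B) = 2 ^- m.
  have -> : P B = ((grid m j.*2.+1)%:E - (grid m j.*2)%:E)%E.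
    have fin : (P (A (grid m j.*2.+1)) < +oo)%E by rewrite ltey_eq fin_num_measure.
    apply: etrans (measureD (mA _) (mA _) fin) _; rewrite setIidr//.
    by congr (_ - _)%E; apply: PA; rewrite grid01//; exact: ltnW.
  by rewrite /= /grid -mulrBl -natrB// subSnn mul1r.
have l0 : 0 < (7 / 5 : R) ^+ m by rewrite exprn_gt0.
have := @rare_hits _ _ _ P n B ((7 / 5) ^+ m / sn) (sn * scale M m) mB.
rewrite PB; move=> /(_ _)/=; rewrite divr_ge0 ?(ltW l0) ?(ltW sn0)//= ler_pdivrMr// [2^-1 * _]mulrC.
move=> /(_ hm); apply: rareW.
rewrite ler_pM2l// ler_expR lerB//.
  have -> : 2 * ((7 / 5) ^+ m / sn) ^+ 2 * (n%:R * (2 ^- m * (1 - 2 ^- m))) =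
     2 * ((49 / 50) ^+ m * (1 - 2 ^- m)).
    rewrite -sn2 expr_div_n -exprM mulnC exprM.
    rewrite (_ : (7 / 5) ^+ 2 = (49 / 50) * 2 :> R); last by field.
    by rewrite exprMn; field; rewrite expf_neq0//= gt_eqF.
  have : (49 / 50 : R) ^+ m <= 1 by rewrite exprn_ile1//; lra.
  have : 0 <= (49 / 50 : R) ^+ m by rewrite exprn_ge0//; lra.
  have : 0 <= 2 ^- m :> R by rewrite invr_ge0 exprn_ge0.
  have : 2 ^- m <= 1 :> R by rewrite invf_le1 ?exprn_gt0// exprn_ege1//; lra.
  by nra.
rewrite le_eqVlt; apply/orP; left; apply/eqP.
have : (7 / 5) ^+ m * (5 / 7) ^+ m = 1 :> R.
  by rewrite -exprMn (_ : 7 / 5 * (5 / 7) = 1 :> R) ?expr1n//; field.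
rewrite /scale; set u := (7 / 5) ^+ m; set w := (5 / 7) ^+ m => uw.
rewrite [RHS](_ : _ = M * m.+1%:R * (u * w)); first by rewrite uw mulr1.
by field; rewrite gt_eqF.
Qed.

(* The total of the scales: [rare_chaining] needs it to be at most [12 * M]. *)
Let budget m : R := \sum_(i < m) (i.+2)%:R * (5 / 7) ^+ i.+1.

Let budget_le m : budget m <= 12.
Proof.
suff -> : budget m = 45 / 4 - (5 / 7) ^+ m.+1 * ((m%:R + 2) * (7 / 2) + 35 / 4).
  have : 0 <= (5 / 7 : R) ^+ m.+1 * ((m%:R + 2) * (7 / 2) + 35 / 4).
    have := ler0n R m; rewrite mulr_ge0 ?exprn_ge0 ?addr_ge0 ?mulr_ge0 ?divr_ge0//.
  lra.
elim: m => [|m IHm]; first by rewrite /budget big_ord0; field.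
rewrite /budget big_ord_recr/= -/(budget m) IHm !exprS -!natr1.
by field.
Qed.

(** A grid point of level [m + 1] is either one of level [m] or its successor, so
    that the deviation at any grid point is a sum of one increment per level. *)
Let path n M L (x : n.-tuple T) :
  (forall m, (0 < m <= L)%N -> forall j, (j < 2 ^ m.-1)%N ->
     `|increment m j x| < Num.sqrt n%:R * scale M m) ->
  forall m, (m <= L)%N -> forall j, (j < 2 ^ m)%N ->
    `|deviation (grid m j) x| <= Num.sqrt n%:R * (M * budget m).
Proof.
move=> h; elim=> [_ j|m IHm mL j jm].
  rewrite expn0 ltnS leqn0 => /eqP ->.
  rewrite /deviation /grid mul0r A0 hits0 mulr0 subrr normr0.
  by rewrite /budget big_ord0 !mulr0.
have j2 : (j./2 < 2 ^ m)%N by rewrite ltn_half_double -mul2n -expnS.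
have gE : grid m.+1 j./2.*2 = grid m j./2.
  rewrite /grid -mul2n natrM exprS; field; exact: expf_neq0.
have IH := IHm (ltnW mL) _ j2.
have bE : Num.sqrt n%:R * (M * budget m.+1) =
    Num.sqrt n%:R * (M * budget m) + Num.sqrt n%:R * scale M m.+1.
  by rewrite /budget big_ord_recr/= /scale; ring.
have [jo|je] := boolP (odd j).
  have hj : j = j./2.*2.+1 by rewrite -[LHS]odd_double_half jo add1n.
  have {h} h := h m.+1 mL _ j2; rewrite bE.
  have -> : deviation (grid m.+1 j) x = deviation (grid m j./2) x + increment m.+1 j./2 x.
    rewrite /deviation /increment {1}hj -gE.
    rewrite (hitsD R _ (_ : A (grid m.+1 j./2.*2) `<=` _)); last first.
      by apply: subA; rewrite ler_pM2r ?invr_gt0 ?exprn_gt0// ler_nat.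
    have -> : grid m.+1 j = grid m.+1 j./2.*2 + 2 ^- m.+1.
      by rewrite {1}hj /grid -natr1 mulrDl mul1r.
    by ring.
  by apply: le_trans (ler_normD _ _) _; rewrite lerD// ltW.
have hj : j = j./2.*2 by rewrite -[LHS]odd_double_half (negbTE je) add0n.
rewrite hj gE bE (le_trans IH)// lerDl mulr_ge0 ?sqrtr_ge0//.
have := h m.+1 mL _ j2 => /(le_lt_trans (normr_ge0 _)) sc.
by have := sqrtr_ge0 (n%:R : R); rewrite le_eqVlt => /predU1P[s0|s0];
  [move: sc; rewrite -s0 mul0r ltxx|rewrite -(pmulr_rge0 _ s0) ltW].
Qed.

(** A union bound over all dyadic increments: there are [2 ^ (m - 1)] of them at
    level [m], and each is large with probability of order [expR (- M * (m + 1))],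
    which decreases faster as soon as [M >= 2]. *)
Lemma rare_chaining n L (M : R) : (0 < n)%N -> 2 <= M ->
  (7 / 5) ^+ L <= Num.sqrt n%:R / 2 :> R ->
  rare (power_prob P n)
    [set x | exists2 j, (j < 2 ^ L)%N &
       12 * M * Num.sqrt n%:R < `|deviation (j%:R / 2 ^+ L) x|]
    (4 * expR (4 - M)).
Proof.
move=> n0 M2 hL.
pose E i j : set (n.-tuple T) :=
  [set x | Num.sqrt n%:R * scale M i.+1 <= `|increment i.+1 j x|].
have lvl i : (i < L)%N -> rare (power_prob P n)
    [set x | exists2 j, (j < 2 ^ i)%N & E i j x]
    (2 * expR (4 - M) * (1 / 2) ^+ i).
  move=> iL.
  have := @rare_bigU _ _ _ (power_prob P n) (2 ^ i) (E i)
    (fun=> 2 * expR (4 - M * i.+2%:R)).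
  rewrite sumr_const card_ord => h; apply: rareW (h _); last first.
    move=> j ji; apply: rare_increment => //; apply: le_trans hL.
    by rewrite ler_weXn2l//; lra.
  have e4 : 4 <= expR M.
    apply: (@le_trans _ _ (expR 1 ^+ 2)).
      have := expR_ge1Dx (1 : R) => h1; have : 2 ^+ 2 <= expR 1 ^+ 2 :> R.
        by rewrite lerXn2r ?nnegrE ?expR_ge0//; lra.
      lra.
    by rewrite -expRM_natl ler_expR; lra.
  have -> : expR (4 - M * i.+2%:R) = expR (4 - M) * expR (- M) ^+ i.+1.
    by rewrite -expRM_natl -expRD -!natr1; congr expR; ring.
  rewrite -[_ *+ _]mulr_natl natrX.
  have -> : 2 ^+ i * (2 * (expR (4 - M) * expR (- M) ^+ i.+1)) =
      2 * expR (4 - M) * (expR (- M) * (2 * expR (- M)) ^+ i).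
    by rewrite exprMn exprS; ring.
  rewrite ler_wpM2l ?mulr_ge0 ?expR_ge0//.
  have eM : expR (- M) <= 1 / 4.
    by rewrite expRN div1r lef_pV2 ?posrE ?expR_gt0//; lra.
  have eM0 := expR_ge0 (- M).
  have : (2 * expR (- M)) ^+ i <= (1 / 2) ^+ i by rewrite lerXn2r ?nnegrE//; lra.
  have : 0 <= (2 * expR (- M)) ^+ i by rewrite exprn_ge0//; lra.
  by nra.
have := rare_bigU lvl.
have -> : \sum_(j < L) 2 * expR (4 - M) * (1 / 2) ^+ j =
    4 * expR (4 - M) * (1 - (1 / 2) ^+ L).
  rewrite -mulr_sumr; have : \sum_(i < L) (1 / 2 : R) ^+ i = 2 * (1 - (1 / 2) ^+ L).
    elim: (L) => [|l IHl]; first by rewrite big_ord0 expr0 subrr mulr0.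
    by rewrite big_ord_recr/= IHl exprS; field.
  by move=> ->; ring.
move=> h; apply: rareW (rareS _ h).
  by rewrite ler_piMr ?mulr_ge0 ?expR_ge0// gerBl exprn_ge0//; lra.
move=> x [j jL]; apply: contraPP => /forall2NP no; apply/negP; rewrite -leNgt.
have hh m : (0 < m <= L)%N -> forall j', (j' < 2 ^ m.-1)%N ->
     `|increment m j' x| < Num.sqrt n%:R * scale M m.
  move=> /andP[m0 mL] j' j'm; rewrite ltNge; apply/negP => hE.
  case: (no m.-1) => [|]; first by rewrite prednK// => /negP.
  by apply; exists j' => //; rewrite /E/= prednK.
apply: le_trans (path hh (leqnn L) jL) _.
rewrite mulrC ler_wpM2r ?sqrtr_ge0// [12 * M]mulrC ler_wpM2l ?budget_le//; lra.
Qed.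

End chaining.

Section empirical_process.
Context (R : realType) (P : probability R R).
Local Notation F := (dist_fun P).
Hypothesis cF : continuous F.

Lemma grid_between L (v : R) : 0 <= v <= 1 -> exists j,
  [/\ (j < 2 ^ L)%N, j%:R / 2 ^+ L <= v & v <= j.+1%:R / 2 ^+ L] /\
  (v < j.+1%:R / 2 ^+ L \/ j.+1 = (2 ^ L)%N).
Proof.
move=> /andP[v0 v1]; have g0 : 0 < 2 ^+ L :> R by rewrite exprn_gt0.
have [{}v1|v1'] := ltP v 1.
  have vg : 0 <= v * 2 ^+ L by rewrite mulr_ge0// ltW.
  have /andP[h1 h2] := Num.Theory.truncn_itv vg.
  exists (Num.truncn (v * 2 ^+ L)); rewrite ler_pdivrMr// ltr_pdivlMr//.
  split; last by left.
  split => //; last by rewrite ler_pdivlMr// ltW.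
  by rewrite -(ltr_nat R) natrX (le_lt_trans h1)// gtr_pMl.
have -> : v = 1 by apply/eqP; rewrite eq_le v1.
have e : (2 ^ L).-1.+1 = (2 ^ L)%N by rewrite prednK// expn_gt0.
exists (2 ^ L).-1; rewrite e natrX divff ?gt_eqF//; split; last by right.
split => //.
by rewrite ler_pdivrMr// mul1r -natrX ler_nat leq_pred.
Qed.

(** The dyadic grid is refined until its mesh is of order [n ^ (- 1 / 2)], so that
    monotonicity between neighbouring grid points costs only one more [M]. *)
Lemma rare_sup_deviation n (M : R) : (256 <= n)%N -> 2 <= M ->
  rare (power_prob P n)
    [set x | exists t, 13 * M < Num.sqrt n%:R * `|emp_dist_fun x t - F t|]
    (4 * expR (4 - M)).
Proof.
move=> n256 M2.
have n0 : (0 < n)%N by exact: leq_trans n256.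
have n0R : 0 < n%:R :> R by rewrite ltr0n.
set sn := Num.sqrt n%:R.
have sn0 : 0 < sn by rewrite sqrtr_gt0.
have sn2 : sn ^+ 2 = n%:R by rewrite sqr_sqrtr// ltW.
pose L := up_log 4 n.
have nL : (n <= 4 ^ L)%N by exact: up_logP.
have Ln : (4 ^ L.-1 < n)%N by apply: up_log_gtn => //; exact: leq_trans n256.
have L4 : (4 <= L)%N.
  rewrite leqNgt; apply/negP; rewrite ltnS => L3.
  by have := leq_trans n256 (leq_trans nL (leq_pexp2l (isT : 0 < 4)%N L3)).
have e4 l : (2 ^+ l) ^+ 2 = (4 ^ l)%:R :> R.
  by rewrite -exprM mulnC exprM natrX; congr (_ ^+ l); ring.
have snL : sn <= 2 ^+ L.
  rewrite -(@ler_pXn2r _ 2)// ?nnegrE ?exprn_ge0 ?(ltW sn0)//.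
  by rewrite sn2 e4 ler_nat.
have Lsn : 2 ^+ L <= 2 * sn.
  rewrite -[L in 2 ^+ L]prednK ?(leq_trans _ L4)// exprS ler_pM2l//.
  rewrite -(@ler_pXn2r _ 2)// ?nnegrE ?exprn_ge0 ?(ltW sn0)//.
  by rewrite sn2 e4 ler_nat ltnW.
have hL : (7 / 5) ^+ L <= sn / 2.
  have : (7 / 5 : R) ^+ L <= 2 ^+ L * (1 / 4).
    rewrite (_ : 7 / 5 = 2 * (7 / 10)); last by field.
    rewrite exprMn ler_wpM2l ?exprn_ge0//.
    rewrite -(subnK L4) exprD -[leRHS]mul1r ler_pM ?exprn_ge0//.
    - by rewrite exprn_ile1//; lra.
    - by rewrite !exprS expr0; lra.
  by lra.
have h := rare_chaining (@measurable_chain _ P) (chainE cF) (@chain_sub _ P)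
  (chain0 P) n0 M2 hL.
apply: rareS h => x [t]; apply: contraPP => /forall2NP no; apply/negP; rewrite -leNgt.
have dev j : (j < 2 ^ L)%N ->
    `|hits R (chain P (j%:R / 2 ^+ L)) x - n%:R * (j%:R / 2 ^+ L)| <= 12 * M * sn.
  by move=> jL; have [/(_ jL)//|] := no j => /negP; rewrite -leNgt.
have [j [[jL jv vj] vj']] := grid_between L (v := F t)
  ltac:(by rewrite dist_fun_ge0 dist_fun_le1).
have g0 : 0 < 2 ^+ L :> R by rewrite exprn_gt0.
have stepE : j.+1%:R / 2 ^+ L = j%:R / 2 ^+ L + (2 ^+ L)^-1 :> R.
  by rewrite -natr1 mulrDl mul1r.
have ng : n%:R * (2 ^+ L)^-1 <= sn.
  by rewrite ler_pdivrMr// -sn2 expr2 ler_pM2l.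
set H := hits R [set y | y <= t] x.
have H1 : n%:R * F t - sn - 12 * M * sn <= H.
  have jlt : j%:R / 2 ^+ L < 1 :> R by rewrite ltr_pdivrMr// mul1r -natrX ltr_nat.
  have := @hits_le R _ _ n _ _ x (chain_sub_halfline jv jlt); rewrite -/H => h1.
  have := dev _ jL; rewrite ler_norml => /andP[h2 _].
  have : n%:R * F t <= n%:R * (j%:R / 2 ^+ L) + n%:R * (2 ^+ L)^-1.
    by rewrite -mulrDr -stepE ler_wpM2l.
  lra.
have H2 : H <= n%:R * F t + sn + 12 * M * sn.
  have nv : n%:R * (j.+1%:R / 2 ^+ L) <= n%:R * F t + sn.
    by rewrite stepE mulrDr lerD// ler_wpM2l.
  have [jL'|jL'] := ltnP j.+1 (2 ^ L).
    case: vj' => [vj'|e]; last by rewrite e ltnn in jL'.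
    have := @hits_le R _ _ n _ _ x (halfline_sub_chain vj'); rewrite -/H => h1.
    have := dev _ jL'; rewrite ler_norml => /andP[_ h2].
    lra.
  have e : j.+1 = (2 ^ L)%N by apply/eqP; rewrite eqn_leq jL jL'.
  move: nv; rewrite e natrX divff ?gt_eqF// mulr1 => nv.
  have : H <= n%:R by exact: hits_lern.
  have : 0 <= 12 * M * sn by rewrite !mulr_ge0//; [lra|exact: ltW].
  lra.
rewrite emp_dist_funE -/H.
have -> : n%:R^-1 * H - F t = (H - n%:R * F t) / n%:R by field; rewrite gt_eqF.
rewrite normrM normfV (ger0_norm (ltW n0R)) -sn2.
rewrite mulrA -[leRHS](mulrK (unitf_gt0 (exprn_gt0 2 sn0))) ler_pM2r ?invr_gt0 ?exprn_gt0//.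
rewrite (_ : 13 * M * sn ^+ 2 = sn * (13 * M * sn)); last by ring.
rewrite ler_pM2l// sn2 ler_norml.
have : sn <= M * sn by rewrite ler_peMl//; [exact: ltW|lra].
by move=> ?; apply/andP; split; lra.
Qed.

End empirical_process.

(** * Lower bounds on the fluctuations in the tail *)

Section tail_fluctuations.
Context (R : realType) d (T : measurableType d) (P : probability T R).

Lemma has_mean_prod n (f : T -> R) c : (forall x, 0 <= f x) -> has_mean P f c ->
  has_mean (power_prob P n) (fun x => \prod_(i < n) f (tnth x i)) (c ^+ n).
Proof.
move=> f0 fc; have mf := has_mean_measurable fc; case: fc => _ fc.
have E := power_prob_prod n mf f0 fc; split => //.
apply/integrableP; split.
  by apply/measurable_EFinP; exact: measurable_tuple_prod.
under eq_integral do rewrite /= ger0_norm ?prodr_ge0//.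
by rewrite E ltry.
Qed.

Lemma has_mean_sum I (r : seq I) (f : I -> T -> R) (c : I -> R) :
  (forall i, has_mean P (f i) (c i)) ->
  has_mean P (fun x => \sum_(i <- r) f i x) (\sum_(i <- r) c i).
Proof.
move=> h; elim: r => [|i r IHr].
  rewrite big_nil (_ : (fun _ => _) = fun=> 0); first exact: has_mean_cst.
  by apply/funext => x; rewrite big_nil.
rewrite big_cons (_ : (fun _ => _) = fun x => f i x + \sum_(i <- r) f i x).
  exact: has_meanD.
by apply/funext => x; rewrite big_cons.
Qed.

(** If many nonnegative variables of mean 1 are nearly orthogonal once centred,
    then it is rare that all of them are small: their average has mean 1 and a small
    variance. *)
Lemma rare_all_small k (W : 'I_k -> T -> R) (b c : R) : (0 < k)%N ->
  0 <= b -> 0 <= c ->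
  (forall j, has_mean P (W j) 1) ->
  (forall i j, exists2 m, has_mean P (fun x => W i x * W j x) m &
     m <= if i == j then b else c) ->
  rare P [set x | forall j, W j x <= 2^-1] (4 * (b / k%:R + c - 1)).
Proof.
move=> k0 b0 c0 hW hWW.
have k0R : 0 < k%:R :> R by rewrite ltr0n.
have [m hm mle] : exists2 m : 'I_k -> 'I_k -> R,
    forall i j, has_mean P (fun x => W i x * W j x) (m i j) &
    forall i j, m i j <= if i == j then b else c.
  exists (fun i j => sval (cid2 (hWW i j))) => i j; by case: cid2.
pose A x := k%:R^-1 * \sum_(j < k) W j x.
have hA : has_mean P A 1.
  have := has_meanZ k%:R^-1 (has_mean_sum (index_enum 'I_k) hW).
  by rewrite sumr_const card_ord mulVf ?gt_eqF.
pose S := \sum_(i < k) \sum_(j < k) m i j.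
have hA2 : has_mean P (fun x => A x ^+ 2) ((k%:R ^+ 2)^-1 * S).
  have := has_meanZ (k%:R ^+ 2)^-1 (has_mean_sum (index_enum 'I_k)
     (fun i => has_mean_sum (index_enum 'I_k) (fun j => hm i j))).
  apply: eq_has_mean => x.
  rewrite /A exprMn exprVn; congr (_ * _).
  rewrite expr2 mulr_suml; apply: eq_bigr => i _.
  by rewrite mulr_sumr.
have Sle : (k%:R ^+ 2)^-1 * S <= b / k%:R + c.
  have : S <= \sum_(i < k) (b + k%:R * c).
    apply: ler_sum => i _.
    rewrite (bigD1 i)//= lerD//; first by have := mle i i; rewrite eqxx.
    apply: (@le_trans _ _ (\sum_(j < k | j != i) c)).
      by apply: ler_sum => j ji; have := mle i j; rewrite eq_sym (negbTE ji).
    rewrite sumr_const -[c *+ _]mulr_natl ler_wpM2r// ler_nat.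
    by rewrite (leq_trans (max_card _))// card_ord.
  rewrite sumr_const card_ord -[_ *+ k]mulr_natl => h.
  rewrite -(@ler_pM2l _ (k%:R ^+ 2)) ?exprn_gt0// mulVKf ?expf_neq0 ?gt_eqF//.
  apply: le_trans h _; rewrite le_eqVlt; apply/orP; left; apply/eqP.
  by field; rewrite gt_eqF.
exists (fun x => 4 * (A x - 1) ^+ 2).
  have := has_meanZ 4 (has_meanD (has_meanB hA2 (has_meanZ 2 hA)) (has_mean_cst P 1)).
  move=> h; have h' : has_mean P (fun x => 4 * (A x - 1) ^+ 2)
      (4 * ((k%:R ^+ 2)^-1 * S - 2 * 1 + 1)).
    by apply: eq_has_mean h => x; ring.
  apply: (mean_leW _ (has_mean_mean_le _ h')); last first.
    by move=> x; rewrite mulr_ge0// sqr_ge0.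
  by rewrite ler_pM2l//; lra.
move=> x hx; have : A x <= 2^-1.
  rewrite /A ler_pdivrMl// (le_trans (ler_sum _ (fun j _ => hx j)))//.
  by rewrite sumr_const card_ord mulr_natl.
by move=> ?; nra.
Qed.

End tail_fluctuations.

Section binomial_tilts.
Context (R : realType) d (T : measurableType d) (P : probability T R).

Definition std_indic (A : set T) (v : R) (x : T) : R :=
  (\1_A x - v) / Num.sqrt (v * (1 - v)).

(** The likelihood ratio of a sample whose law is perturbed, at the scale
    [n ^ (- 1 / 2)], in the direction of the set [A]. *)
Definition tilt n (l : R) (A : set T) (v : R) (x : n.-tuple T) : R :=
  \prod_(i < n) (1 + l / Num.sqrt n%:R * std_indic A v (tnth x i)).

Lemma sqrt_var_gt0 (v : R) : 0 < v < 1 -> 0 < Num.sqrt (v * (1 - v)).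
Proof. by move=> /andP[v0 v1]; rewrite sqrtr_gt0 mulr_gt0// subr_gt0. Qed.

Lemma std_indic_bound (A : set T) (v : R) x : 0 < v < 1 ->
  `|std_indic A v x| <= (Num.sqrt (v * (1 - v)))^-1.
Proof.
move=> v01; have s0 := sqrt_var_gt0 v01; have /andP[v0 v1] := v01.
rewrite /std_indic normrM normfV (gtr0_norm s0) ler_piMl ?invr_ge0 ?(ltW s0)//.
by rewrite indicE; case: (_ \in _) => /=; rewrite ler_norml; apply/andP; split; lra.
Qed.

Lemma has_mean_std_indic (A : set T) (v : R) : measurable A -> P A = v%:E ->
  has_mean P (std_indic A v) 0.
Proof.
move=> mA PA; have := has_meanZ (Num.sqrt (v * (1 - v)))^-1
  (has_meanB (has_mean_indic P mA) (has_mean_cst P v)).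
by rewrite PA subrr mulr0; apply: eq_has_mean => x; rewrite mulrC.
Qed.

Lemma has_mean_std_indicM (A B : set T) (v w : R) : measurable A -> measurable B ->
  A `<=` B -> 0 < v < 1 -> 0 < w < 1 -> P A = v%:E -> P B = w%:E ->
  exists2 c, has_mean P (fun x => std_indic A v x * std_indic B w x) c &
    c <= Num.sqrt (v / w).
Proof.
move=> mA mB AB v01 w01 PA PB.
have sv := sqrt_var_gt0 v01; have sw := sqrt_var_gt0 w01.
have /andP[v0 v1] := v01; have /andP[w0 w1] := w01.
have h := has_meanZ ((Num.sqrt (v * (1 - v)))^-1 * (Num.sqrt (w * (1 - w)))^-1)
  (has_meanD (has_meanB (has_meanB (has_mean_indic P mA) (has_meanZ w (has_mean_indic P mA)))
     (has_meanZ v (has_mean_indic P mB))) (has_mean_cst P (v * w))).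
rewrite PA PB /= in h.
exists ((Num.sqrt (v * (1 - v)))^-1 * (Num.sqrt (w * (1 - w)))^-1 *
   (v - w * v - v * w + v * w)).
  apply: eq_has_mean h => x; rewrite /std_indic.
  have : \1_A x * \1_B x = \1_A x :> R.
    rewrite !indicE; case: (boolP (x \in A)) => [/set_mem/AB/mem_set ->|_];
      by rewrite ?mulr1 ?mul0r.
  move=> e; rewrite [RHS](_ : _ = (Num.sqrt (v * (1 - v)))^-1 * (Num.sqrt (w * (1 - w)))^-1 *
    (\1_A x * \1_B x - w * \1_A x - v * \1_B x + v * w)); first by rewrite e.
  by field; rewrite !gt_eqF.
have -> : v - w * v - v * w + v * w = v * (1 - w) by ring.
rewrite -(@ler_pXn2r _ 2)// ?nnegrE ?sqrtr_ge0//; last first.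
  by rewrite !mulr_ge0 ?invr_ge0 ?sqrtr_ge0 ?subr_ge0 ?(ltW v0) ?(ltW w1).
rewrite !exprMn !exprVn !sqr_sqrtr ?mulr_ge0 ?invr_ge0 ?subr_ge0 ?(ltW v0) ?(ltW w0) ?(ltW v1) ?(ltW w1)//.
rewrite [leLHS](_ : _ = (v / w) * ((1 - w) / (1 - v))); last first.
  by field; rewrite !gt_eqF//= ?subr_gt0.
have vw : v <= w by rewrite -lee_fin -PA -PB le_measure ?inE.
rewrite ler_piMr ?divr_ge0 ?(ltW v0) ?(ltW w0)// ler_pdivrMr ?subr_gt0// mul1r.
by rewrite lerD2l lerN2.
Qed.

Let step_ge0 n (l : R) (A : set T) (v : R) x : 0 < v < 1 -> 0 <= l ->
  l / Num.sqrt (v * (1 - v)) <= Num.sqrt n%:R -> (0 < n)%N ->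
  `|l / Num.sqrt n%:R * std_indic A v x| <= 1.
Proof.
move=> v01 l0 hl n0; have s0 := sqrt_var_gt0 v01.
have sn0 : 0 < Num.sqrt n%:R :> R by rewrite sqrtr_gt0 ltr0n.
rewrite normrM ger0_norm; last by rewrite divr_ge0 ?sqrtr_ge0.
have := @std_indic_bound A v x v01 => hb.
have : l / Num.sqrt n%:R * `|std_indic A v x| <=
    l / Num.sqrt n%:R * (Num.sqrt (v * (1 - v)))^-1.
  by rewrite ler_wpM2l// divr_ge0// sqrtr_ge0.
move/le_trans; apply; rewrite mulrAC ler_pdivrMr// mul1r.
by [].
Qed.

Lemma has_mean_tilt n (l : R) (A : set T) (v : R) :
  measurable A -> P A = v%:E -> 0 < v < 1 -> 0 <= l -> (0 < n)%N ->
  l / Num.sqrt (v * (1 - v)) <= Num.sqrt n%:R ->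
  has_mean (power_prob P n) (tilt l A v) 1.
Proof.
move=> mA PA v01 l0 n0 hl; rewrite -[X in has_mean _ _ X](expr1n _ n).
apply: (@has_mean_prod _ _ _ _ n (fun t => 1 + l / Num.sqrt n%:R * std_indic A v t)).
  by move=> x; have := step_ge0 A x v01 l0 hl n0; rewrite ler_norml => /andP[]; lra.
have := has_meanD (has_mean_cst P 1) (has_meanZ (l / Num.sqrt n%:R)
  (has_mean_std_indic mA PA)).
by rewrite mulr0 addr0.
Qed.

(** Likelihood ratios in the directions of nested sets of very different
    probabilities are nearly uncorrelated. *)
Lemma has_mean_tiltM n (l : R) (A B : set T) (v w : R) :
  measurable A -> measurable B -> A `<=` B -> P A = v%:E -> P B = w%:E ->
  0 < v < 1 -> 0 < w < 1 -> 0 <= l -> (0 < n)%N ->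
  l / Num.sqrt (v * (1 - v)) <= Num.sqrt n%:R ->
  l / Num.sqrt (w * (1 - w)) <= Num.sqrt n%:R ->
  exists2 m, has_mean (power_prob P n)
      (fun x => tilt l A v x * tilt l B w x) m &
    m <= expR (l ^+ 2 * Num.sqrt (v / w)).
Proof.
move=> mA mB AB PA PB v01 w01 l0 n0 hv hw.
have n0R : 0 < n%:R :> R by rewrite ltr0n.
have [c hc cle] := has_mean_std_indicM mA mB AB v01 w01 PA PB.
set th := l / Num.sqrt n%:R.
pose f x := (1 + th * std_indic A v x) * (1 + th * std_indic B w x).
have f0 x : 0 <= f x.
  have := step_ge0 A x v01 l0 hv n0; have := step_ge0 B x w01 l0 hw n0.
  rewrite -/th !ler_norml => /andP[? _] /andP[? _].
  by apply: mulr_ge0; lra.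
have hf : has_mean P f (1 + th ^+ 2 * c).
  apply: (has_mean_eq (has_meanD (has_meanD (has_mean_cst P 1)
    (has_meanZ th (has_mean_std_indic mA PA)))
    (has_meanD (has_meanZ th (has_mean_std_indic mB PB)) (has_meanZ (th ^+ 2) hc)))).
    by move=> x; rewrite /f; ring.
  by ring.
exists ((1 + th ^+ 2 * c) ^+ n).
  apply: eq_has_mean (has_mean_prod n f0 hf) => x.
  by rewrite /tilt -big_split.
have th2 : th ^+ 2 = l ^+ 2 / n%:R.
  by rewrite /th exprMn exprVn sqr_sqrtr ?ltW.
have -> : l ^+ 2 * Num.sqrt (v / w) = n%:R * (th ^+ 2 * Num.sqrt (v / w)).
  by rewrite th2; field; rewrite gt_eqF.
rewrite expRM_natl lerXn2r ?nnegrE ?expR_ge0//.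
  exact: has_mean_le (has_mean_cst P 0) hf f0.
apply: le_trans (expR_ge1Dx _); rewrite lerD2l ler_wpM2l// sqr_ge0//.
Qed.

Lemma expR_ge_quadratic (x : R) : -1 <= x <= 1 -> 1 + x <= expR (x - x ^+ 2 / 8).
Proof.
move=> /andP[x1 x2]; set u := x - x ^+ 2 / 8.
have h : 1 + u / 2 <= expR (u / 2) by exact: expR_ge1Dx.
have -> : expR u = expR (u / 2) ^+ 2.
  by rewrite -expRM_natl; congr expR; field.
have x20 : 0 <= x ^+ 2 by exact: sqr_ge0.
have x21 : x ^+ 2 <= 1 by nra.
have u0 : 0 <= 1 + u / 2 by rewrite /u; lra.
have h2 : (1 + u / 2) ^+ 2 <= expR (u / 2) ^+ 2 by rewrite lerXn2r ?nnegrE ?expR_ge0.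
apply: le_trans h2; rewrite -subr_ge0.
rewrite (_ : _ - _ = x ^+ 2 / 4 * ((1 - x / 8) ^+ 2 - 2^-1)); last by rewrite /u; field.
rewrite mulr_ge0 ?divr_ge0//; nra.
Qed.

(** A likelihood ratio that is not small forces the count to deviate: otherwise
    its logarithm is at most [l * M - l ^ 2 / 16] with [l = 32 * M]. *)
Lemma tilt_small n (M : R) (A : set T) (v : R) (x : n.-tuple T) :
  0 < v < 1 -> 1 <= M -> (0 < n)%N ->
  32 * M / Num.sqrt (v * (1 - v)) <= Num.sqrt n%:R ->
  `|hits R A x - n%:R * v| <= M * Num.sqrt (v * (1 - v)) * Num.sqrt n%:R ->
  tilt (32 * M) A v x <= 2^-1.
Proof.
move=> v01 M1 n0 hl hd; have s0 := sqrt_var_gt0 v01; have /andP[v0 v1] := v01.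
have n0R : 0 < n%:R :> R by rewrite ltr0n.
set s := Num.sqrt (v * (1 - v)) in s0 hl hd.
set l := 32 * M in hl *; have l0 : 0 <= l by rewrite /l; lra.
set sn := Num.sqrt n%:R in hl hd *.
have sn0 : 0 < sn by rewrite sqrtr_gt0.
have sn2 : sn ^+ 2 = n%:R by rewrite sqr_sqrtr// ltW.
have s2 : s ^+ 2 = v * (1 - v) by rewrite sqr_sqrtr// mulr_ge0 ?subr_ge0 ?(ltW v0) ?(ltW v1).
set Z := hits R A x - n%:R * v in hd.
have ZE : \sum_(i < n) std_indic A v (tnth x i) = Z / s.
  rewrite /Z /std_indic -mulr_suml sumrB; congr ((_ - _) / _).
  by rewrite sumr_const card_ord -[_ *+ n]mulr_natl.
have Z2E : \sum_(i < n) std_indic A v (tnth x i) ^+ 2 = n%:R + (1 - 2 * v) / s * (Z / s).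
  have sq t : std_indic A v t ^+ 2 = 1 + (1 - 2 * v) / s * std_indic A v t.
    rewrite /std_indic -/s [RHS](_ : _ = (s ^+ 2 + (1 - 2 * v) * (\1_A t - v)) / s ^+ 2).
      rewrite expr_div_n s2 indicE; congr (_ / _).
      by case: (_ \in _) => /=; ring.
    by field; rewrite gt_eqF.
  rewrite (eq_bigr _ (fun i _ => sq (tnth x i))) big_split/= -mulr_sumr ZE.
  by rewrite sumr_const card_ord.
have h1 : tilt l A v x <= expR (\sum_(i < n)
   (l / sn * std_indic A v (tnth x i) - (l / sn * std_indic A v (tnth x i)) ^+ 2 / 8)).
  rewrite expR_sum; apply: ler_prod => i _.
  have := step_ge0 A (tnth x i) v01 l0 hl n0; rewrite ler_norml => /andP[b1 b2].
  apply/andP; split; first by rewrite -/sn in b1; lra.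
  by apply: expR_ge_quadratic; rewrite b1.
apply: (le_trans h1).
have -> : \sum_(i < n)
   (l / sn * std_indic A v (tnth x i) - (l / sn * std_indic A v (tnth x i)) ^+ 2 / 8) =
   l / sn * (Z / s) - (l / sn) ^+ 2 / 8 * (n%:R + (1 - 2 * v) / s * (Z / s)).
  rewrite sumrB -mulr_sumr ZE -Z2E mulr_sumr; congr (_ - _).
  by apply: eq_bigr => i _; rewrite exprMn; ring.
set z := Z / s.
have hz : `|z| <= M * sn.
  rewrite /z normrM normfV (gtr0_norm s0) ler_pdivrMr//.
  by rewrite mulrAC.
have hk : `|(1 - 2 * v) / s * z| <= n%:R / 2.
  rewrite normrM normrM normfV (gtr0_norm s0).
  have b1 : `|1 - 2 * v| <= 1 by rewrite ler_norml; apply/andP; split; lra.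
  have b2 : `|1 - 2 * v| / s <= s^-1 by rewrite ler_piMl// invr_ge0 ltW.
  have b3 : s^-1 * M <= sn / 32.
    by move: hl; rewrite /l ler_pdivlMr// => ?; rewrite mulrC; lra.
  have : `|1 - 2 * v| / s * `|z| <= s^-1 * (M * sn).
    by apply: ler_pM => //; rewrite divr_ge0// ltW.
  rewrite mulrA => b4; have : s^-1 * M * sn <= sn / 32 * sn by rewrite ler_wpM2r// ltW.
  have -> : sn / 32 * sn = n%:R / 32 by rewrite -sn2; field.
  by lra.
have hlz : l / sn * z <= l * M.
  rewrite mulrAC ler_pdivrMr// -[leRHS]mulrA ler_wpM2l//.
  by apply: le_trans (ler_norm z) _.
have hlk : (l / sn) ^+ 2 / 8 * (n%:R / 2) <= (l / sn) ^+ 2 / 8 * (n%:R + (1 - 2 * v) / s * z).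
  rewrite ler_wpM2l ?divr_ge0 ?sqr_ge0//.
  by move: hk; rewrite ler_norml => /andP[]; lra.
have e1 : (l / sn) ^+ 2 / 8 * (n%:R / 2) = l ^+ 2 / 16.
  by rewrite -sn2; field; rewrite gt_eqF.
apply: (@le_trans _ _ (expR (- 1))).
  rewrite ler_expR (le_trans (lerB hlz hlk))// e1 /l; nra.
rewrite expRN lef_pV2 ?posrE ?expR_gt0//.
by have := expR_ge1Dx (1 : R); lra.
Qed.

End binomial_tilts.

Section tail_points.
Context (R : realType) (P : probability R R).
Local Notation F := (dist_fun P).
Hypothesis cF : continuous F.

(** Points whose levels decrease geometrically with a small ratio see nearly
    independent normalised deviations, so that one of them is large: otherwise all
    the likelihood ratios [tilt] at these points would be small. *)
Lemma rare_flat_tail (del M eta : R) : 0 < del <= 2^-1 -> 1 <= M -> 0 < eta ->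
  exists k (t : 'I_k -> R), (forall j, 0 < F (t j) < del) /\
  exists n0, forall n, (n0 <= n)%N ->
    rare (power_prob P n)
      [set x | forall j, `|hits R [set y | y <= t j] x - n%:R * F (t j)| <=
         M * Num.sqrt (F (t j) * (1 - F (t j))) * Num.sqrt n%:R] eta.
Proof.
move=> /andP[del0 del2] M1 eta0; pose l := 32 * M.
have l0 : 0 < l by rewrite /l; lra.
have l2 : 0 < l ^+ 2 by rewrite exprn_gt0.
(* The square root [r] of the ratio of successive levels bounds the correlation of
   the tilted directions, and [l ^ 2 * r] must be small with [eta]. *)
pose r := Num.min 2^-1 (eta / 16) / l ^+ 2.
have m0 : 0 < Num.min 2^-1 (eta / 16) by rewrite lt_min; lra.
have r0 : 0 < r by rewrite divr_gt0.
have lr : l ^+ 2 * r = Num.min 2^-1 (eta / 16) by rewrite mulrC divfK ?gt_eqF.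
have r1 : r < 1.
  rewrite ltr_pdivrMr// mul1r gt_min; apply/orP; left.
  have : 1 <= l by rewrite /l; lra.
  by move=> l1; have := exprn_ege1 2 l1; lra.
have hc : 4 * (expR (l ^+ 2 * r) - 1) <= eta / 2.
  have h1 : l ^+ 2 * r <= 2^-1 by rewrite lr ge_min lexx.
  have h2 : l ^+ 2 * r <= eta / 16 by rewrite lr ge_min lexx orbT.
  have h0 : 0 < l ^+ 2 * r by rewrite mulr_gt0.
  have := expR_le_quadratic h1; set u := l ^+ 2 * r in h0 h1 h2 *; nra.
pose k := (Num.truncn (8 * expR (l ^+ 2) / eta)).+1.
have hk : 4 * (expR (l ^+ 2) / k%:R) <= eta / 2.
  have k0 : 0 < k%:R :> R by rewrite ltr0n.
  have : 8 * expR (l ^+ 2) / eta < k%:R by exact: Num.Theory.truncnS_gt.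
  rewrite ltr_pdivrMr// => h; rewrite mulrA ler_pdivrMr//; lra.
pose v (j : 'I_k) := del * (r ^+ 2) ^+ j.+1.
have r20 : 0 < r ^+ 2 by rewrite exprn_gt0.
have r21 : r ^+ 2 < 1 by rewrite exprn_ilt1// ltW.
have v01 j : 0 < v j < del.
  by rewrite /v mulr_gt0 ?exprn_gt0//= gtr_pMr// exprn_ilt1// ltW.
have v0 j : 0 < v j by case/andP: (v01 j).
have v1 j : 0 < v j < 1 by have /andP[-> ?] := v01 j; rewrite /=; lra.
pose t j := sval (cid (dist_fun_surj cF (v1 j))).
have Ft j : F (t j) = v j by rewrite /t; case: cid.
exists k, t; split; first by move=> j; rewrite Ft.
pose vm := del * (r ^+ 2) ^+ k.
have vm0 : 0 < vm by rewrite mulr_gt0// exprn_gt0.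
have vmv j : vm <= v j.
  by rewrite ler_pM2l// ler_wiXn2l// ?(ltW r20)// ltW.
exists (Num.truncn (2 * l ^+ 2 / vm)).+1 => n n0.
have npos : (0 < n)%N by exact: leq_trans n0.
have hn : 2 * l ^+ 2 / vm <= n%:R.
  by apply: le_trans (_ : (Num.truncn (2 * l ^+ 2 / vm)).+1%:R <= _);
    [exact/ltW/Num.Theory.truncnS_gt|rewrite ler_nat].
have hs j : l / Num.sqrt (v j * (1 - v j)) <= Num.sqrt n%:R.
  have s0 := sqrt_var_gt0 (v1 j).
  have sq0 : 0 <= Num.sqrt n%:R * Num.sqrt (v j * (1 - v j)).
    by rewrite mulr_ge0 ?sqrtr_ge0.
  rewrite ler_pdivrMr// -(@ler_pXn2r _ 2)// ?nnegrE ?sq0 ?(ltW l0)//.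
  have /andP[va vb] := v01 j; have vc := vmv j.
  have nn : 0 <= v j * (1 - v j) by rewrite mulr_ge0//; lra.
  rewrite [in leRHS]exprMn (sqr_sqrtr nn) sqr_sqrtr ?ler0n//.
  have : vm / 2 <= v j * (1 - v j) by nra.
  move=> h1; have : n%:R * (vm / 2) <= n%:R * (v j * (1 - v j)) by rewrite ler_wpM2l.
  by apply: le_trans; move: hn; rewrite ler_pdivrMr//; lra.
have PA j : P [set y | y <= t j] = (v j)%:E by rewrite dist_funE Ft.
pose W := fun j : 'I_k => (tilt l [set y | y <= t j] (v j) : n.-tuple R -> R).
have hW j : has_mean (power_prob P n) (W j) 1.
  by apply: has_mean_tilt => //; [exact: measurable_halfline|exact: ltW].
have sub (i j : 'I_k) : (i <= j)%N -> [set y | y <= t j] `<=` [set y | y <= t i].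
  rewrite leq_eqVlt => /predU1P[/ord_inj -> //|ij] y /= /le_trans; apply.
  apply/ltW/(@dist_fun_lt _ P); rewrite !Ft ltr_pM2l//.
  by rewrite ltr_iXn2l ?ltnS.
have hvv (i j : 'I_k) : (i < j)%N -> Num.sqrt (v j / v i) <= r.
  move=> ij; rewrite -[leRHS](gtr0_norm r0) -sqrtr_sqr ler_wsqrtr//.
  rewrite ler_pdivrMr// /v mulrCA ler_pM2l// -exprS.
  by rewrite ler_wiXn2l// ltW.
have hWW i j : exists2 m, has_mean (power_prob P n) (fun x => W i x * W j x) m &
    m <= if i == j then expR (l ^+ 2) else expR (l ^+ 2 * r).
  wlog ij : i j / (j <= i)%N => [h|].
    have [ij|/ltnW ij] := leqP j i; first exact: h.
    have [m hm mle] := h j i ij; exists m; last by rewrite eq_sym.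
    by apply: eq_has_mean hm => x; rewrite mulrC.
  have [m hm mle] := has_mean_tiltM (measurable_halfline (t i)) (measurable_halfline (t j))
    (sub _ _ ij) (PA i) (PA j) (v1 i) (v1 j) (ltW l0) npos (hs i) (hs j).
  exists m => //; apply: (le_trans mle); case: eqVneq => [->|neq].
    by rewrite divff ?gt_eqF// sqrtr1 mulr1.
  rewrite ler_expR ler_pM2l// hvv// ltn_neqAle ij andbT.
  by apply: contra neq => /eqP/ord_inj ->.
have h := rare_all_small (ltn0Sn _) (expR_ge0 _) (expR_ge0 _) hW hWW.
apply: rareW (rareS _ h); first by rewrite -/k; lra.
move=> x hx j; apply: tilt_small => //.
by have := hx j; rewrite Ft.
Qed.

End tail_points.

(** * The divergence kernels near and far from the diagonal *)

Section phi_bounds.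
Context (R : realType).

Lemma is_derive_ge0_le (h h1 : R -> R) (a b : R) : 0 < a -> a <= b ->
  (forall y : R, 0 < y -> is_derive y 1 h (h1 y)) ->
  (forall y, a <= y <= b -> 0 <= h1 y) -> h a <= h b.
Proof.
move=> a0 ab dh h1p.
have [c cab] : exists2 c, c \in `[a, b]%R & h b - h a = h1 c * (b - a).
  apply: MVT_segment => // [y|].
    by rewrite in_itv/= => /andP[ay _]; apply: dh; exact: lt_trans ay.
  apply: derivable_within_continuous => y; rewrite in_itv/= => /andP[ay _].
  by have [] := dh y (lt_le_trans a0 ay).
move=> e; rewrite -subr_ge0 e mulr_ge0 ?subr_ge0// h1p//.
Qed.

(** Integrating a bound on the second derivative twice, away from 1. *)
Lemma second_order_ge (f f1 f2 : R -> R) (x m : R) : 0 < x ->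
  (forall y : R, 0 < y -> is_derive y 1 f (f1 y)) ->
  (forall y : R, 0 < y -> is_derive y 1 f1 (f2 y)) ->
  f 1 = 0 -> f1 1 = 0 ->
  (forall y, (1 <= y <= x) || (x <= y <= 1) -> m <= f2 y) ->
  m / 2 * (x - 1) ^+ 2 <= f x.
Proof.
move=> x0 df df1 fz f1z hf2.
pose g y : R := f y - m / 2 * (y - 1) ^+ 2.
pose g1 y : R := f1 y - m * (y - 1).
have dg (y : R) : 0 < y -> is_derive y 1 g (g1 y).
  move=> y0; have h := df y y0.
  have -> : g = f - (m / 2) *: ((id - cst 1) * (id - cst 1)).
    by apply/funext => z; rewrite /g !fctE expr2.
  apply: is_derive_eq; rewrite /g1 /GRing.scale/= !fctE; by field.
have dg1 (y : R) : 0 < y -> is_derive y 1 g1 (f2 y - m).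
  move=> y0; have h := df1 y y0.
  have -> : g1 = f1 - m *: (id - cst 1).
    by apply/funext => z; rewrite /g1 !fctE.
  apply: is_derive_eq; rewrite /GRing.scale/=; ring.
have dNg (y : R) : 0 < y -> is_derive y 1 (- g) (- g1 y).
  by move=> y0; have h := dg y y0; exact: is_deriveN.
have g11 : g1 1 = 0 by rewrite /g1 f1z subrr mulr0 subrr.
have gz : g 1 = 0 by rewrite /g fz subrr expr0n/= mulr0 subrr.
suff : 0 <= g x by rewrite subr_ge0.
have [x1|x1] := leP 1 x.
  rewrite -gz; apply: (is_derive_ge0_le ltr01 x1 dg) => y /andP[y1 yx].
  rewrite -g11; apply: (is_derive_ge0_le ltr01 y1 dg1) => z /andP[z1 zy].
  by rewrite subr_ge0 hf2// z1 (le_trans zy).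
have := is_derive_ge0_le x0 (ltW x1) dNg; rewrite /= !fctE gz oppr0 oppr_le0; apply.
move=> y /andP[xy y1]; rewrite oppr_ge0 -g11.
apply: (is_derive_ge0_le (lt_le_trans x0 xy) y1 dg1) => z /andP[yz z1].
by rewrite subr_ge0 hf2// (le_trans xy yz) z1 orbT.
Qed.

Lemma second_order_le (f f1 f2 : R -> R) (x M : R) : 0 < x ->
  (forall y : R, 0 < y -> is_derive y 1 f (f1 y)) ->
  (forall y : R, 0 < y -> is_derive y 1 f1 (f2 y)) ->
  f 1 = 0 -> f1 1 = 0 ->
  (forall y, (1 <= y <= x) || (x <= y <= 1) -> f2 y <= M) ->
  f x <= M / 2 * (x - 1) ^+ 2.
Proof.
move=> x0 df df1 fz f1z hf2.
have := @second_order_ge (- f) (fun y => - f1 y) (fun y => - f2 y) x (- M) x0.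
rewrite !fctE fz f1z oppr0 !mulNr lerN2; apply => //.
- by move=> y y0; have h := df y y0; exact: is_deriveN.
- by move=> y y0; have h := df1 y y0; exact: is_deriveN.
- by move=> y /hf2; rewrite lerN2.
Qed.

Definition phi_real (s x : R) : R :=
  if s == 0 then x - ln x - 1
  else if s == 1 then x * (ln x - 1) + 1
  else (1 - s + s * x - x `^ s) / (s * (1 - s)).

Lemma phi_div_real (s x : R) : 0 < x -> phi_div s x = (phi_real s x)%:E.
Proof.
move=> x0; rewrite /phi_div /phi_real (gt_eqF x0) andbF.
by case: (s == 0); case: (s == 1).
Qed.

Lemma ratio_pow_bound (x y a : R) : 0 < x -> (1 <= y <= x) || (x <= y <= 1) ->
  (Num.max x x^-1 `^ `|a|)^-1 <= y `^ a <= Num.max x x^-1 `^ `|a|.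
Proof.
move=> x0 yx; set m := Num.max x x^-1.
have m1 : 1 <= m.
  by rewrite le_max; have [//|x1] := leP 1 x; rewrite orFb invf_ge1// ltW.
have m0 : 0 < m by exact: lt_le_trans m1.
have y0 : 0 < y.
  by case/orP: yx => /andP[? _]; [exact: lt_le_trans ltr01 _|exact: lt_le_trans x0 _].
have ym : y <= m.
  rewrite le_max; case/orP: yx => /andP[y1 y2]; first by rewrite y2.
  apply/orP; right; apply: (le_trans y2); rewrite invf_ge1//; exact: le_trans y2.
have my : m^-1 <= y.
  rewrite -[y]invrK lef_pV2 ?posrE ?invr_gt0// le_max.
  case/orP: yx => /andP[y1 y2]; last first.
    by apply/orP; right; rewrite lef_pV2 ?posrE.
  by apply/orP; left; apply: (@le_trans _ _ 1); [rewrite invf_le1|exact: le_trans y2].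
have lny : `|ln y| <= ln m.
  rewrite ler_norml -lnV ?posrE//; apply/andP; split;
    by rewrite ler_ln ?posrE ?invr_gt0.
rewrite /powR !gt_eqF// -expRN !ler_expR -ler_norml normrM.
by rewrite ler_wpM2l.
Qed.

(** The second derivative of [phi_real s] is [x `^ (s - 2)] for every [s]. *)
Lemma phi_real_bounds (s x : R) : 0 < x ->
  (Num.max x x^-1 `^ `|s - 2|)^-1 / 2 * (x - 1) ^+ 2 <= phi_real s x <=
  Num.max x x^-1 `^ `|s - 2| / 2 * (x - 1) ^+ 2.
Proof.
move=> x0; set m := Num.max x x^-1 `^ `|s - 2|.
pose f1 (y : R) : R := if s == 1 then ln y else (y `^ (s - 1) - 1) / (s - 1).
have df (y : R) : 0 < y -> is_derive y 1 (phi_real s) (f1 y).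
  move=> y0; have hl := is_derive1_ln y0; have hp := is_derive1_powR s y0.
  rewrite /f1; have [s0|s0] := eqVneq s 0.
    have -> : phi_real s = id - @ln R - cst 1.
      by apply/funext => z; rewrite /phi_real s0 eqxx !fctE.
    rewrite s0 eq_sym oner_eq0 sub0r.
    apply: is_derive_eq; rewrite powR_inv1 ?(ltW y0)//; field.
    by rewrite gt_eqF.
  have [s1|s1] := eqVneq s 1.
    have -> : phi_real s = id * (@ln R - cst 1) + cst 1.
      by apply/funext => z; rewrite /phi_real s1 oner_eq0 eqxx !fctE.
    apply: is_derive_eq; rewrite /GRing.scale/= !fctE; field.
    by rewrite gt_eqF.
  have -> : phi_real s = (s * (1 - s))^-1 *: (cst (1 - s) + s *: id - (@powR R ^~ s)).
    by apply/funext => z; rewrite /phi_real (negbTE s0) (negbTE s1) !fctE /GRing.scale/= mulrC.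
  have hd := is_deriveZ (s * (1 - s))^-1 (is_deriveB (is_deriveD
    (is_derive_cst (1 - s) y 1) (is_deriveZ s (is_derive_id y 1))) hp).
  apply: (is_derive_eq hd); rewrite /GRing.scale/=.
  have s1' : s - 1 != 0 by rewrite subr_eq0.
  have s1'' : 1 - s != 0 by rewrite subr_eq0 eq_sym.
  move: (y `^ (s - 1)) => p; rewrite add0r mulr1.
  have -> : s - s * p = s * (1 - p) by ring.
  rewrite invfM mulrACA mulVf// mul1r mulrC -[1 - p]opprB -[1 - s]opprB.
  by rewrite invrN mulrNN.
have df1 (y : R) : 0 < y -> is_derive y 1 f1 (y `^ (s - 2)).
  move=> y0; have hl := is_derive1_ln y0; have hp := is_derive1_powR (s - 1) y0.
  rewrite /f1; have [s1|s1] := eqVneq s 1.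
    apply: is_derive_eq; rewrite s1 (_ : 1 - 2 = -1); last by ring.
    by rewrite powR_inv1// ltW.
  have -> : (fun y0 : R => (y0 `^ (s - 1) - 1) / (s - 1)) =
      (s - 1)^-1 *: ((@powR R ^~ (s - 1)) - cst 1).
    by apply/funext => z; rewrite !fctE /GRing.scale/= mulrC.
  have hd := is_deriveZ (s - 1)^-1 (is_deriveB hp (is_derive_cst (1 : R) y 1)).
  apply: (is_derive_eq hd); rewrite /GRing.scale/= subr0.
  rewrite mulrA mulVf ?subr_eq0// mul1r; congr (_ `^ _); ring.
have f0 : phi_real s 1 = 0.
  rewrite /phi_real ln1 powR1; case: eqVneq => [_|s0]; first by ring.
  by case: eqVneq => [_|s1]; [ring|rewrite (_ : _ - 1 = 0) ?mul0r//; ring].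
have f10 : f1 1 = 0.
  by rewrite /f1 ln1 powR1; case: ifP => // _; rewrite subrr mul0r.
apply/andP; split.
  apply: (second_order_ge x0 df df1 f0 f10) => y yx.
  by have /andP[] := ratio_pow_bound (s - 2) x0 yx.
apply: (second_order_le x0 df df1 f0 f10) => y yx.
by have /andP[] := ratio_pow_bound (s - 2) x0 yx.
Qed.

End phi_bounds.

Section K_bounds.
Context (R : realType).

(** Once both likelihood ratios of the pair of Bernoulli laws lie within a
    factor [c] of 1, [K_div] is the chi-square distance up to a power of [c]. *)
Lemma K_div_bounds (s u v c : R) : 0 < u < 1 -> 0 < v < 1 -> 1 <= c ->
  u <= c * v -> v <= c * u -> 1 - u <= c * (1 - v) -> 1 - v <= c * (1 - u) ->
  exists2 k, K_div s u v = k%:E &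
    (c `^ `|s - 2|)^-1 / 2 * ((u - v) ^+ 2 / (v * (1 - v))) <= k <=
    c `^ `|s - 2| / 2 * ((u - v) ^+ 2 / (v * (1 - v))).
Proof.
move=> /andP[u0 u1] /andP[v0 v1] c1 uv vu uv' vu'.
have c0 : 0 < c by exact: lt_le_trans c1.
have x0 : 0 < u / v by rewrite divr_gt0.
have y0 : 0 < (1 - u) / (1 - v) by rewrite divr_gt0// subr_gt0.
set m := c `^ `|s - 2|.
have m0 : 0 < m by exact: powR_gt0.
have ratio (x : R) : 0 < x -> x <= c -> x^-1 <= c ->
    m^-1 / 2 * (x - 1) ^+ 2 <= phi_real s x <= m / 2 * (x - 1) ^+ 2.
  move=> xp xc xc'; have /andP[h1 h2] := phi_real_bounds s xp.
  set w := Num.max x x^-1 in h1 h2.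
  have w0 : 0 < w by rewrite lt_max xp.
  have wc : w `^ `|s - 2| <= m.
    apply: ge0_ler_powR => //; rewrite ?nnegrE ?(ltW w0) ?(ltW c0)//.
    by rewrite ge_max xc xc'.
  have wp : 0 < w `^ `|s - 2| by exact: powR_gt0.
  apply/andP; split.
    apply: le_trans h1; rewrite ler_wpM2r ?sqr_ge0// ler_pM2r//.
    by rewrite lef_pV2 ?posrE.
  by apply: (le_trans h2); rewrite ler_wpM2r ?sqr_ge0// ler_pM2r.
have /andP[a1 a2] : m^-1 / 2 * (u / v - 1) ^+ 2 <= phi_real s (u / v) <=
    m / 2 * (u / v - 1) ^+ 2.
  by apply: ratio => //; rewrite ?invf_div ler_pdivrMr.
have /andP[b1 b2] : m^-1 / 2 * ((1 - u) / (1 - v) - 1) ^+ 2 <=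
    phi_real s ((1 - u) / (1 - v)) <= m / 2 * ((1 - u) / (1 - v) - 1) ^+ 2.
  by apply: ratio => //; rewrite ?invf_div ler_pdivrMr// subr_gt0.
exists (v * phi_real s (u / v) + (1 - v) * phi_real s ((1 - u) / (1 - v))).
  by rewrite /K_div !phi_div_real.
have E (z : R) : z / 2 * ((u - v) ^+ 2 / (v * (1 - v))) =
    v * (z / 2 * (u / v - 1) ^+ 2) +
    (1 - v) * (z / 2 * ((1 - u) / (1 - v) - 1) ^+ 2).
  have v1' : 1 - v != 0 by rewrite subr_eq0 gt_eqF.
  have v0' : v != 0 by rewrite gt_eqF.
  by field; rewrite v1' v0'.
rewrite !E; apply/andP; split; apply: lerD; rewrite ler_wpM2l//;
  by [exact: ltW|rewrite subr_ge0 ltW].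
Qed.

Lemma measurable_phi_div (s : R) : measurable_fun setT (phi_div s).
Proof.
have m0 : measurable_fun setT (fun x : R => x == 0).
  by apply: measurable_fun_eqr.
rewrite /phi_div; case: (s == 0).
  apply: measurable_fun_ifT => //; apply/measurable_EFinP.
  by apply: measurable_funB => //; exact: measurable_funB.
case: (s == 1).
  apply/measurable_EFinP; apply: measurable_funD => //; apply: measurable_funM => //.
  exact: measurable_funB.
have me : measurable_fun setT
    (fun x : R => ((1 - s + s * x - x `^ s) / (s * (1 - s)))%:E).
  apply/measurable_EFinP; apply: measurable_funM => //; apply: measurable_funB.
    by apply: measurable_funD => //; exact: measurable_funM.
  exact: measurable_powR.
case: (s < 0) => //=.
exact: measurable_fun_ifT.
Qed.

Lemma measurable_K_div (s u : R) (P : probability R R) :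
  measurable_fun setT (fun t => K_div s u (dist_fun P t)).
Proof.
have mF := measurable_dist_fun P.
have mV (f : R -> R) : measurable_fun setT f -> (forall t, 0 <= f t) ->
    measurable_fun setT (fun t => (f t)^-1).
  move=> mf f0; rewrite (_ : (fun t => _) = fun t => f t `^ (-1)).
    exact: (measurableT_comp (@measurable_powR R (-1)) mf).
  by apply/funext => t; rewrite powR_inv1.
have m1F : measurable_fun setT (fun t => 1 - dist_fun P t) by exact: measurable_funB.
have F1 t : 0 <= 1 - dist_fun P t by rewrite subr_ge0 dist_fun_le1.
apply: emeasurable_funD; apply: emeasurable_funM;
  try (by apply/measurable_EFinP);
  apply: (measurableT_comp (measurable_phi_div s));
  by apply: measurable_funM => //; apply: mV => // t; exact: dist_fun_ge0.
Qed.

End K_bounds.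

(** * The test statistic as a supremum over levels *)

Section statistic.
Context (R : realType) (P : probability R R) (s : R).

(** Rejection, phrased pointwise: the range of the supremum becomes the presence
    of observations on both sides of [t], and the supremum can be restricted to a
    set [D] of points. *)
Definition exceeds n (D : set R) (c : R) (x : n.-tuple R) :=
  exists t, [/\ D t, exists i, tnth x i <= t, exists i, t < tnth x i &
    (c%:E < K_div s (emp_dist_fun x t) (dist_fun P t))%E].

Lemma order_stat_range n (x : n.-tuple R) t :
  order_stat x 1 <= t < order_stat x n <->
  (exists i, tnth x i <= t) /\ (exists i, t < tnth x i).
Proof.
have sz : size (sort <=%O x) = n by rewrite size_sort size_tuple.
have so : sorted <=%O (sort <=%O x) by exact: sort_le_sorted.
have mem k : (k < n)%N -> exists i, tnth x i = nth 0 (sort <=%O x) k.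
  move=> kn; have : nth 0 (sort <=%O x) k \in x.
    by rewrite -(mem_sort <=%O) mem_nth// sz.
  by case/tnthP => i ->; exists i.
have ind (i : 'I_n) : exists2 k, (k < n)%N & tnth x i = nth 0 (sort <=%O x) k.
  have : tnth x i \in sort <=%O x by rewrite mem_sort mem_tnth.
  by move/(nthP 0) => [k]; rewrite sz => kn <-; exists k.
have mono j k : (j <= k)%N -> (k < n)%N ->
    nth 0 (sort <=%O x) j <= nth 0 (sort <=%O x) k.
  move=> jk kn; apply: (sorted_leq_nth le_trans lexx 0 so) => //;
    by rewrite inE sz// (leq_ltn_trans jk).
split => [/andP[h1 h2]|[[i hi] [j hj]]].
  have [n0|n0] := posnP n.
    have e (k : nat) : nth 0 (sort <=%O x) k = 0 by rewrite nth_default// sz n0.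
    by move: (le_lt_trans h1 h2); rewrite /order_stat !e ltxx.
  split.
    by have [i ei] := mem 0%N n0; exists i; rewrite ei.
  have [i ei] := mem n.-1 ltac:(by rewrite prednK).
  by exists i; rewrite ei.
have n0 : (0 < n)%N by exact: leq_trans (ltn_ord i).
have [k kn ek] := ind i; have [l ln el] := ind j.
apply/andP; split; rewrite /order_stat.
  by apply: le_trans hi; rewrite ek mono.
apply: (lt_le_trans hj); rewrite el mono ?prednK//.
by rewrite -ltnS prednK.
Qed.

Lemma S_stat_gt n (x : n.-tuple R) c : (c%:E < S_stat P s x)%E <-> exceeds setT c x.
Proof.
split => [/ereal_sup_gt[_ [t /order_stat_range[h1 h2] <-] ct]|[t [_ h1 h2 ct]]].
  by exists t.
apply: (lt_le_trans ct); apply: ereal_sup_ubound; exists t => //=.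
by apply/order_stat_range.
Qed.

Lemma hits_pos n (A : set R) (x : n.-tuple R) :
  0 < hits R A x -> exists i, A (tnth x i).
Proof.
move=> h; apply/not_existsP => no; move: h; rewrite /hits big1 ?ltxx// => i _.
by rewrite indicE memNset//; exact: no.
Qed.

Lemma emp_range n (x : n.-tuple R) t : 0 < emp_dist_fun x t < 1 ->
  (exists i, tnth x i <= t) /\ (exists i, t < tnth x i).
Proof.
have [n0|n0] := posnP n.
  have e : n%:R = 0 :> R by rewrite n0.
  by rewrite emp_dist_funE e invr0 mul0r ltxx.
have n0R : 0 < n%:R :> R by rewrite ltr0n.
rewrite emp_dist_funE => /andP[]; rewrite pmulr_rgt0 ?invr_gt0// => /hits_pos h.
rewrite ltr_pdivrMl// mulr1 => h2; split => //.
apply/not_existsP => no; move: h2; apply/negP; rewrite -leNgt.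
rewrite -(hits_setT R x); apply: ler_sum => i _.
rewrite !indicE in_setT mem_set//= leNgt; apply/negP; exact: no.
Qed.

Lemma emp_range_bounds n (x : n.-tuple R) t :
  (exists i, tnth x i <= t) -> (exists i, t < tnth x i) ->
  n%:R^-1 <= emp_dist_fun x t <= 1 - n%:R^-1.
Proof.
move=> [i hi] [j hj].
have n0 : (0 < n)%N by exact: leq_trans (ltn_ord i).
have n0R : 0 < n%:R :> R by rewrite ltr0n.
have e : 1 - n%:R^-1 = n%:R^-1 * (n%:R - 1) :> R by field; rewrite gt_eqF.
rewrite emp_dist_funE e -{1}[n%:R^-1]mulr1 !ler_pM2l ?invr_gt0//.
apply/andP; split.
  rewrite /hits (bigD1 i)//= indicE mem_set// lerDl.
  by apply: sumr_ge0.
rewrite -(hits_setT R x) /hits (bigD1 j)//= [X in X - 1](bigD1 j)//=.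
have -> : \1_[set y | y <= t] (tnth x j) = 0 :> R.
  by rewrite indicE memNset//=; apply/negP; rewrite -ltNge.
rewrite indicE in_setT addrAC subrr !add0r; apply: ler_sum => k _.
by rewrite !indicE in_setT ler_nat; case: (_ \in _).
Qed.

(** For [A] an arbitrary Borel set: either [t] is one of the observations, or it
    can be separated from all of them by two rational numbers. *)
Lemma measurable_pattern n (A : set R) (I : {set 'I_n}) :
  measurable A -> I != finset.set0 -> ~: I != finset.set0 ->
  measurable [set x : n.-tuple R | exists2 t, A t &
     forall i, (tnth x i <= t) = (i \in I)].
Proof.
move=> mA /set0Pn[i0 i0I] /set0Pn[j0 j0I].
have mt i : measurable_fun setT (fun x : n.-tuple R => tnth x i).
  exact: measurable_tnth.
pose E1 j : set (n.-tuple R) := [set x | A (tnth x j)] `&`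
  \bigcap_(i in [set: 'I_n]) [set x | (tnth x i <= tnth x j) = (i \in I)].
pose E2 (p q : rat) : set (n.-tuple R) :=
  [set x | exists2 t, A t & ratr p < t < ratr q] `&`
  \bigcap_(i in [set: 'I_n]) [set x | if i \in I then tnth x i <= ratr p
                                       else ratr q <= tnth x i].
have -> : [set x : n.-tuple R | exists2 t, A t & forall i, (tnth x i <= t) = (i \in I)] =
    (\bigcup_(j in [set: 'I_n]) ([set x | j \in I] `&` E1 j)) `|`
    \bigcup_(p in [set: rat]) \bigcup_(q in [set: rat]) E2 p q.
  apply/seteqP; split => [x [t At h]|x [[j _ [jI [Aj hj]]]|[p _ [q _ [[t At /andP[pt tq]] h]]]]].
  - have [[j xj]|no] := pselect (exists j, tnth x j = t).
      left; exists j => //; split; first by rewrite /= -h xj.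
      by split; rewrite /= ?xj// => i _ /=; rewrite xj h.
    right.
    pose hi := [arg max_(i > i0 in I) tnth x i]%O.
    pose lo := [arg min_(i < j0 in ~: I) tnth x i]%O.
    have [hiI hiM] : hi \in I /\ forall i, i \in I -> tnth x i <= tnth x hi.
      by rewrite /hi; case: arg_maxP.
    have [loI loM] : lo \in ~: I /\ forall i, i \in ~: I -> tnth x lo <= tnth x i.
      by rewrite /lo; case: arg_minP.
    have hit : tnth x hi < t.
      rewrite lt_neqAle h hiI andbT; apply/eqP => e; apply: no; by exists hi.
    have tlo : t < tnth x lo by rewrite ltNge h; rewrite inE in loI.
    have [p /itvP hp] := rat_in_itvoo hit; have [q /itvP hq] := rat_in_itvoo tlo.
    exists p => //; exists q => //; split; first by exists t => //; rewrite hp hq.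
    move=> i _ /=; case: ifPn => iI.
      by apply: (le_trans (hiM _ iI)); rewrite ltW// hp.
    by apply: le_trans (loM i _); rewrite ?inE// ltW// hq.
  - by exists (tnth x j) => // i; exact: hj.
  - exists t => // i; have := h i Logic.I => /=; case: ifPn => iI h'.
      by apply: (le_trans h'); exact: ltW.
    by apply/negbTE; rewrite -ltNge; exact: lt_le_trans h'.
apply: measurableU.
  apply: fin_bigcup_measurable => [|j _]; first exact: finite_finset.
  apply: measurableI.
    by case: (j \in I); rewrite ?set_true ?set_false.
  apply: measurableI; first by rewrite -[X in measurable X]setTI; exact: mt.
  apply: fin_bigcap_measurable => [|i _]; first exact: finite_finset.
  have := measurable_fun_ler (mt i) (mt j) => /(_ measurableT [set (i \in I)] Logic.I).
  by rewrite setTI.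
apply: bigcupT_measurable_rat => p; apply: bigcupT_measurable_rat => q.
apply: measurableI.
  by have [h|h] := pselect (exists2 t, A t & ratr p < t < ratr q);
    [rewrite (_ : [set x | _] = setT)//; apply/seteqP; split|
     rewrite (_ : [set x | _] = set0)//; apply/seteqP; split].
apply: fin_bigcap_measurable => [|i _]; first exact: finite_finset.
case: (i \in I); rewrite -[X in measurable X]setTI.
  have := mt i measurableT _ (measurable_itv `]-oo, ratr p]).
  by congr measurable; apply/seteqP; split => x /= []; rewrite in_itv.
have := mt i measurableT _ (measurable_itv `[ratr q, +oo[).
by congr measurable; apply/seteqP; split => x /= []; rewrite in_itv/= andbT.
Qed.

(** The empirical distribution function at [t] only depends on the set of indices
    of the observations up to [t], which takes finitely many values. *)
Lemma measurable_exceeds n (D : set R) c : measurable D ->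
  measurable [set x : n.-tuple R | exceeds D c x].
Proof.
move=> mD.
pose u (I : {set 'I_n}) : R := n%:R^-1 * #|I|%:R.
pose A I := D `&` [set t | (c%:E < K_div s (u I) (dist_fun P t))%E].
have mA I : measurable (A I).
  apply: measurableI => //.
  have := emeasurable_fun_o_infty measurableT (measurable_K_div s (u I) P) c%:E.
  by rewrite setTI.
have hitsI (x : n.-tuple R) t (I : {set 'I_n}) : (forall i, (tnth x i <= t) = (i \in I)) ->
    emp_dist_fun x t = u I.
  move=> h; rewrite emp_dist_funE /u; congr (_ * _).
  rewrite -sum1_card natr_sum [RHS]big_mkcond; apply: eq_bigr => i _.
  rewrite indicE -h; case: ifPn => hi; first by rewrite mem_set.
  by rewrite memNset//=; exact/negP.
have -> : [set x : n.-tuple R | exceeds D c x] =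
    \bigcup_(I in [set I : {set 'I_n} | (I != finset.set0) && (~: I != finset.set0)])
      [set x | exists2 t, A I t & forall i, (tnth x i <= t) = (i \in I)].
  apply/seteqP; split => [x [t [Dt [i hi] [j hj] ct]]|x [I /andP[In0 Cn0] [t [Dt ct] h]]].
    pose I := [set i | tnth x i <= t]%SET.
    have hI i' : (tnth x i' <= t) = (i' \in I) by rewrite inE.
    exists I.
      apply/andP; split; apply/set0Pn; first by exists i; rewrite -hI.
      by exists j; rewrite inE -hI -ltNge.
    exists t; last exact: hI.
    by split; [exact: Dt|rewrite /mkset -(hitsI x t)].
  case/set0Pn: In0 => i iI; case/set0Pn: Cn0 => j jI.
  exists t; split; first exact: Dt.
  - by exists i; rewrite h.
  - by exists j; rewrite ltNge h; rewrite inE in jI.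
  - by rewrite (hitsI x t I).
apply: fin_bigcup_measurable => [|I /andP[In0 Cn0]]; first exact: finite_finset.
exact: measurable_pattern.
Qed.

Lemma S_test_exceeds (c : nat -> R) n :
  S_test P s c (n := n) = \1_[set x | exceeds setT (c n) x].
Proof. by congr (\1_ _); apply/seteqP; split => x /= /S_stat_gt. Qed.

Lemma is_test_indic d (T : measurableType d) (A : set T) : measurable A ->
  is_test (\1_A : T -> R).
Proof.
move=> mA; split => // x.
by rewrite indicE; case: (_ \in _); rewrite ?lexx ?ler01.
Qed.

Lemma S_test_test_sequence c : test_sequence (S_test P s c).
Proof.
move=> n; rewrite S_test_exceeds; apply: is_test_indic.
exact: measurable_exceeds.
Qed.

End statistic.

(** * Exponential families near the null parameter *)

Section limits.
Context (R : realType).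

Lemma cvg_nat_powR (r : R) : 0 < r -> n%:R `^ (- r) @[n --> \oo] --> (0 : R).
Proof.
move=> r0; apply/cvgrPdist_lt => e e0.
have [N hN] : exists N : nat, e `^ (- r^-1) < N%:R.
  by exists (Num.truncn (e `^ (- r^-1))).+1; rewrite Num.Theory.truncnS_gt.
near=> n; rewrite sub0r normrN ger0_norm ?powR_ge0//.
have nN : e `^ (- r^-1) < n%:R.
  by apply: (lt_le_trans hN); rewrite ler_nat; near: n; exact: nbhs_infty_ge.
have n0 : 0 < n%:R :> R by apply: le_lt_trans nN; exact: powR_ge0.
have e0' : 0 < e `^ (- r^-1) by exact: powR_gt0.
rewrite powRN -[ltRHS]invrK ltf_pV2 ?posrE ?powR_gt0 ?invr_gt0//.
have -> : e^-1 = (e `^ (- r^-1)) `^ r.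
  by rewrite -powRrM mulNr mulVf ?gt_eqF// powRN powRr1// ltW.
by apply: gt0_ltr_powR; rewrite ?nnegrE// ltW.
Unshelve. all: by end_near. Qed.

Lemma has_mean_cvg d (T : measurableType d) (P : probability T R)
    (f_ : nat -> T -> R) (f D : T -> R) (b : R) :
  (forall n, measurable_fun setT (f_ n)) ->
  (forall x, f_ n x @[n --> \oo] --> f x) ->
  (forall n x, `|f_ n x| <= D x) -> has_mean P D b ->
  exists2 m, has_mean P f m & exists2 m_ : nat -> R,
    (forall n, has_mean P (f_ n) (m_ n)) & m_ n @[n --> \oo] --> m.
Proof.
move=> mf cf fD hD.
have mlim : measurable_fun setT f.
  by apply: (measurable_fun_cvg mf) => x _; exact: cf.
have absf x : `|f x| <= D x.
  apply: (cvgr_to_le (cvg_norm (cf x))).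
  by apply: nearW => n; exact: fD.
have [m hm] := has_mean_dominated mlim absf hD.
have /choice[m_ hm_] n := has_mean_dominated (mf n) (fD n) hD.
exists m => //; exists m_ => //.
have [|||||_ _] := @dominated_convergence _ _ _ P setT measurableT
  (fun n x => (f_ n x)%:E) (fun x => (f x)%:E) (fun x => (D x)%:E).
- by move=> n; exact/measurable_EFinP.
- exact/measurable_EFinP.
- by apply: aeW => x _; apply: cvg_EFin; [exact: nearW|exact: cf].
- by case: hD.
- by apply: aeW => x n _ /=; rewrite lee_fin.
rewrite (_ : [sequence _]_n = fun n => (m_ n)%:E); last first.
  by apply/funext => n /=; case: (hm_ n).
by case: hm => _ ->; move/fine_cvg.
Qed.

Lemma expR_sub1_ge (y : R) : y <= expR y - 1.
Proof. by rewrite lerBrDl expR_ge1Dx. Qed.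

Lemma expR_sub1_le (y : R) : expR y - 1 <= y * expR y.
Proof.
have h : expR y * (1 - y) <= 1.
  rewrite -[leRHS](expRxMexpNx_1 y) ler_wpM2l ?expR_ge0//.
  exact: (expR_ge1Dx (- y)).
by rewrite lerBlDr -lerBlDl (le_trans _ h)// mulrBr mulr1 mulrC.
Qed.

Lemma expR_quotient_bound (u t : R) : 0 < u <= 1 ->
  `|(expR (u * t) - 1) / u| <= `|t| * (1 + expR t).
Proof.
move=> /andP[u0 u1]; rewrite normrM normfV (gtr0_norm u0) ler_pdivrMr//.
have e0 : 0 <= expR t by exact: expR_ge0.
have h1 := expR_sub1_ge (u * t); have h2 := expR_sub1_le (u * t).
have [t0|t0] := leP 0 t.
  rewrite (ger0_norm t0) ger0_norm; last first.
    by apply: le_trans h1; rewrite mulr_ge0// ltW.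
  apply: (le_trans h2); rewrite [leRHS]mulrC mulrA ler_wpM2l ?mulr_ge0 ?(ltW u0)//.
  have : expR (u * t) <= expR t by rewrite ler_expR ler_piMl.
  lra.
have ut : u * t <= 0 by rewrite pmulr_rle0// ltW.
rewrite (ltr0_norm t0) ler0_norm; last first.
  by rewrite subr_le0 -expR0 ler_expR.
have : 0 <= - t * expR t * u by rewrite !mulr_ge0 ?(ltW u0)// oppr_ge0 ltW.
lra.
Qed.

(** Third exponential moments dominate squared difference quotients. *)
Lemma expR_quotient_sqr (t : R) :
  (`|t| * (1 + expR t)) ^+ 2 <= 4 * t ^+ 2 + 4 * expR (3 * t).
Proof.
rewrite exprMn real_normK ?num_real//.
have t2 : 0 <= t ^+ 2 by exact: sqr_ge0.
have e0 : 0 < expR t by exact: expR_gt0.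
have -> : expR (3 * t) = expR t ^+ 3 by rewrite expRM_natl.
have [t0|t0] := leP 0 t.
  have h : t ^+ 2 <= 2 * expR t.
    have : 1 + t ^+ 2 / 2 <= expR t := expR_ge1Dxn 1 t0.
    lra.
  have h' : t ^+ 2 * expR t ^+ 2 <= 2 * expR t ^+ 3.
    by rewrite [expR t ^+ 3]exprS mulrA ler_wpM2r// sqr_ge0.
  have -> : t ^+ 2 * (1 + expR t) ^+ 2 =
      2 * t ^+ 2 + 2 * (t ^+ 2 * expR t ^+ 2) - t ^+ 2 * (1 - expR t) ^+ 2 by ring.
  have : 0 <= t ^+ 2 * (1 - expR t) ^+ 2 by rewrite mulr_ge0// sqr_ge0.
  lra.
have e1 : expR t <= 1 by rewrite -expR0 ler_expR ltW.
have : t ^+ 2 * (1 + expR t) ^+ 2 <= t ^+ 2 * 4.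
  by rewrite ler_wpM2l//; nra.
have : 0 < expR t ^+ 3 by exact: exprn_gt0.
lra.
Qed.

Lemma cvg_expR_quotient (u : nat -> R) (t : R) :
  (\forall n \near \oo, 0 < u n) -> u n @[n --> \oo] --> (0 : R) ->
  (expR (u n * t) - 1) / u n @[n --> \oo] --> t.
Proof.
move=> up u0.
have e1 : `|t| * `|expR (u n * t) - 1| @[n --> \oo] --> (0 : R).
  have ut : u n * t @[n --> \oo] --> (0 : R).
    by rewrite -(mul0r t); apply: cvgM => //; exact: cvg_cst.
  have : expR (u n * t) @[n --> \oo] --> expR 0.
    by apply: (continuous_cvg _ _ ut); exact: continuous_expR.
  rewrite expR0 => ce.
  have : expR (u n * t) - 1 @[n --> \oo] --> (1 - 1 : R).
    by apply: cvgB => //; exact: cvg_cst.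
  rewrite subrr => /cvg_norm; rewrite normr0 => cn.
  by rewrite -(mulr0 `|t|); apply: cvgM => //; exact: cvg_cst.
apply/cvgrPdist_le => e e0.
near=> n.
have un : 0 < u n by near: n.
have h1 := expR_sub1_ge (u n * t); have h2 := expR_sub1_le (u n * t).
have : `|t| * `|expR (u n * t) - 1| <= e.
  by near: n; apply: cvgr_le; first exact: e1.
apply: le_trans.
have qt : 0 <= (expR (u n * t) - 1) / u n - t.
  by rewrite subr_ge0 ler_pdivlMr// mulrC.
rewrite distrC (ger0_norm qt) -normrM; apply: le_trans (ler_norm _).
rewrite mulrBr mulr1 lerD2r ler_pdivrMr//.
by rewrite mulrAC (mulrC t).
Unshelve. all: by end_near. Qed.

End limits.

(** All that the rest of the proof uses of the exponential family: alternatives at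
    distance [a n] from [P], in the asymptotic direction [h]. Domination by [D]
    turns pointwise convergence of the scores into convergence of all first and
    second moments. *)
Record local_alternatives (R : realType) (P : probability R R)
    (Q : nat -> probability R R) (a : nat -> R) (G : nat -> R -> R)
    (h D : R -> R) (d sg2 : R) : Prop := LocalAlternatives {
  local_rate_ge0 : forall n, 0 <= a n;
  local_measurable : forall n, measurable_fun setT (G n);
  local_density_ge0 : forall n x, 0 <= 1 + a n * G n x;
  local_density : forall n f, measurable_fun setT f ->
    (forall x, (0 <= f x)%E) ->
    (\int[Q n]_x f x = \int[P]_x ((1 + a n * G n x)%:E * f x))%E;
  local_centered : forall n, has_mean P (G n) 0;
  local_cvg : forall x, G n x @[n --> \oo] --> h x;
  local_dominated : forall n x, G n x ^+ 2 <= D x;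
  local_dominating : has_mean P D d;
  local_variance : has_mean P (fun x => h x ^+ 2) sg2 }.

Section exponential_family.
Context (R : realType) (P : R -> probability R R) (C T : R -> R).
Hypothesis family : is_exponential_family P C T.
Hypothesis T_L2 : T \in Lfun (P 0) 2%:E.

Let mT : measurable_fun setT T.
Proof. by move: T_L2; rewrite inE => /andP[]; rewrite inE. Qed.

Let C_gt0 u : 0 <= u -> 0 < C u.
Proof. by case: family => _ _ _ h _; exact: h. Qed.

Let mexp u : measurable_fun setT (fun x => expR (u * T x)).
Proof. by apply: measurableT_comp => //; exact: measurable_funM. Qed.

Let mean_T : exists m, has_mean (P 0) T m.
Proof.
have := Lfun_subset12 (fin_num_measure (P 0) _ measurableT) T_L2.
move/Lfun1_integrable => iT; exists (fine (\int[P 0]_x (T x)%:E)); split => //.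
by rewrite fineK//; exact: integrable_fin_num.
Qed.

Let mean_T2 : exists m, has_mean (P 0) (fun x => T x ^+ 2) m.
Proof.
have /Lfun1_integrable iT := Lfun2_mul_Lfun1 T_L2 T_L2.
exists (fine (\int[P 0]_x (T x ^+ 2)%:E)); split.
  by apply: eq_integrable iT.
by rewrite fineK//; apply: integrable_fin_num => //; apply: eq_integrable iT.
Qed.

Lemma exponential_density u (f : R -> \bar R) : 0 <= u ->
  measurable_fun setT f -> (forall x, (0 <= f x)%E) ->
  (\int[P u]_x f x = \int[P 0]_x ((C u * expR (u * T x))%:E * f x))%E.
Proof.
move=> u0 mf f0; case: family => _ _ _ _ /(_ u u0)[dom ae].
have md : measurable_fun setT (fun x => C u * expR (u * T x)).
  exact: measurable_funM.
apply: ge0_integral_density => //.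
  by move=> x; rewrite mulr_ge0 ?expR_ge0// ltW// C_gt0.
move=> A mA.
have := Radon_Nikodym_integral (nu := charge_of_finite_measure (P u)) dom mA.
rewrite /= => ->; apply: ae_eq_integral => //.
- by apply: measurable_funTS; apply: measurable_int; exact: Radon_Nikodym_integrable.
- by apply: measurable_funTS; exact/measurable_EFinP.
- by apply: ae_eq_subset ae.
Qed.

Lemma exponential_moment u : 0 <= u ->
  has_mean (P 0) (fun x => expR (u * T x)) (C u)^-1.
Proof.
move=> u0.
have h : mean_le (P 0) (fun x => C u * expR (u * T x)) 1.
  split; first exact: measurable_funM.
    by move=> x; rewrite mulr_ge0 ?expR_ge0// ltW// C_gt0.
  under eq_integral do rewrite -[X in X%:E]mulr1 EFinM.
  by rewrite -(@exponential_density u (cst 1%E))// integral_cst//= probability_setT mule1.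
have [m hm _] := mean_le_has_mean h.
have m1 : m = 1.
  apply: EFin_inj; case: hm => _ <-.
  under eq_integral do rewrite -[X in X%:E]mulr1 EFinM.
  by rewrite -(@exponential_density u (cst 1%E))// integral_cst//= probability_setT mule1.
have Cu := C_gt0 u0.
apply: (has_mean_eq (has_meanZ (C u)^-1 hm)) => [x|]; last by rewrite m1 mulr1.
by rewrite mulrA mulVf ?gt_eqF// mul1r.
Qed.

(** The difference quotient at 0 of the densities; its limit is the derivative of
    the log-likelihood. *)
Definition score u x := (C u * expR (u * T x) - 1) / u.

Lemma score_centered u : 0 <= u -> has_mean (P 0) (score u) 0.
Proof.
move=> u0; have hu := has_meanZ (C u) (exponential_moment u0).
have h1 := has_meanB hu (has_mean_cst (P 0) 1).
apply: (has_mean_eq (has_meanZ u^-1 h1)) => [x|]; first by rewrite /score mulrC.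
by rewrite mulfV ?gt_eqF ?C_gt0// subrr mulr0.
Qed.

(** By Jensen, the normalising constant stays bounded as the parameter tends
    to 0; so the scores are dominated by a multiple of [|T| (1 + expR T)],
    whose square is controlled by [T^2] and the third exponential moment. *)
Lemma score_limit (u : nat -> R) (m : R) : (forall n, 0 <= u n <= 1) ->
  (\forall n \near \oo, 0 < u n) -> u n @[n --> \oo] --> (0 : R) ->
  has_mean (P 0) T m ->
  (forall x, score (u n) x @[n --> \oo] --> T x - m) /\
  exists D d, (forall n x, score (u n) x ^+ 2 <= D x) /\ has_mean (P 0) D d.
Proof.
move=> u01 up u0 hm.
pose w x := `|T x| * (1 + expR (T x)).
have mw : measurable_fun setT w.
  apply: measurable_funM; first exact: measurableT_comp.
  apply: measurable_funD => //; exact: measurableT_comp.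
have w0 x : 0 <= w x by rewrite mulr_ge0// addr_ge0// expR_ge0.
have [t2 ht2] := mean_T2.
have h3 := exponential_moment (ler0n R 3).
have hW := has_meanD (has_meanZ 4 ht2) (has_meanZ 4 h3).
set W := (fun x => _) in hW; set mW := (_ + _) in hW.
have wW x : w x ^+ 2 <= W x by exact: expR_quotient_sqr.
have w1W x : w x <= 1 + W x.
  have := wW x; have := sqr_ge0 (w x - 1); have := w0 x; rewrite sqrrB; lra.
have [mw' hw] : exists b, has_mean (P 0) w b.
  apply: (has_mean_dominated mw _ (has_meanD (has_mean_cst (P 0) 1) hW)) => x.
  by rewrite ger0_norm.
pose q n x := (expR (u n * T x) - 1) / u n.
have mq n : measurable_fun setT (q n).
  by apply: measurable_funM => //; exact: measurable_funB.
have qw n x : `|q n x| <= w x.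
  have /andP[un0 un1] := u01 n; rewrite /q; have [->|un] := eqVneq (u n) 0.
    by rewrite invr0 mulr0 normr0.
  by apply: expR_quotient_bound; rewrite un1 andbT lt_neqAle eq_sym un.
have cq x : q n x @[n --> \oo] --> T x by exact: cvg_expR_quotient.
have [m' hm' [c hc cm]] := has_mean_cvg mq cq qw hw.
have em : m' = m := has_mean_uniq hm' hm.
rewrite {}em in cm.
have cw n : `|c n| <= mw'.
  rewrite ler_norml (has_mean_le (hc n) hw (fun x => le_trans (ler_norm _) (qw n x))).
  rewrite andbT lerNl -mulN1r.
  apply: (has_mean_le (has_meanZ (-1) (hc n)) hw) => x.
  by rewrite mulN1r (le_trans _ (qw n x))// -normrN ler_norm.
have un n : 0 <= u n by case/andP: (u01 n).
have cC n : (C (u n))^-1 = 1 + u n * c n.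
  apply: (has_mean_uniq (exponential_moment (un n))).
  apply: (has_mean_eq (has_meanD (has_mean_cst (P 0) 1) (has_meanZ (u n) (hc n)))) => // x.
  rewrite /q; have [->|u0'] := eqVneq (u n) 0; first by rewrite !mul0r expR0 addr0.
  by rewrite mulrC divfK// subrKC.
have Cn n := C_gt0 (un n).
have sE n x : score (u n) x = C (u n) * (q n x - c n).
  have [e0|u0'] := eqVneq (u n) 0.
    rewrite /score /q e0 invr0 !mulr0 sub0r.
    have := hc n; rewrite /q e0 invr0 => hc0.
    have -> : c n = 0.
      by apply: (has_mean_uniq hc0); apply: (has_mean_eq (has_mean_cst (P 0) 0)) => // y; rewrite mulr0.
    by rewrite oppr0 mulr0.
  have -> : c n = ((C (u n))^-1 - 1) / u n by rewrite cC addrC addKr mulrC mulKf.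
  rewrite /score /q; field; by rewrite u0' gt_eqF.
split.
  have C1 : C (u n) @[n --> \oo] --> (1 : R).
    have : (C (u n))^-1 @[n --> \oo] --> (1 : R).
      under eq_fun do rewrite cC.
      have : 1 + u n * c n @[n --> \oo] --> 1 + 0 * m.
        by apply: cvgD; [exact: cvg_cst|exact: cvgM].
      by rewrite mul0r addr0.
    have -> : (fun n => C (u n)) = (fun n => ((C (u n))^-1)^-1).
      by apply/funext => n; rewrite invrK.
    move=> hV; have : ((C (u n))^-1)^-1 @[n --> \oo] --> (1 : R)^-1.
      by apply: cvgV hV; exact: oner_neq0.
    by rewrite invr1.
  move=> x; under eq_fun do rewrite sE.
  have : C (u n) * (q n x - c n) @[n --> \oo] --> 1 * (T x - m).
    by apply: cvgM => //; apply: cvgB => //; exact: cq.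
  by rewrite mul1r.
pose K := expR `|m|.
have CK n : C (u n) <= K.
  have /andP[un0 un1] := u01 n.
  rewrite -(lef_pV2) ?posrE ?expR_gt0// -expRN.
  apply: (@le_trans _ _ (expR (u n * m))).
    rewrite ler_expR lerNl -mulrN (le_trans (ler_norm _))// normrM normrN.
    by rewrite ger0_norm// ler_piMl.
  have hl := has_meanD (has_mean_cst (P 0) (expR (u n * m)))
    (has_meanZ (expR (u n * m) * u n) (has_meanB hm (has_mean_cst (P 0) m))).
  rewrite subrr mulr0 addr0 in hl.
  apply: (has_mean_le hl (exponential_moment un0)) => x.
  have -> : u n * T x = u n * m + u n * (T x - m) by ring.
  rewrite expRD -mulrA -{1}[expR (u n * m)]mulr1 -mulrDr ler_wpM2l ?expR_ge0//.
  exact: expR_ge1Dx.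
exists (fun x => K ^+ 2 * 2 * (W x + mw' ^+ 2)), (K ^+ 2 * 2 * (mW + mw' ^+ 2)).
split; last exact: has_meanZ (has_meanD hW (has_mean_cst (P 0) _)).
move=> n x; rewrite sE exprMn -mulrA; apply: ler_pM; rewrite ?sqr_ge0//.
  by rewrite ler_sqr ?nnegrE ?expR_ge0 ?(ltW (Cn n)).
have h1 : `|q n x - c n| <= w x + mw' by rewrite (le_trans (ler_normB _ _))// lerD.
rewrite -real_normK ?num_real//.
apply: (@le_trans _ _ ((w x + mw') ^+ 2)).
  by rewrite ler_sqr ?nnegrE ?(le_trans _ h1).
have := wW x; have := sqr_ge0 (w x - mw'); rewrite sqrrB sqrrD; lra.
Qed.

Lemma exponential_variance (m : R) : has_mean (P 0) T m ->
  has_mean (P 0) (fun x => (T x - m) ^+ 2) (fine 'V_(P 0)[T]).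
Proof.
move=> hm; have [t2 ht2] := mean_T2.
have h := has_meanD ht2 (has_meanD (has_meanZ (- (2 * m)) hm) (has_mean_cst (P 0) (m ^+ 2))).
have e : fine 'E_(P 0)[T] = m by rewrite unlock; case: hm => _ ->.
set b := (_ + _) in h.
have {}h : has_mean (P 0) (fun x => (T x - m) ^+ 2) b.
  by apply: (has_mean_eq h) => // x; ring.
apply: (has_mean_eq h) => //.
rewrite /variance unlock e unlock.
by case: h => _; under eq_integral do rewrite expr2; move=> ->.
Qed.

Lemma exponential_alternatives (beta r : R) : 0 < beta -> 0 < r ->
  exists m D d, local_alternatives (P 0) (signal_alternative P beta r)
    (fun n => n%:R `^ (- beta) * n%:R `^ (- r)) (fun n => score (n%:R `^ (- r)))
    (fun x => T x - m) D d (fine 'V_(P 0)[T]).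
Proof.
move=> b0 r0; have [m hm] := mean_T.
have pow01 (z : R) n : 0 < z -> 0 <= (n%:R : R) `^ (- z) <= 1.
  move=> z0; rewrite powR_ge0/=; case: n => [|n].
    by rewrite powR0 ?ler01// oppr_eq0 gt_eqF.
  have n1 : 1 <= n.+1%:R :> R by rewrite ler1n.
  rewrite powRN invf_le1 ?powR_gt0//.
  apply: (@le_trans _ _ (1 `^ z)); first by rewrite powR1.
  by apply: ge0_ler_powR => //; [exact: ltW|rewrite nnegrE|rewrite nnegrE].
have npos (z : R) : \forall n \near \oo, 0 < (n%:R : R) `^ z.
  by near=> n; rewrite powR_gt0// ltr0n; near: n; exact: nbhs_infty_gt.
have [cs [D [d [sD hD]]]] := score_limit (fun n => pow01 r n r0) (npos (- r))
  (cvg_nat_powR r0) hm.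
exists m, D, d.
have th0 n : 0 <= (n%:R : R) `^ (- r) by case/andP: (pow01 r n r0).
have ms n : measurable_fun setT (score (n%:R `^ (- r))).
  exact: has_mean_measurable (score_centered (th0 n)).
have sE n x : n%:R `^ (- beta) * n%:R `^ (- r) * score (n%:R `^ (- r)) x =
    n%:R `^ (- beta) * (C (n%:R `^ (- r)) * expR (n%:R `^ (- r) * T x) - 1).
  rewrite -mulrA; congr (_ * _); rewrite /score.
  have [->|u0] := eqVneq (n%:R `^ (- r)) (0 : R).
    by case: family => _ _ -> _ _; rewrite !mul0r expR0 mulr1 subrr.
  by rewrite mulrC divfK.
have l0 n x : 0 <= 1 + n%:R `^ (- beta) * n%:R `^ (- r) * score (n%:R `^ (- r)) x.
  have /andP[e0 e1] := pow01 beta n b0.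
  rewrite sE mulrBr mulr1 addrCA addrC addr_ge0 ?subr_ge0// !mulr_ge0 ?expR_ge0//.
  by rewrite ltW// C_gt0.
split => //.
- move=> n f mf f0.
  have /andP[e0 e1] := pow01 beta n b0.
  apply: ge0_integral_density => //.
    apply: measurable_funD => //; exact: measurable_funM.
  move=> A mA; rewrite /= /mixture e0 e1/=.
  pose g x := C (n%:R `^ (- r)) * expR (n%:R `^ (- r) * T x).
  have g0 x : 0 <= g x by rewrite mulr_ge0 ?expR_ge0// ltW// C_gt0.
  have mg : measurable_fun setT g by exact: measurable_funM.
  have -> : P (n%:R `^ (- r)) A = (\int[P 0]_(x in A) (g x)%:E)%E.
    have := @exponential_density (n%:R `^ (- r)) (fun x => (\1_A x)%:E) (th0 n).
    rewrite integral_indic// setIT => -> //; last first.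
      by apply/measurable_EFinP; exact: measurable_indic.
    rewrite [RHS]integral_mkcond; apply: eq_integral => x _.
    by rewrite /g patchE indicE; case: (_ \in _); rewrite ?mule1 ?mule0.
  transitivity (\int[P 0]_(x in A) ((1 - n%:R `^ (- beta))%:E + (n%:R `^ (- beta))%:E * (g x)%:E))%E.
    have h1 x : A x -> (0 <= (1 - n%:R `^ (- beta))%:E)%E by rewrite lee_fin subr_ge0.
    have h2 x : A x -> (0 <= (n%:R `^ (- beta))%:E * (g x)%:E)%E.
      by rewrite -EFinM lee_fin mulr_ge0.
    have h3 : measurable_fun A (fun x => (n%:R `^ (- beta))%:E * (g x)%:E)%E.
      by apply: measurable_funTS; apply/measurable_EFinP; exact: measurable_funM.
    have h4 : measurable_fun A (fun x => (g x)%:E).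
      by apply: measurable_funTS; exact/measurable_EFinP.
    rewrite ge0_integralD// integral_cst// ge0_integralZl//.
    by move=> x _; rewrite lee_fin.
  apply: eq_integral => x _; rewrite sE -EFinM -EFinD /g; congr EFin; ring.
- by move=> n; exact: score_centered.
- exact: exponential_variance.
Unshelve. all: by end_near. Qed.

End exponential_family.

(** * Likelihood ratios and tests *)

Definition is_density d (X : measurableType d) (R : realType)
    (P Q : probability X R) (l : X -> R) :=
  [/\ measurable_fun setT l, forall x, 0 <= l x &
    forall f : X -> \bar R, measurable_fun setT f -> (forall x, (0 <= f x)%E) ->
      (\int[Q]_x f x = \int[P]_x ((l x)%:E * f x))%E].

Section density.
Context d (X : measurableType d) (R : realType).
Implicit Types (P Q : probability X R) (l f : X -> R).

Lemma density_mean P Q l : is_density P Q l -> has_mean P l 1.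
Proof.
move=> [ml l0 /(_ (cst 1%E)) h].
have e : (\int[P]_x (l x)%:E = 1)%E.
  under eq_integral do rewrite -[_%:E]mule1.
  by rewrite -h// integral_cst//= probability_setT mule1.
split => //; apply/integrableP; split; first exact/measurable_EFinP.
by under eq_integral do rewrite /= ger0_norm//; rewrite e ltry.
Qed.

Lemma density_prod P Q l n : is_density P Q l ->
  is_density (power_prob P n) (power_prob Q n)
    (fun x : n.-tuple X => \prod_(i < n) l (tnth x i)).
Proof.
move=> [ml l0 hl]; split; first exact: measurable_tuple_prod.
  by move=> x; apply: prodr_ge0.
move=> f mf f0.
have map_id (x : n.-tuple X) : map_tuple id x = x.
  by apply: val_inj; rewrite /= map_id.
have := @power_prob_change _ _ _ P Q id l n f (@measurable_id _ _ _) ml l0 hl mf f0.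
by under eq_integral do rewrite map_id;
  under [in RHS]eq_integral do rewrite map_id.
Qed.

Lemma has_mean_prod_sqr P l n (b : R) : has_mean P (fun x => l x ^+ 2) b ->
  has_mean (power_prob P n)
    (fun x => (\prod_(i < n) l (tnth x i)) ^+ 2) (b ^+ n).
Proof.
move=> h; have := has_mean_prod n (fun x => sqr_ge0 (l x)) h.
by under eq_fun do rewrite prodrXl.
Qed.

Lemma is_test_mean P f : is_test f -> exists m, has_mean P f m.
Proof.
move=> [mf f01]; apply: (has_mean_bounded P mf (b := 1)) => x.
by have /andP[h0 h1] := f01 x; rewrite ger0_norm.
Qed.

(** A test sees two laws as different only through the fluctuations of their
    likelihood ratio, here measured by its second moment. *)
Lemma transport_gap P Q (L f : X -> R) (chi eta : R) :
  (forall x, 0 <= L x) -> has_mean P L 1 ->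
  has_mean P (fun x => L x ^+ 2) (1 + chi) -> is_test f -> 0 < eta ->
  (\int[Q]_x (f x)%:E = \int[P]_x (L x * f x)%:E)%E ->
  eclose (eta + chi / eta) (\int[Q]_x (f x)%:E)%E (\int[P]_x (f x)%:E)%E.
Proof.
move=> L0 L1 L2 tf eta0 ->; have [mf f01] := tf.
have [m [im em]] := is_test_mean P tf; rewrite em.
have mL := has_mean_measurable L1.
have [m' [im' em']] : exists m', has_mean P (fun x => L x * f x) m'.
  apply: (has_mean_dominated _ _ L1) => [|x]; first exact: measurable_funM.
  by have /andP[h0 h1] := f01 x; rewrite ger0_norm ?mulr_ge0// ler_piMr.
rewrite em'.
have hs : has_mean P (fun x => eta + (L x - 1) ^+ 2 / eta) (eta + chi / eta).
  apply: (has_mean_eq (has_meanD (has_mean_cst P eta) (has_meanZ eta^-1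
    (has_meanD L2 (has_meanD (has_meanZ (- 2) L1) (has_mean_cst P 1)))))).
  - by move=> x /=; rewrite [_ / eta]mulrC; congr (_ + _ * _); ring.
  - by rewrite [_ / eta]mulrC; congr (_ + _ * _); ring.
have absL x : `|L x * f x - f x| <= eta + (L x - 1) ^+ 2 / eta.
  have /andP[h0 h1] := f01 x.
  rewrite -{2}[f x]mul1r -mulrBl normrM (ger0_norm h0).
  apply: (@le_trans _ _ `|L x - 1|); first by rewrite ler_piMr.
  rewrite -(ler_pM2l eta0) mulrDr [eta * (_ / _)]mulrC divfK ?gt_eqF//.
  rewrite -[X in _ <= _ + X]real_normK ?num_real//.
  have := sqr_ge0 (eta - `|L x - 1|); rewrite sqrrB -expr2.
  have : 0 <= eta * `|L x - 1| by rewrite mulr_ge0// ltW.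
  lra.
split; rewrite -EFinD lee_fin.
  apply: (has_mean_le (conj im' em') (has_meanD (conj im em) hs)) => x.
  by rewrite -lerBlDl (le_trans _ (absL x))// ler_norm.
apply: (has_mean_le (conj im em) (has_meanD (conj im' em') hs)) => x.
by rewrite -lerBlDl (le_trans _ (absL x))// distrC ler_norm.
Qed.

(** Contiguity: where the likelihood ratio exceeds [K], its second moment
    controls the mass that it carries. *)
Lemma rare_contiguous P Q L (b K c : R) (E : set X) : is_density P Q L ->
  has_mean P (fun x => L x ^+ 2) b -> 0 < K -> rare P E c ->
  rare Q E (K * c + b / K).
Proof.
move=> [mL L0 hL] L2 K0 [f [mf f0 fc] Ef].
have mg : measurable_fun setT (fun x => Num.min (f x) 1).
  exact: measurable_minr.
have g0 x : 0 <= Num.min (f x) 1 by rewrite le_min f0 ler01.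
exists (fun x => Num.min (f x) 1); last first.
  by move=> x /Ef /= fx; rewrite le_min fx lexx.
split => //.
rewrite hL//; last exact/measurable_EFinP.
have h : mean_le P (fun x => K * f x + K^-1 * L x ^+ 2) (K * c + K^-1 * b).
  apply: mean_leD; apply: mean_leZ; rewrite ?(ltW K0) ?invr_ge0 ?(ltW K0)//.
  by apply: has_mean_mean_le L2 => x; exact: sqr_ge0.
case: h => mh h0; rewrite [b / K]mulrC; apply: le_trans.
apply: ge0_le_integral => //.
- by move=> x _; rewrite -EFinM lee_fin mulr_ge0.
- by apply/measurable_EFinP; exact: measurable_funM.
- exact/measurable_EFinP.
move=> x _; rewrite -EFinM lee_fin.
have [LK|LK] := leP (L x) K.
  apply: (@le_trans _ _ (K * f x)).
    by rewrite ler_pM// ge_min lexx.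
  by rewrite lerDl mulr_ge0 ?sqr_ge0// invr_ge0 ltW.
apply: (@le_trans _ _ (K^-1 * L x ^+ 2)).
  rewrite [leRHS]mulrC ler_pdivlMr//.
  apply: (@le_trans _ _ (L x * K)).
    by rewrite ler_wpM2r ?(ltW K0)// ler_piMr// ge_min lexx orbT.
  by rewrite expr2 ler_wpM2l// ltW.
by rewrite lerDr mulr_ge0// ltW.
Qed.

Lemma rare_measure P (E : set X) c : measurable E -> rare P E c -> (P E <= c%:E)%E.
Proof.
move=> mE [f [mf f0 fc] Ef]; apply: le_trans fc.
have <- : (\int[P]_x (\1_E x)%:E = P E)%E by rewrite integral_indic// setIT.
apply: ge0_le_integral => //.
- by apply/measurable_EFinP; exact: measurable_indic.
- exact/measurable_EFinP.
move=> x _; rewrite lee_fin indicE; have [|_] := boolP (x \in E); last exact: f0.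
by rewrite inE => /Ef.
Qed.

End density.

Section error_sum.
Context (R : realType) (P Q : probability R R) (n : nat).
Implicit Types f : n.-tuple R -> R.
Local Notation Pn := (power_prob P n).
Local Notation Qn := (power_prob Q n).

Lemma error_sumE f : error_sum P Q f =
  (\int[Pn]_x (f x)%:E + \int[Qn]_x (1 - f x)%:E)%E.
Proof. by rewrite /error_sum unlock. Qed.

Lemma error_sum_gap f c : is_test f ->
  eclose c (\int[Qn]_x (f x)%:E)%E (\int[Pn]_x (f x)%:E)%E ->
  eclose c (error_sum P Q f) 1%E.
Proof.
move=> tf; rewrite error_sumE.
have [p [ip ->]] := is_test_mean Pn tf; have [q hq] := is_test_mean Qn tf.
have [_ ->] := has_meanB (has_mean_cst Qn 1) hq; case: hq => _ ->.
rewrite /eclose -!EFinD !lee_fin => -[h1 h2]; split; lra.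
Qed.

Lemma error_sum_indic (A : set (n.-tuple R)) (a b : R) : measurable A ->
  rare Pn A a -> rare Qn (~` A) b -> (error_sum P Q (\1_A : _ -> R) <= (a + b)%:E)%E.
Proof.
move=> mA ra rb; rewrite error_sumE EFinD; apply: leeD.
  by rewrite integral_indic// setIT; exact: rare_measure.
rewrite (_ : (fun x => _) = fun x => (\1_(~` A) x)%:E); last first.
  by apply/funext => x; rewrite !indicE in_setC; case: (_ \in _); rewrite /= ?subrr ?subr0.
have mC : measurable (~` A) by exact: measurableC.
rewrite integral_indic// setIT.
exact: rare_measure.
Qed.

(** The Neyman-Pearson test rejects where the likelihood ratio exceeds 1. *)
Lemma neyman_pearson (l : R -> R) : is_density P Q l ->
  ereal_inf [set error_sum P Q f | f in [set f : n.-tuple R -> R | is_test f]] =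
  (\int[Pn]_x (Num.min 1 (\prod_(i < n) l (tnth x i)))%:E)%E.
Proof.
move=> hd; have := density_prod n hd; set L := (fun x => _) => -[mL L0 hL].
have E f : is_test f -> error_sum P Q f =
    (\int[Pn]_x (f x + L x * (1 - f x))%:E)%E.
  move=> [mf f01]; rewrite error_sumE.
  have f0 x : 0 <= f x by case/andP: (f01 x).
  have f1 x : 0 <= 1 - f x by rewrite subr_ge0; case/andP: (f01 x).
  have m1f : measurable_fun setT (fun x => 1 - f x) by exact: measurable_funB.
  rewrite hL//; last exact/measurable_EFinP.
  have mfE : measurable_fun setT (fun x => (f x)%:E) by exact/measurable_EFinP.
  have mLf : measurable_fun setT (fun x => (L x)%:E * (1 - f x)%:E)%E.
    by apply: emeasurable_funM; exact/measurable_EFinP.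
  have Lf0 x : (0 <= (L x)%:E * (1 - f x)%:E)%E by rewrite mule_ge0// lee_fin.
  by rewrite -ge0_integralD// => [x _]; rewrite lee_fin.
have mmin : measurable_fun setT (fun x => Num.min 1 (L x)) by exact: measurable_minr.
apply/eqP; rewrite eq_le; apply/andP; split.
  pose f : n.-tuple R -> R := \1_[set x | 1 < L x].
  have mA : measurable [set x | 1 < L x].
    have := mL measurableT _ (measurable_itv `]1, +oo[).
    by rewrite setTI; congr measurable; apply/seteqP; split => x /=; rewrite in_itv/= andbT.
  have tf : is_test f by exact: is_test_indic.
  apply: ereal_inf_lbound; exists f => //; rewrite E//.
  apply: eq_integral => x _; congr EFin; rewrite /f indicE.
  case: ltP => h; first by rewrite mem_set//= subrr mulr0 addr0.
  by rewrite memNset/= ?add0r ?subr0 ?mulr1//; apply/negP; rewrite -leNgt.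
apply: le_ereal_inf_tmp => _ [f tf <-]; rewrite E//.
have [mf f01] := tf.
apply: ge0_le_integral => //.
- by move=> x _; rewrite lee_fin le_min ler01 L0.
- exact/measurable_EFinP.
- apply/measurable_EFinP; apply: measurable_funD => //; apply: measurable_funM => //.
  exact: measurable_funB.
move=> x _; rewrite lee_fin; have /andP[f0 f1] := f01 x; have := L0 x.
set z := L x => z0; have [h|h] := leP 1 z.
  have : 0 <= (z - 1) * (1 - f x) by rewrite mulr_ge0// subr_ge0.
  lra.
have : 0 <= (1 - z) * f x by rewrite mulr_ge0// subr_ge0 ltW.
lra.
Qed.

End error_sum.

(** * Consequences of local alternatives *)

Section local.
Context (R : realType) (P : probability R R) (Q : nat -> probability R R).
Context (a : nat -> R) (G : nat -> R -> R) (h D : R -> R) (d sg2 : R).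
Hypothesis la : local_alternatives P Q a G h D d sg2.

Lemma local_is_density n : is_density P (Q n) (fun x => 1 + a n * G n x).
Proof.
split; [|exact: local_density_ge0 la n|exact: local_density la n].
by apply: measurable_funD => //; apply: measurable_funM => //; exact: local_measurable la n.
Qed.

Let G_le n x : `|G n x| <= 1 + D x.
Proof.
have := local_dominated la n x; rewrite -real_normK ?num_real// => hD.
have := sqr_ge0 (`|G n x| - 1); rewrite sqrrB; have := normr_ge0 (G n x); lra.
Qed.

Lemma local_mean (B : set R) : measurable B ->
  exists2 m, has_mean P (fun x => h x * \1_B x) m & exists2 m_ : nat -> R,
    (forall n, has_mean P (fun x => G n x * \1_B x) (m_ n)) & m_ n @[n --> \oo] --> m.
Proof.
move=> mB; apply: (has_mean_cvg _ _ _
  (has_meanD (has_mean_cst P 1) (local_dominating la))) => [n|x|n x].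
- by apply: measurable_funM; [exact: local_measurable la n|exact: measurable_indic].
- by apply: cvgM; [exact: local_cvg la x|exact: cvg_cst].
- rewrite normrM indicE; apply: le_trans (G_le n x).
  by case: (_ \in _); rewrite ?normr1 ?mulr1// normr0 mulr0.
Qed.

Lemma local_mean_sqr (B : set R) : measurable B ->
  exists2 m, has_mean P (fun x => h x ^+ 2 * \1_B x) m & exists2 m_ : nat -> R,
    (forall n, has_mean P (fun x => G n x ^+ 2 * \1_B x) (m_ n)) &
    m_ n @[n --> \oo] --> m.
Proof.
move=> mB; apply: (has_mean_cvg _ _ _ (local_dominating la)) => [n|x|n x].
- apply: measurable_funM; last exact: measurable_indic.
  by apply: measurable_funX; exact: local_measurable la n.
- by apply: cvgM; [apply: cvgM; exact: local_cvg la x|exact: cvg_cst].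
- rewrite normrM normrX real_normK ?num_real// indicE.
  apply: le_trans (local_dominated la n x).
  by case: (_ \in _); rewrite ?normr1 ?mulr1// normr0 mulr0 sqr_ge0.
Qed.

Lemma local_second_moment : exists2 v : nat -> R,
  (forall n, has_mean P (fun x => G n x ^+ 2) (v n)) & v n @[n --> \oo] --> sg2.
Proof.
have [m hm [v hv vm]] := local_mean_sqr measurableT.
have T1 (f : R -> R) x : f x * \1_[set: R] x = f x by rewrite indicE in_setT mulr1.
exists v => [n|]; first by apply: (has_mean_eq (hv n)) => // x; rewrite T1.
suff <- : m = sg2 by [].
apply: (has_mean_uniq _ (local_variance la)).
by apply: (has_mean_eq hm) => // x; rewrite T1.
Qed.

Lemma local_limit_centered : has_mean P h 0.
Proof.
have [m hm [v hv vm]] := local_mean measurableT.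
have T1 (f : R -> R) x : f x * \1_[set: R] x = f x by rewrite indicE in_setT mulr1.
have v0 n : v n = 0.
  apply: (has_mean_uniq (hv n)).
  by apply: (has_mean_eq (local_centered la n)) => // x; rewrite T1.
apply: (has_mean_eq hm) => [x|]; first by rewrite T1.
apply: (cvg_unique _ vm) => //; rewrite (_ : (fun n => v n) = fun=> 0); first exact: cvg_cst.
by apply/funext.
Qed.

Lemma local_density_sqr n (v : R) : has_mean P (fun x => G n x ^+ 2) v ->
  has_mean P (fun x => (1 + a n * G n x) ^+ 2) (1 + a n ^+ 2 * v).
Proof.
move=> hv; apply: (has_mean_eq (has_meanD (has_mean_cst P 1)
  (has_meanD (has_meanZ (2 * a n) (local_centered la n)) (has_meanZ (a n ^+ 2) hv)))).
  by move=> x; ring.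
by rewrite mulr0 add0r.
Qed.

(** Second moments of the likelihood ratio of the sample stay bounded as long as
    [n] times the chi-square distance does. *)
Lemma exprD1_le_expR n (x : R) : 0 <= x -> (1 + x) ^+ n <= expR (n%:R * x).
Proof.
move=> x0; rewrite expRM_natl lerXn2r ?nnegrE ?expR_ge0 ?addr_ge0//.
exact: expR_ge1Dx.
Qed.

(** Alternatives at squared distance of smaller order than [1 / n] are
    undetectable: the likelihood ratio converges to 1 in mean square. *)
Theorem indistinguishable (f : forall n, n.-tuple R -> R) :
  n%:R * a n ^+ 2 @[n --> \oo] --> (0 : R) -> test_sequence f ->
  cannot_distinguish P Q f.
Proof.
move=> na tf; have [v hv vs] := local_second_moment.
have cE : expR (n%:R * (a n ^+ 2 * v n)) @[n --> \oo] --> (1 : R).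
  have : n%:R * a n ^+ 2 * v n @[n --> \oo] --> (0 : R).
    by rewrite -(mul0r sg2); exact: cvgM.
  move=> /(continuous_cvg _ (@continuous_expR R 0)); rewrite expR0.
  by under eq_fun do rewrite /= -mulrA.
apply: eclose_cvg => e e0.
near=> n.
have nE : expR (n%:R * (a n ^+ 2 * v n)) <= 1 + e ^+ 2 / 4.
  by near: n; apply: cvgr_le; [exact: cE|rewrite ltrDl divr_gt0// exprn_gt0].
have v0 : 0 <= v n.
  apply: (has_mean_le (has_mean_cst P 0) (hv n)) => x; exact: sqr_ge0.
apply: error_sum_gap; first exact: tf.
have [mL L0 hL] := density_prod n (local_is_density n).
have chi := has_mean_prod_sqr n (local_density_sqr (hv n)).
have e2 : 0 < e / 2 by rewrite divr_gt0.
have av0 : 0 <= a n ^+ 2 * v n by rewrite mulr_ge0// sqr_ge0.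
have f0 x : (0 <= (f n x)%:E)%E by rewrite lee_fin; have [_ /(_ x)/andP[]] := tf n.
have mfE : measurable_fun setT (fun x => (f n x)%:E).
  by apply/measurable_EFinP; case: (tf n).
rewrite -(addrNK 1 (_ ^+ n)) addrC in chi.
have [h1 h2] := transport_gap L0 (density_mean (density_prod n (local_is_density n)))
  chi (tf n) e2 (hL _ mfE f0).
have := exprD1_le_expR n av0.
set z := (_ ^+ n) in h1 h2 *; move=> zE.
have le_e : e / 2 + (z - 1) / (e / 2) <= e.
  rewrite -lerBrDl -ler_pdivlMr ?invr_gt0// invrK.
  have : z - 1 <= e ^+ 2 / 4 by lra.
  by move=> /le_trans; apply; rewrite le_eqVlt; apply/orP; left; apply/eqP; field.
by apply: (ecloseW _ le_e); split.
Unshelve. all: by end_near. Qed.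

(** At the critical rate the multiplicative central limit theorem applies. *)
Theorem local_bayes_risk : 0 < sg2 -> a n @[n --> \oo] --> (0 : R) ->
  n%:R * a n ^+ 2 @[n --> \oo] --> (1 : R) ->
  ereal_inf [set error_sum P (Q n) f | f in [set f : n.-tuple R -> R | is_test f]]
    @[n --> \oo] -->
  (2%:E * normal_prob 0 1 `](2^-1 * Num.sqrt sg2)%R, +oo[%classic)%E.
Proof.
move=> sg0 a0 na; have [v hv vs] := local_second_moment.
under eq_fun => n do rewrite (neyman_pearson n (local_is_density n)).
have mG := local_measurable la.
have [b hb [rho hrho rb]] : exists2 m, has_mean P (fun=> 0 : R) m & exists2 m_ : nat -> R,
    (forall n, has_mean P (fun x => Num.min (G n x ^+ 2) (a n * `|G n x| ^+ 3)) (m_ n)) &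
    m_ n @[n --> \oo] --> m.
  apply: (has_mean_cvg _ _ _ (local_dominating la)) => [n|x|n x].
  - apply: measurable_minr; first by apply: measurable_funX; exact: mG.
    apply: measurable_funM => //; apply: measurable_funX; apply: measurableT_comp => //.
  - have c3 : a n * `|G n x| ^+ 3 @[n --> \oo] --> (0 : R).
      have cg : `|G n x| @[n --> \oo] --> `|h x|.
        by apply: cvg_norm; exact: local_cvg la x.
      have : a n * `|G n x| ^+ 3 @[n --> \oo] --> 0 * `|h x| ^+ 3.
        by apply: (cvgM a0); exact: (cvgM cg (cvgM cg cg)).
      by rewrite mul0r.
    apply: (squeeze_cvgr _ (cvg_cst 0) c3); apply: nearW => n.
    have t0 : 0 <= a n * `|G n x| ^+ 3.
      by rewrite mulr_ge0 ?exprn_ge0// (local_rate_ge0 la).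
    by rewrite le_min sqr_ge0 t0/= ge_min lexx orbT.
  - have t0 : 0 <= a n * `|G n x| ^+ 3.
      by rewrite mulr_ge0 ?exprn_ge0// (local_rate_ge0 la).
    rewrite ger0_norm; last by rewrite le_min sqr_ge0.
    by apply: le_trans (local_dominated la n x); rewrite ge_min lexx.
have b0 : b = 0 := has_mean_uniq hb (has_mean_cst P 0).
apply: (bayes_risk_cvg (Y := fun n x => a n * G n x)
  (v := fun n => a n ^+ 2 * v n) (rho := fun n => a n ^+ 2 * rho n)).
- apply: nearW => n; split.
  + by apply: measurable_funM => //; exact: mG.
  + by move=> x; have := local_density_ge0 la n x; lra.
  + by apply: (has_mean_eq (has_meanZ (a n) (local_centered la n))) => //; rewrite mulr0.
  + by apply: (has_mean_eq (has_meanZ (a n ^+ 2) (hv n))) => // x; rewrite exprMn.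
  + apply: (has_mean_eq (has_meanZ (a n ^+ 2) (hrho n))) => // x.
    rewrite minr_pMr ?sqr_ge0// -exprMn; congr Num.min.
    by rewrite normrM exprMn (ger0_norm (local_rate_ge0 la n)) mulrA -exprSr.
- by rewrite sqrtr_gt0.
- rewrite sqr_sqrtr; last exact: ltW.
  under eq_fun do rewrite mulrA.
  have : n%:R * a n ^+ 2 * v n @[n --> \oo] --> 1 * sg2 by exact: cvgM.
  by rewrite mul1r.
- under eq_fun do rewrite mulrA.
  have : n%:R * a n ^+ 2 * rho n @[n --> \oo] --> 1 * b by exact: cvgM.
  by rewrite b0 mulr0.
Qed.

End local.

(** * The statistic is driven by the tails *)

Section tails.
Context (R : realType) (P : probability R R) (s : R).
Local Notation F := (dist_fun P).
Hypothesis cF : continuous F.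

Definition tails (del : R) : set R := [set t | F t < del \/ 1 - del <= F t].

Lemma K_div_close (u v : R) : 0 < v < 1 ->
  `|u - v| <= v / 2 -> `|u - v| <= (1 - v) / 2 ->
  0 < u < 1 /\ exists2 k, K_div s u v = k%:E &
    (2 `^ `|s - 2|)^-1 / 2 * ((u - v) ^+ 2 / (v * (1 - v))) <= k <=
    2 `^ `|s - 2| / 2 * ((u - v) ^+ 2 / (v * (1 - v))).
Proof.
move=> /andP[v0 v1]; rewrite !ler_norml => /andP[a1 a2] /andP[b1 b2].
have u01 : 0 < u < 1 by lra.
by split => //; apply: K_div_bounds; lra.
Qed.

Lemma variance_mid_ge (del v : R) : 0 < del <= 4^-1 -> del <= v -> v < 1 - del ->
  del / 4 * del <= v * (1 - v).
Proof.
move=> /andP[d0 d4] dv vd.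
have h1 : 0 <= (v - del) * (1 - del - v) by apply: mulr_ge0; lra.
have h2 : del * del <= del * 4^-1 by rewrite ler_pM2l.
lra.
Qed.

(** In the middle of the range the statistic is of order [1 / n]; the points
    produced by [rare_flat_tail] make it exceed any multiple of [1 / n] in the
    lower tail. *)
Lemma exceeds_tails_rare (del e : R) : 0 < del <= 4^-1 -> 0 < e ->
  exists n0, forall n, (n0 <= n)%N -> rare (power_prob P n)
    [set x | exists c, exceeds P s setT c x /\ ~ exceeds P s (tails del) c x] e.
Proof.
move=> /andP[del0 del4] e0.
pose m : R := 2 `^ `|s - 2|.
have m1 : 1 <= m.
  by rewrite /m -[leLHS](@powRr0 _ 2) ler_powR// ler1n.
have m0 : 0 < m by exact: lt_le_trans m1.
pose M : R := Num.max 2 (4 - ln (e / 8)).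
have M2 : 2 <= M by rewrite le_max lexx.
have eM : 4 * expR (4 - M) <= e / 2.
  have : expR (4 - M) <= e / 8.
    rewrite -[leRHS]lnK ?posrE ?divr_gt0// ler_expR lerBlDr -lerBlDl.
    by rewrite le_max lexx orbT.
  lra.
(* The factor [m] compares the two sides of [K_div_bounds]; [26 / del] exceeds
   [13 / sqrt (del * (1 - del))]. *)
pose M' : R := m * (26 * M / del).
have M'1 : 1 <= M'.
  rewrite /M' -[leLHS]mulr1 ler_pM// ler_pdivlMr// mul1r; lra.
have e2 : 0 < e / 2 by rewrite divr_gt0.
have del2 : 0 < del <= 2^-1 by rewrite del0; lra.
have [k [t [ht [n0 hn0]]]] := rare_flat_tail cF del2 M'1 e2.
pose v0 := \big[Num.min/del]_j F (t j).
have v00 : 0 < v0 by apply: lt_bigmin => // j _; case/andP: (ht j).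
have v0d : v0 <= del by exact: bigmin_le_id.
have v0t j : v0 <= F (t j) by exact: bigmin_le.
exists (maxn 256 (maxn n0 (Num.truncn ((26 * M / v0) ^+ 2)).+1)) => n.
rewrite !geq_max => /and3P[n256 nn0 nN].
have ee : 4 * expR (4 - M) + e / 2 <= e by lra.
apply: (rareW ee); apply: rareS (rareU (rare_sup_deviation cF n256 M2) (hn0 n nn0)).
have n0R : 0 < n%:R :> R by rewrite ltr0n; exact: leq_trans n256.
have q0 : 0 < Num.sqrt n%:R :> R by rewrite sqrtr_gt0.
have dev (x : n.-tuple R) : ~ (exists u, 13 * M < Num.sqrt n%:R * `|emp_dist_fun x u - F u|) ->
    forall u, (emp_dist_fun x u - F u) ^+ 2 <= (13 * M) ^+ 2 / n%:R /\
      `|emp_dist_fun x u - F u| <= v0 / 2.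
  move=> no u; have hu : Num.sqrt n%:R * `|emp_dist_fun x u - F u| <= 13 * M.
    by rewrite leNgt; apply/negP => h; apply: no; exists u.
  split.
    rewrite ler_pdivlMr// mulrC -(sqr_sqrtr (ltW n0R)) -exprMn.
    rewrite -real_normK ?num_real// normrM (gtr0_norm q0).
    by rewrite ler_sqr ?nnegrE ?mulr_ge0// ?(ltW q0)// (le_trans _ M2).
  have hq : 26 * M / v0 <= Num.sqrt n%:R.
    rewrite -[leLHS]ger0_norm; last by rewrite divr_ge0 ?(ltW v00)//; lra.
    rewrite -sqrtr_sqr ler_sqrt//; apply: (@le_trans _ _ (Num.truncn ((26 * M / v0) ^+ 2)).+1%:R).
      by rewrite ltW// Num.Theory.truncnS_gt.
    by rewrite ler_nat; exact: nN.
  rewrite ler_pdivrMr// in hq.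
  rewrite -(ler_pM2l q0); apply: (le_trans hu); lra.
move=> x [c [[u [_ lo hi cK]] nex]].
apply: contrapT => /not_orP[no1 no2]; apply: nex.
have {no1} dx := dev x no1.
have [j hj] : exists j, M' * Num.sqrt (F (t j) * (1 - F (t j))) * Num.sqrt n%:R <
    `|hits R [set y | y <= t j] x - n%:R * F (t j)|.
  apply: contrapT => no; apply: no2 => j; rewrite leNgt; apply/negP => h; apply: no.
  by exists j.
have [tu|tu] := pselect (tails del u); first by exists u.
have {tu} [dv vd] : del <= F u /\ F u < 1 - del.
  by split; [rewrite leNgt|rewrite ltNge]; apply/negP => h; apply: tu; [left|right].
have v0u : v0 / 2 <= F u / 2 by rewrite ler_pM2r// (le_trans v0d).
have v0u' : v0 / 2 <= (1 - F u) / 2.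
  by rewrite ler_pM2r// (le_trans v0d)// lerBrDr addrC -lerBrDr ltW.
have [d1 d2] := dx u; have [_ w2] := dx (t j).
have u01 : 0 < F u < 1.
  by rewrite (lt_le_trans del0)//= (lt_le_trans vd)// gerBl ltW.
have /andP[tj0 tjd] := ht j.
have tj1 : F (t j) <= 1 - F (t j).
  apply: (@le_trans _ _ 4^-1); first by apply: ltW (lt_le_trans tjd del4).
  by rewrite lerBrDr -lerBrDl (le_trans (ltW tjd))// (le_trans del4)//; lra.
have tj01 : 0 < F (t j) < 1.
  by rewrite tj0 (lt_le_trans (lt_le_trans tjd del4))// invf_le1 ?ler1n.
have v0tj : v0 / 2 <= F (t j) / 2 by rewrite ler_pM2r.
have v0tj' : v0 / 2 <= (1 - F (t j)) / 2 by rewrite ler_pM2r// (le_trans (v0t j)).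
have [_ [kk Ek /andP[_ k2]]] := K_div_close u01 (le_trans d2 v0u) (le_trans d2 v0u').
have [u'01 [k' Ek' /andP[k'1 _]]] :=
  K_div_close tj01 (le_trans w2 v0tj) (le_trans w2 v0tj').
have [r1 r2] := emp_range u'01.
exists (t j); split; [by left|exact: r1|exact: r2|].
rewrite Ek'; rewrite Ek in cK; apply: (lt_le_trans cK); rewrite lee_fin.
set uu := emp_dist_fun x u in d1 k2; set v := F u in dv vd d1 k2.
set u' := emp_dist_fun x (t j) in k'1; set v' := F (t j) in hj tj01 k'1.
apply: (le_trans k2); apply: le_trans k'1; rewrite -/m.
have vv0 : 0 < v' * (1 - v') by case/andP: tj01 => ? ?; rewrite mulr_gt0// subr_gt0.
have h1 : (uu - v) ^+ 2 / (v * (1 - v)) <= (26 * M / del) ^+ 2 / n%:R.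
  have dd : del / 4 * del <= v * (1 - v) by apply: variance_mid_ge => //; rewrite del0.
  have vv : 0 < v * (1 - v) by apply: lt_le_trans dd; rewrite !mulr_gt0.
  rewrite ler_pdivrMr//; apply: (le_trans d1).
  have -> : (26 * M / del) ^+ 2 / n%:R * (v * (1 - v)) =
      (13 * M) ^+ 2 / n%:R * ((v * (1 - v)) / (del / 4 * del)).
    by field; rewrite !gt_eqF.
  rewrite -[leLHS]mulr1 ler_wpM2l ?divr_ge0 ?sqr_ge0 ?(ltW n0R)//.
  by rewrite ler_pdivlMr ?mul1r// !mulr_gt0.
have h2 : M' ^+ 2 / n%:R <= (u' - v') ^+ 2 / (v' * (1 - v')).
  rewrite ler_pdivlMr// -mulrAC ler_pdivrMr//.
  have hu' : hits R [set y | y <= t j] x - n%:R * v' = n%:R * (u' - v').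
    by rewrite /u' emp_dist_funE mulrBr mulrA mulfV ?mul1r// gt_eqF.
  rewrite hu' normrM (gtr0_norm n0R) in hj.
  have : (M' * Num.sqrt (v' * (1 - v')) * Num.sqrt n%:R) ^+ 2 <= (n%:R * `|u' - v'|) ^+ 2.
    have h0 : 0 <= M' * Num.sqrt (v' * (1 - v')) * Num.sqrt n%:R.
      have M'0 : 0 <= M' := le_trans ler01 M'1.
      by apply: mulr_ge0; [apply: mulr_ge0 => //|]; exact: sqrtr_ge0.
    by rewrite ler_sqr ?nnegrE ?(ltW hj)// (le_trans h0)// ltW.
  rewrite !exprMn !sqr_sqrtr ?(ltW vv0) ?(ltW n0R)// real_normK ?num_real//.
  rewrite expr2 [n%:R * n%:R * _]mulrAC ler_pM2r//.
  by rewrite [n%:R * _]mulrC.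
apply: (@le_trans _ _ (m / 2 * ((26 * M / del) ^+ 2 / n%:R))).
  by rewrite ler_pM2l// divr_gt0.
apply: (@le_trans _ _ (m^-1 / 2 * (M' ^+ 2 / n%:R))); last first.
  by rewrite ler_pM2l// divr_gt0// invr_gt0.
rewrite le_eqVlt; apply/orP; left; apply/eqP; rewrite /M'.
by field; rewrite !gt_eqF.
Qed.

End tails.

(** * The statistic cannot see the critical alternatives *)

Section censoring.
Context (R : realType) (P : probability R R).
Local Notation F := (dist_fun P).
Hypothesis cF : continuous F.

Definition middle (del : R) : set R := [set x | (del <= F x) && (F x < 1 - del)].

Definition censor (del a0 x : R) := if (del <= F x) && (F x < 1 - del) then a0 else x.

Let mmid del : measurable_fun setT (fun x => (del <= F x) && (F x < 1 - del)).
Proof.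
have mF := measurable_dist_fun P.
by apply: measurable_and; [exact: measurable_fun_ler|exact: measurable_fun_ltr].
Qed.

Lemma measurable_middle del : measurable (middle del).
Proof.
have := mmid del measurableT (Y := [set true]) Logic.I.
by rewrite setTI; congr measurable; apply/seteqP; split => x.
Qed.

Lemma measurable_censor del a0 : measurable_fun setT (censor del a0).
Proof. exact: measurable_fun_ifT. Qed.

Lemma middle_ge del : 0 < del <= 4^-1 -> 1 - 2 * del <= fine (P (middle del)).
Proof.
move=> /andP[d0 d4]; rewrite -lee_fin fineK ?fin_num_measure//; last exact: measurable_middle.
have sub : chain P (1 - del) `<=` chain P del `|` middle del.
  rewrite /chain; case: leP => [|_]; first by lra.
  case: leP => [|_]; first by lra.
  move=> x /= xd; case: (ltP (F x) del) => h; [by left|right].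
  by rewrite /middle/= h xd.
have key : (P (chain P (1 - del)%R) <= P (chain P del) + P (middle del))%E.
  apply: (le_trans _ (measureU2 P (measurable_chain P del) (measurable_middle del))).
  apply: le_measure => //; rewrite inE; first exact: measurable_chain.
  by apply: measurableU; [exact: measurable_chain|exact: measurable_middle].
have d1 : 0 <= 1 - del <= 1 by lra.
have d2 : 0 <= del <= 1 by lra.
move: key; rewrite (chainE cF d1) (chainE cF d2).
case: (P (middle del)) => [r|_|].
- by rewrite -EFinD !lee_fin; lra.
- exact: leey.
- by rewrite addeNy leeNy_eq.
Qed.

Lemma censor_halfline del a0 t y : middle del a0 -> tails P del t ->
  (censor del a0 y <= t) = (y <= t).
Proof.
move=> /andP[ad ad'] tt; rewrite /censor; case: ifP => // /andP[yd yd'].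
case: tt => tt.
  have ta : t < a0 := dist_fun_lt (lt_le_trans tt ad).
  have ty : t < y := dist_fun_lt (lt_le_trans tt yd).
  by rewrite !leNgt ta ty.
have ta : a0 < t := dist_fun_lt (lt_le_trans ad' tt).
have ty : y < t := dist_fun_lt (lt_le_trans yd' tt).
by rewrite (ltW ta) (ltW ty).
Qed.

Lemma exceeds_censor s del a0 n c (x : n.-tuple R) : middle del a0 ->
  exceeds P s (tails P del) c (map_tuple (censor del a0) x) <->
  exceeds P s (tails P del) c x.
Proof.
move=> ma.
have emp t : tails P del t ->
    emp_dist_fun (map_tuple (censor del a0) x) t = emp_dist_fun x t.
  move=> tt; rewrite /emp_dist_fun; congr (_ * _); apply: eq_bigr => i _.
  rewrite tnth_map !indicE; congr (_%:R); congr nat_of_bool.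
  by apply/idP/idP; rewrite !inE/= censor_halfline.
have cE t i : tails P del t ->
    (tnth (map_tuple (censor del a0) x) i <= t) = (tnth x i <= t).
  by move=> tt; rewrite tnth_map censor_halfline.
split=> -[t [tt [i hi] [j hj] ct]]; exists t; split; try exact: tt.
- by exists i; rewrite -cE.
- by exists j; rewrite ltNge -cE// -ltNge.
- by rewrite -(emp t tt); exact: ct.
- by exists i; rewrite cE.
- by exists j; rewrite ltNge cE// -ltNge.
- by rewrite (emp t tt); exact: ct.
Qed.

(** On the middle of the range only the total mass [q] of the density matters. *)
Lemma censored_integral del a0 (l : R -> R) (q : R) (f : R -> \bar R) :
  (forall x, 0 <= l x) -> measurable_fun setT l ->
  has_mean P (fun x => l x * \1_(middle del) x) q ->
  measurable_fun setT f -> (forall x, (0 <= f x)%E) ->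
  (\int[P]_x ((l x)%:E * f (censor del a0 x)) =
   \int[P]_x ((l x * \1_(~` middle del) x)%:E * f (censor del a0 x)) + f a0 * q%:E)%E.
Proof.
move=> l0 ml [_ hq] mf f0.
have mfc : measurable_fun setT (fun x => f (censor del a0 x)).
  exact: measurableT_comp mf (measurable_censor del a0).
have mM := measurable_middle del.
have m1 : measurable_fun setT (fun x => l x * \1_(middle del) x).
  by apply: measurable_funM => //; exact: measurable_indic.
have m2 : measurable_fun setT (fun x => l x * \1_(~` middle del) x).
  by apply: measurable_funM => //; apply: measurable_indic; exact: measurableC.
have i1 x : 0 <= l x * \1_(middle del) x by rewrite mulr_ge0.
have i2 x : 0 <= l x * \1_(~` middle del) x by rewrite mulr_ge0.
have m1E : measurable_fun setT (fun x => (l x * \1_(middle del) x)%:E).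
  exact/measurable_EFinP.
have m2E : measurable_fun setT
    (fun x => (l x * \1_(~` middle del) x)%:E * f (censor del a0 x))%E.
  by apply: emeasurable_funM => //; exact/measurable_EFinP.
have i1E x : (0 <= (l x * \1_(middle del) x)%:E)%E by rewrite lee_fin.
rewrite -hq -ge0_integralZl// -ge0_integralD//; last 3 first.
- by move=> x _; rewrite mule_ge0// lee_fin.
- by move=> x _; rewrite mule_ge0.
- by apply: emeasurable_funM.
apply: eq_integral => x _; rewrite !indicE in_setC /censor.
have -> : (x \in middle del) = (del <= F x) && (F x < 1 - del).
  by apply/idP/idP; rewrite inE.
case: ifP => _ /=; first by rewrite mulr0 mul0e add0e mulr1 muleC.
by rewrite mulr0 mule0 adde0 mulr1.
Qed.

End censoring.

Section critical.
Context (R : realType) (P : probability R R) (Q : nat -> probability R R).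
Context (a : nat -> R) (G : nat -> R -> R) (h D : R -> R) (d sg2 : R).
Hypothesis la : local_alternatives P Q a G h D d sg2.
Local Notation F := (dist_fun P).
Hypothesis cF : continuous F.

(** The density of the censored alternatives: on the middle of the range the
    score is replaced by its average. *)
Lemma censored_density n del a0 (m1 m2 pm : R) :
  has_mean P (fun x => G n x * \1_(~` middle P del) x) m1 ->
  has_mean P (fun x => G n x ^+ 2 * \1_(~` middle P del) x) m2 ->
  has_mean P \1_(middle P del) pm -> 2^-1 <= pm ->
  exists l : R -> R, [/\ measurable_fun setT l, forall x, 0 <= l x,
    forall f, measurable_fun setT f -> (forall x, (0 <= f x)%E) ->
      (\int[Q n]_x f (censor P del a0 x) =
       \int[P]_x ((l x)%:E * f (censor P del a0 x)))%E,
    has_mean P l 1 &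
    exists2 chi, has_mean P (fun x => l x ^+ 2) (1 + chi) &
      0 <= chi <= 3 * (a n ^+ 2 * m2)].
Proof.
move=> h1 h2 hp p2; set M := middle P del in h1 h2 hp *.
have p0 : 0 < pm by apply: lt_le_trans p2; rewrite invr_gt0.
have mM : measurable M by exact: measurable_middle.
have ind (x : R) : (\1_(~` M) x = 1 :> R /\ \1_M x = 0 :> R) \/
    (\1_(~` M) x = 0 :> R /\ \1_M x = 1 :> R).
  by rewrite !indicE in_setC; case: (x \in M); [right|left].
have hl : has_mean P (fun x => (1 + a n * G n x) * \1_M x) (pm - a n * m1).
  apply: (has_mean_eq (has_meanD hp (has_meanZ (a n)
    (has_meanB (local_centered la n) h1)))) => [x|]; last by rewrite sub0r mulrN.
  by have [[-> ->]|[-> ->]] := ind x; ring.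
pose c := m1 / pm.
pose l x := 1 + a n * (G n x * \1_(~` M) x - c * \1_M x).
have q0 : 0 <= pm - a n * m1.
  apply: (has_mean_le (has_mean_cst P 0) hl) => x.
  by rewrite mulr_ge0 ?(local_density_ge0 la).
have lE x : l x = (1 + a n * G n x) * \1_(~` M) x + (pm - a n * m1) / pm * \1_M x.
  rewrite /l /c; have [[-> ->]|[-> ->]] := ind x; first by ring.
  by field; rewrite gt_eqF.
have hc : has_mean P (fun x => G n x * \1_(~` M) x - c * \1_M x) 0.
  apply: (has_mean_eq (has_meanB h1 (has_meanZ c hp))) => //.
  by rewrite /c divfK ?gt_eqF// subrr.
have h1l : has_mean P l 1.
  by apply: (has_mean_eq (has_meanD (has_mean_cst P 1) (has_meanZ (a n) hc))) => //; rewrite mulr0 addr0.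
have ml := has_mean_measurable h1l.
have l0 x : 0 <= l x.
  by rewrite lE addr_ge0// mulr_ge0 ?(local_density_ge0 la)// divr_ge0// ltW.
have hs : has_mean P (fun x => (G n x * \1_(~` M) x - c * \1_M x) ^+ 2)
    (m2 + c ^+ 2 * pm).
  apply: (has_mean_eq (has_meanD h2 (has_meanZ (c ^+ 2) hp))) => // x.
  by have [[-> ->]|[-> ->]] := ind x; ring.
(* The variance of the score restricted to the tails is nonnegative. *)
have var0 : m1 ^+ 2 <= m2.
  have : has_mean P (fun x => (G n x * \1_(~` M) x - m1) ^+ 2) (m2 - m1 ^+ 2).
    apply: (has_mean_eq (has_meanD h2 (has_meanD (has_meanZ (- 2 * m1) h1)
      (has_mean_cst P (m1 ^+ 2))))) => [x|]; last by ring.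
    by have [[-> _]|[-> _]] := ind x; ring.
  move=> /(has_mean_le (has_mean_cst P 0)) hv; rewrite -subr_ge0; apply: hv => x.
  exact: sqr_ge0.
have cm : c ^+ 2 * pm <= 2 * m2.
  have -> : c ^+ 2 * pm = m1 ^+ 2 * pm^-1 by rewrite /c; field; rewrite gt_eqF.
  have p2' : pm^-1 <= 2 by rewrite -[2]invrK lef_pV2 ?posrE ?invr_gt0.
  rewrite mulrC; apply: ler_pM => //; rewrite ?sqr_ge0//.
  by rewrite invr_ge0 ltW.
exists l; split => //.
  move=> f mf f0.
  have mfc : measurable_fun setT (fun x => f (censor P del a0 x)).
    exact: measurableT_comp mf (measurable_censor P del a0).
  rewrite (local_density la)//.
  have [mL _ _] := local_is_density la n.
  rewrite (censored_integral a0 (local_density_ge0 la n) mL hl mf f0).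
  rewrite (censored_integral a0 l0 ml (q := pm - a n * m1) _ mf f0); last first.
    apply: (has_mean_eq (has_meanZ ((pm - a n * m1) / pm) hp)) => [x|].
      by rewrite lE; have [[-> ->]|[-> ->]] := ind x; ring.
    by rewrite divfK ?gt_eqF.
  congr (_ + _)%E; apply: eq_integral => x _; congr (_%:E * _)%E.
  by rewrite lE -/M; have [[-> ->]|[-> ->]] := ind x; ring.
exists (a n ^+ 2 * (m2 + c ^+ 2 * pm)).
  apply: (has_mean_eq (has_meanD (has_mean_cst P 1)
    (has_meanD (has_meanZ (2 * a n) hc) (has_meanZ (a n ^+ 2) hs)))).
    by move=> x; rewrite /l; ring.
  by rewrite mulr0 add0r.
have m20 : 0 <= m2 by apply: le_trans var0; exact: sqr_ge0.
apply/andP; split.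
  apply: mulr_ge0; first exact: sqr_ge0.
  by apply: addr_ge0 => //; apply: mulr_ge0; [exact: sqr_ge0|exact: ltW].
rewrite mulrCA ler_wpM2l ?sqr_ge0//; lra.
Qed.

(** The tails shrink to the set where [F] is 0 or 1, which is a null set. *)
Lemma small_tails (kap : R) : 0 < kap -> exists2 del, 0 < del <= 4^-1 &
  exists2 t2, has_mean P (fun x => h x ^+ 2 * \1_(~` middle P del) x) t2 & t2 < kap.
Proof.
move=> kap0.
pose del k : R := (k.+4)%:R^-1.
have del0 k : 0 < del k by rewrite invr_gt0.
have del4 k : del k <= 4^-1 by rewrite lef_pV2 ?posrE// ler_nat.
have cdel : del k @[k --> \oo] --> (0 : R).
  apply/cvgrPdist_lt => e e0.
  have [N hN] : exists N : nat, e^-1 < N%:R.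
    by exists (Num.truncn e^-1).+1; rewrite Num.Theory.truncnS_gt.
  near=> k; rewrite sub0r normrN gtr0_norm//.
  rewrite -[ltRHS]invrK ltf_pV2 ?posrE ?invr_gt0//.
  apply: (lt_le_trans hN); rewrite ler_nat.
  by apply: (@leq_trans k); [near: k; exact: nbhs_infty_ge|rewrite -addn4 leq_addr].
pose Z : set R := [set x | F x = 0 \/ 1 <= F x].
have mF := measurable_dist_fun P.
have hh := local_variance la.
have [mh2 _] : measurable_fun setT (fun x => h x ^+ 2) /\ True.
  by split => //; exact: has_mean_measurable hh.
have [|x|k x|m hm [t ht tm]] := has_mean_cvg
   (f_ := fun k x => h x ^+ 2 * \1_(~` middle P (del k)) x)
   (f := fun x => h x ^+ 2 * \1_Z x) _ _ _ hh.
- move=> k; apply: measurable_funM => //; apply: measurable_indic.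
  by apply: measurableC; exact: measurable_middle.
- apply: cvgM; first exact: cvg_cst.
  have [xZ|xZ] := pselect (Z x).
    rewrite (_ : (fun k => _) = fun=> \1_Z x); first exact: cvg_cst.
    apply/funext => k; rewrite !indicE in_setC memNset ?mem_set//=.
    rewrite /middle/=; have := del0 k; case: xZ => xZ dk.
      by rewrite xZ leNgt dk.
    by move=> /andP[_]; rewrite ltNge => /negP; apply; lra.
  have x0 : 0 < F x.
    by rewrite lt_neqAle dist_fun_ge0 andbT eq_sym; apply/eqP => e; apply: xZ; left.
  have x1 : F x < 1 by rewrite ltNge; apply/negP => e; apply: xZ; right.
  apply: cvg_near_cst; near=> k.
  rewrite !indicE in_setC [x \in Z]memNset// mem_set//= /middle /=.
  apply/andP; split.
    by near: k; apply: cvgr_le; [exact: cdel|].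
  rewrite ltrBrDr -ltrBrDl.
  by near: k; apply: cvgr_lt; [exact: cdel|rewrite subr_gt0].
- rewrite normrM normrX real_normK ?num_real// indicE.
  by case: (_ \in _); rewrite ?normr1 ?mulr1// normr0 mulr0 sqr_ge0.
have m0 : m = 0.
  have mZ : measurable Z.
    have -> : Z = ~` (F @^-1` `]0, 1[%classic).
      apply/seteqP; split => x /=; rewrite in_itv/=.
        by case=> [->|]; rewrite ?ltxx// leNgt => /negbTE ->; rewrite andbF.
      move=> /negP; rewrite negb_and -!leNgt => /orP[x0|]; last by right.
      by left; apply/eqP; rewrite eq_le x0 dist_fun_ge0.
    apply: measurableC; rewrite -[X in measurable X]setTI; exact: mF.
  have PZ : P Z = 0%E.
    apply/eqP; rewrite eq_le measure_ge0 andbT; apply/lee_addgt0Pr => e e0.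
    rewrite add0e; have [k ke] : exists k, 2 * del k <= e.
      have : \forall k \near \oo, del k <= e / 2.
        by apply: cvgr_le; [exact: cdel|rewrite divr_gt0].
      by move=> [k _ /(_ k (leqnn k)) /= hk]; exists k; lra.
    have mM := measurable_middle P (del k).
    apply: (@le_trans _ _ (P (~` middle P (del k)))).
      apply: le_measure; rewrite ?inE//; first exact: measurableC.
      move=> x xZ /andP[x0 x1]; have := del0 k; case: xZ => xZ; first by rewrite xZ leNgt in x0; rewrite (negbTE x0).
      by lra.
    rewrite probability_setC// -[P (middle _ _)]fineK ?fin_num_measure//.
    have d01 : 0 < del k <= 4^-1 by rewrite del0 del4.
    have := middle_ge cF d01; rewrite -EFinB lee_fin; lra.
  apply: (has_mean_uniq hm).
  split.
    by case: hm.
  have -> : (\int[P]_x (h x ^+ 2 * \1_Z x)%:E = \int[P]_(x in Z) (h x ^+ 2)%:E)%E.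
    rewrite [RHS]integral_mkcond; apply: eq_integral => x _.
    by rewrite patchE indicE; case: (_ \in _); rewrite ?mulr1 ?mulr0.
  rewrite null_set_integral//.
  by apply: measurable_funTS; exact/measurable_EFinP.
have [k hk] : exists k, t k < kap.
  have : \forall k \near \oo, t k < kap by apply: cvgr_lt; [exact: tm|rewrite m0].
  by move=> [k _ /(_ k (leqnn k))]; exists k.
by exists (del k); [rewrite del0 del4|exists (t k)].
Unshelve. all: by end_near. Qed.

Lemma integral_exceeds_gap n (Pn : probability (n.-tuple R) R)
    (A B : set (n.-tuple R)) (e : R) : measurable A -> measurable B -> B `<=` A ->
  rare Pn (A `\` B) e ->
  eclose e (\int[Pn]_x (\1_A x : R)%:E)%E (\int[Pn]_x (\1_B x : R)%:E)%E.
Proof.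
move=> mA mB BA rAB; rewrite !integral_indic// !setIT.
have mAB : measurable (A `\` B) by exact: measurableD.
have e0 : 0 <= e by case: rAB => f /mean_le_ge0.
have BA' : (Pn B <= Pn A)%E by apply: le_measure; rewrite ?inE.
split; last by apply: (le_trans BA'); rewrite leeDl.
have AE : A = B `|` (A `\` B).
  apply/seteqP; split => x; last by case=> [/BA|[]].
  by move=> Ax; have [Bx|Bx] := pselect (B x); [left|right].
rewrite {1}AE.
apply: (le_trans (measureU2 Pn mB mAB)); rewrite leeD2l//.
exact: rare_measure.
Qed.

(** At the critical rate the statistic is decided in the tails, up to rare
    events. There the alternatives, once censored, are at small chi-square
    distance from the null law. *)
Theorem S_test_indistinguishable (s : R) (c : nat -> R) :
  n%:R * a n ^+ 2 @[n --> \oo] --> (1 : R) ->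
  cannot_distinguish P Q (S_test P s c).
Proof.
move=> na; have [v hv vs] := local_second_moment la.
apply: eclose_cvg => e e0.
have la0 : 0 < ln (1 + e ^+ 2 / 16).
  by rewrite ln_gt0// ltrDl divr_gt0// exprn_gt0.
have [del dd [t2 ht2 t2l]] := small_tails (divr_gt0 la0 (ltr0n R 3) : 0 < _ / 3).
have [a0 Fa0] : exists t, F t = 2^-1 by apply: dist_fun_surj => //; lra.
have ma0 : middle P del a0 by case/andP: dd => ? ?; apply/andP; rewrite Fa0; split; lra.
have mN : measurable (~` middle P del) by apply: measurableC; exact: measurable_middle.
have [m1' _ [m1 hm1 _]] := local_mean la mN.
have [m2' hm2' [m2 hm2 m2t]] := local_mean_sqr la mN.
have {hm2' t2l} m2l : m2' < ln (1 + e ^+ 2 / 16) / 3 by rewrite (has_mean_uniq hm2' ht2).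
pose b0 := expR (sg2 + 1).
have b00 : 0 < b0 by exact: expR_gt0.
pose K := 8 * b0 / e.
have K0 : 0 < K by rewrite divr_gt0// mulr_gt0.
pose r := Num.min (e / 4) (e / (8 * K)).
have r0 : 0 < r by rewrite lt_min !divr_gt0// mulr_gt0.
have [n0 hn0] := exceeds_tails_rare s cF dd r0.
have ppm : 2^-1 <= fine (P (middle P del)).
  by have := middle_ge cF dd; case/andP: dd => ? ?; lra.
near=> n.
have nn0 : (n0 <= n)%N by near: n; exact: nbhs_infty_ge.
have rP := hn0 n nn0.
have nv : n%:R * (a n ^+ 2 * v n) <= sg2 + 1.
  near: n; have : n%:R * a n ^+ 2 * v n @[n --> \oo] --> 1 * sg2 by exact: cvgM.
  by rewrite mul1r; under eq_fun do rewrite -mulrA; move=> /cvgr_le; apply; rewrite ltrDl.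
have nm : n%:R * (a n ^+ 2 * m2 n) <= ln (1 + e ^+ 2 / 16) / 3.
  near: n; have : n%:R * a n ^+ 2 * m2 n @[n --> \oo] --> 1 * m2' by exact: cvgM.
  by rewrite mul1r; under eq_fun do rewrite -mulrA; move=> /cvgr_le; apply.
pose A := [set x : n.-tuple R | exceeds P s setT (c n) x].
pose B := [set x : n.-tuple R | exceeds P s (tails P del) (c n) x].
have mA : measurable A by exact: measurable_exceeds.
have mB : measurable B.
  apply: measurable_exceeds.
  have -> : tails P del = ~` middle P del.
    apply/seteqP; split => x /=; rewrite /middle/=.
      by case=> h1 /andP[h2 h3]; [move: (lt_le_trans h1 h2)|move: (le_lt_trans h1 h3)];
        rewrite ltxx.
    move=> /negP; rewrite negb_and -ltNge -leNgt => /orP[]; by [left|right].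
  exact: mN.
have BA : B `<=` A by move=> x [t [_ h1 h2 h3]]; exists t.
have rPAB : rare (power_prob P n) (A `\` B) r.
  by apply: rareS rP => x [Ax Bx]; exists (c n).
have v0 : 0 <= v n.
  by apply: (has_mean_le (has_mean_cst P 0) (hv n)) => x; exact: sqr_ge0.
have rQAB : rare (power_prob (Q n) n) (A `\` B) (e / 4).
  have h2 := has_mean_prod_sqr n (local_density_sqr la (hv n)).
  apply: (rareW _ (rare_contiguous (density_prod n (local_is_density la n)) h2 K0 rPAB)).
  have hb : (1 + a n ^+ 2 * v n) ^+ n <= b0.
    apply: (le_trans (exprD1_le_expR n _)); first by rewrite mulr_ge0// sqr_ge0.
    by rewrite ler_expR.
  have h3 : (1 + a n ^+ 2 * v n) ^+ n / K <= e / 8.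
    by rewrite ler_pdivrMr// /K (le_trans hb)// le_eqVlt; apply/orP; left; apply/eqP; field; rewrite gt_eqF.
  have h4 : K * r <= e / 8.
    apply: (@le_trans _ _ (K * (e / (8 * K)))).
      by rewrite ler_pM2l// ge_min lexx orbT.
    by rewrite le_eqVlt; apply/orP; left; apply/eqP; field; rewrite gt_eqF.
  lra.
have [l [ml l0 hl l1 [chi hchi /andP[chi0 chi3]]]] :=
  censored_density a0 (hm1 n) (hm2 n) (has_mean_indic P (measurable_middle P del)) ppm.
have BE x : B (map_tuple (censor P del a0) x) <-> B x.
  exact: (exceeds_censor s (c n) x ma0).
have cB x : \1_B (map_tuple (censor P del a0) x) = \1_B x :> R.
  rewrite !indicE; have [Bx|Bx] := pselect (B x).
    by rewrite (mem_set Bx) (mem_set ((BE x).2 Bx)).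
  by rewrite (memNset Bx) (memNset (fun h => Bx ((BE x).1 h))).
have SA : S_test P s c (n := n) = \1_A by exact: S_test_exceeds.
clearbody A B.
have e4 : 0 < e / 4 by rewrite divr_gt0.
have gap : eclose (e / 2) (\int[power_prob (Q n) n]_x (\1_B x : R)%:E)%E
    (\int[power_prob P n]_x (\1_B x : R)%:E)%E.
  have L1 := has_mean_prod n l0 l1; rewrite expr1n in L1.
  have L2 := has_mean_prod_sqr n hchi.
  rewrite -(addrNK 1 (_ ^+ n)) addrC in L2.
  have L0 (x : n.-tuple R) : 0 <= \prod_(i < n) l (tnth x i) by apply: prodr_ge0.
  have mBE : measurable_fun setT (fun x : n.-tuple R => (\1_B x : R)%:E).
    by apply/measurable_EFinP; exact: measurable_indic.
  have B0 (x : n.-tuple R) : (0 <= (\1_B x : R)%:E)%E by rewrite lee_fin.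
  have := power_prob_change (measurable_censor P del a0) ml l0 hl mBE B0.
  under eq_integral do rewrite cB.
  under [in RHS]eq_integral do rewrite cB.
  move=> tr; have := transport_gap L0 L1 L2 (is_test_indic R mB) e4 tr.
  move/ecloseW; apply.
  have hb : (1 + chi) ^+ n <= 1 + e ^+ 2 / 16.
    apply: (le_trans (exprD1_le_expR n chi0)).
    rewrite -[leRHS]lnK ?posrE ?addr_gt0// ?divr_gt0 ?exprn_gt0//.
    rewrite ler_expR; apply: (@le_trans _ _ (n%:R * (3 * (a n ^+ 2 * m2 n)))).
      by rewrite ler_wpM2l.
    by rewrite mulrCA mulrC -ler_pdivlMr.
  have hx : ((1 + chi) ^+ n - 1) / (e / 4) <= e / 4.
    rewrite ler_pdivrMr// lerBlDl (le_trans hb)// lerD2l le_eqVlt; apply/orP; left.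
    by apply/eqP; field.
  lra.
rewrite SA; apply: (error_sum_gap (is_test_indic R mA)).
have gP := integral_exceeds_gap mA mB BA rPAB.
have gQ := integral_exceeds_gap mA mB BA rQAB.
apply: (ecloseW (eclose_trans gQ (eclose_trans gap (eclose_sym gP)))).
have re : r <= e / 4 by rewrite ge_min lexx.
lra.
Unshelve. all: by end_near. Qed.

End critical.

(** * Separation below the boundary *)

(** Half-lines generate the Borel sets, so they already witness that a score
    is not degenerate. *)
Lemma halfline_mean_neq0 (R : realType) (P : probability R R) (h : R -> R) (sg2 : R) :
  has_mean P h 0 -> has_mean P (fun x => h x ^+ 2) sg2 -> 0 < sg2 ->
  exists t m, has_mean P (fun x => h x * \1_[set y | y <= t] x) m /\ m != 0.
Proof.
move=> h0 h2 sg0; apply: contrapT => no.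
have mh := has_mean_measurable h0.
have dom x (A : set R) : `|h x * \1_A x| <= 1 + h x ^+ 2.
  apply: (@le_trans _ _ `|h x|).
    rewrite normrM indicE; case: (_ \in _); rewrite ?normr1 ?mulr1//.
    by rewrite normr0 mulr0.
  have := sqr_ge0 (`|h x| - 1); rewrite sqrrB real_normK ?num_real//.
  have := normr_ge0 (h x); lra.
have hD := has_meanD (has_mean_cst P 1) h2.
pose Pz (A : set R) := measurable A /\ has_mean P (fun x => h x * \1_A x) 0.
have PzC A : Pz A -> Pz (~` A).
  move=> [mA hA]; split; first exact: measurableC.
  apply: (has_mean_eq (has_meanB h0 hA)) => [x|]; last by rewrite subrr.
  by rewrite !indicE in_setC; case: (_ \in _); rewrite /= ?mulr1 ?mulr0 ?subrr ?subr0.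
have half t : Pz [set y | y <= t].
  split; first exact: measurable_halfline.
  have [m hm] : exists m, has_mean P (fun x => h x * \1_[set y | y <= t] x) m.
    apply: (has_mean_dominated _ (fun x => dom x _) hD).
    by apply: measurable_funM => //; apply: measurable_indic; exact: measurable_halfline.
  suff -> : 0 = m by [].
  by apply/esym/eqP/negPn/negP => m0; apply: no; exists t, m.
have all A : measurable A -> Pz A.
  move=> mA; have mE := RGenOInfty.measurableE R.
  apply: (dynkin_induction (T := measurableTypeR R) mE).
  - move=> _ _ [x ->] [y ->]; exists (Num.max x y).
    by apply/seteqP; split => z /=; rewrite !in_itv/= !andbT gt_max => /andP.
  - split => //; apply: (has_mean_eq h0) => // x; by rewrite indicE in_setT mulr1.
  - move=> _ [x ->]; have -> : `]x, +oo[%classic = ~` [set y | y <= x].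
      by apply/seteqP; split => z /=; rewrite in_itv/= andbT ltNge => /negP.
    exact: PzC.
  - by move=> S _; exact: PzC.
  - move=> E mE' tE PE; split; first exact: bigcupT_measurable.
    pose U k := \big[setU/set0]_(i < k) E i.
    have PU k : Pz (U k).
      elim: k => [|k [mU hU]].
        rewrite /U big_ord0; split => //.
        by apply: (has_mean_eq (has_mean_cst P 0)) => // x; rewrite indicE in_set0 mulr0.
      rewrite /U big_ord_recr/= -/(U k); split; first by apply: measurableU => //; exact: mE'.
      have := has_meanD hU (PE k).2; rewrite addr0 => hUE.
      apply: (has_mean_eq hUE) => // x.
      rewrite -mulrDr; congr (_ * _); rewrite !indicE in_setU.
      have [xU|xU] := boolP (x \in U k); have [xE|xE] := boolP (x \in E k);
        rewrite /= ?addr0 ?add0r//.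
      exfalso; move: xU xE; rewrite !inE /U -bigcup_mkord => -[i /= ik Ei] Ek.
      have := (trivIsetP.1 tE) i k Logic.I Logic.I (negbT (ltn_eqF ik)).
      by rewrite -subset0 => /(_ x); apply.
    have [| |m hm [m_ hm_ mm]] := has_mean_cvg
      (f_ := fun k x => h x * \1_(U k) x) (f := fun x => h x * \1_(\bigcup_k E k) x)
      _ _ (fun k x => dom x (U k)) hD.
    + by move=> k; exact: has_mean_measurable (PU k).2.
    + move=> x; apply: cvgM; first exact: cvg_cst.
      have [[i _ Ei]|xE] := pselect ((\bigcup_k E k) x).
        apply: cvg_near_cst; near=> k; rewrite !indicE [x \in \bigcup_k _]mem_set//; last by exists i.
        rewrite mem_set// /U -bigcup_mkord; exists i => //=.
        by near: k; exact: nbhs_infty_gt.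
      rewrite (_ : (fun k => _) = fun=> \1_(\bigcup_k E k) x); first exact: cvg_cst.
      apply/funext => k; rewrite !indicE memNset ?memNset//.
      by rewrite /U -bigcup_mkord => -[i _ Ei]; apply: xE; exists i.
    suff -> : 0 = m by [].
    apply: (cvg_unique _ _ mm) => //.
    rewrite (_ : (fun n => m_ n) = fun=> 0); first exact: cvg_cst.
    by apply/funext => k; apply: (has_mean_uniq (hm_ k)); case: (PU k).
  - exact: (eq_ind _ id mA _ (congr1 (fun f => f A) mE)).
pose A := [set x | 0 <= h x].
have mA : measurable A.
  have := mh measurableT _ (measurable_itv `[0, +oo[).
  by rewrite setTI; congr measurable; apply/seteqP; split => x /=; rewrite in_itv/= andbT.
have [_ hA] := all _ mA; have [_ hA'] := all _ (measurableC mA).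
have habs : has_mean P (fun x => `|h x|) 0.
  apply: (has_mean_eq (has_meanB hA hA')) => [x|]; last by rewrite subrr.
  rewrite !indicE in_setC; have [xA|xA] := boolP (x \in A); rewrite /= mulr1 mulr0.
    by rewrite subr0 ger0_norm//; rewrite inE in xA.
  by rewrite sub0r ltr0_norm// ltNge; apply/negP => h'; move/negP: xA; apply; rewrite inE.
have ae0 : ae_eq P setT (fun x => (h x)%:E) (cst 0%E).
  apply/(ae_eq_integral_abs P measurableT); first exact/measurable_EFinP.
  by case: habs.
have : sg2 = 0.
  apply: (has_mean_uniq h2); split; first by case: h2.
  rewrite (ae_eq_integral (cst 0%E))//.
  - by rewrite integral_cst//= mul0e.
  - by apply/measurable_EFinP; exact: has_mean_measurable h2.
  - apply: filterS ae0 => x /= h' _; have hx0 : h x = 0 by exact: (EFin_inj (h' Logic.I)).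
    by rewrite hx0 expr0n.
by move=> e; rewrite e ltxx in sg0.
Unshelve. all: by end_near. Qed.

Section null_bound.
Context (R : realType).

(** Bernoulli, applied to the probability that no observation falls in [A]. *)
Lemma rare_hit (P : probability R R) n (A : set R) : measurable A ->
  rare (power_prob P n) [set x : n.-tuple R | exists i, A (tnth x i)]
    (n%:R * fine (P A)).
Proof.
move=> mA; set p := fine (P A).
have p1 : p <= 1.
  by rewrite /p -lee_fin fineK ?fin_num_measure// probability_le1.
have h1 : has_mean P (fun x => 1 - \1_A x) (1 - p).
  exact: has_meanB (has_mean_cst P 1) (has_mean_indic P mA).
have i01 x : 0 <= (1 - \1_A x : R) <= 1.
  by rewrite subr_ge0 gerBl !indicE ler0n lern1 andbT; case: (x \in A).
have i0 x : 0 <= 1 - \1_A x :> R by case/andP: (i01 x).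
have h2 := has_mean_prod n i0 h1.
have h3 := has_meanB (has_mean_cst _ 1) h2.
have pr01 (x : n.-tuple R) : 0 <= (\prod_(i < n) (1 - \1_A (tnth x i)) : R) <= 1.
  by apply: (big_ind (fun z : R => 0 <= z <= 1)) => [|a b /andP[a0 a1] /andP[b0 b1]|i _];
    rewrite ?ler01 ?lexx// mulr_ge0//= mulr_ile1.
exists (fun x => 1 - \prod_(i < n) (1 - \1_A (tnth x i))).
  apply: (mean_leW _ (has_mean_mean_le _ h3)).
    have := @expr_ge_bernoulli R n (- p); rewrite lerN2 => /(_ p1).
    by rewrite mulrN; lra.
  by move=> x; rewrite subr_ge0; case/andP: (pr01 x).
move=> x [i Ai]; rewrite (bigD1 i)//= indicE mem_set//= subrr mul0r subr0.
exact: lexx.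
Qed.

(** Multiplicative form of a deviation of Poisson size: [x] and [y] are the
    expected and the observed number of points of a set. *)
Lemma deviation_ratio (B x y : R) : 1 <= B -> 0 < x -> 1 <= B ^+ 2 * x -> 1 <= y ->
  `|y - x| <= B * Num.sqrt x -> y <= (2 + B ^+ 2) * x /\ x <= (2 + B ^+ 2) * y.
Proof.
move=> B1 x0 Bx y1; set q := Num.sqrt x.
have q0 : 0 <= q by exact: sqrtr_ge0.
have xq : x = q ^+ 2 by rewrite sqr_sqrtr// ltW.
rewrite ler_norml => /andP[h1 h2].
have B0 : 0 <= B by exact: le_trans B1.
have Bq1 : 1 <= B * q.
  by rewrite -(@ler_pXn2r _ 2) ?nnegrE ?mulr_ge0// expr1n exprMn -xq.
have h3 : B * q <= (B * q) ^+ 2 by rewrite expr2 ler_peMl// mulr_ge0.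
rewrite exprMn -xq in h3.
split; first lra.
have h4 : B * q <= (x + B ^+ 2) / 2.
  have := sqr_ge0 (q - B); rewrite sqrrB -xq; lra.
have : B ^+ 2 <= B ^+ 2 * y by rewrite ler_peMr ?sqr_ge0.
lra.
Qed.

Lemma sqrt_variance_step (n z p v : R) : 0 <= z -> 0 <= v <= 1 -> 0 <= p <= 1 ->
  0 <= n -> n * `|p - v| <= 1 ->
  2 * z * (1 + Num.sqrt (n * (p * (1 - p)))) <=
  2 * z * (2 + Num.sqrt (n * (v * (1 - v)))).
Proof.
move=> z0 /andP[v0 v1] /andP[p0 p1] n0 pv; rewrite ler_wpM2l ?mulr_ge0//.
have V0 : 0 <= n * (v * (1 - v)) by rewrite !mulr_ge0// subr_ge0.
set q := Num.sqrt (n * (v * (1 - v))).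
have q0 : 0 <= q by exact: sqrtr_ge0.
suff : Num.sqrt (n * (p * (1 - p))) <= 1 + q by lra.
rewrite -[leRHS]ger0_norm ?addr_ge0// -sqrtr_sqr ler_sqrt ?sqr_ge0//.
rewrite sqrrD expr1n sqr_sqrtr//.
have h : p * (1 - p) <= v * (1 - v) + `|p - v|.
  have -> : p * (1 - p) = v * (1 - v) + (p - v) * (1 - p - v) by ring.
  rewrite lerD2l (le_trans (ler_norm _))// normrM ler_piMr// ler_norml; lra.
have : n * (p * (1 - p)) <= n * (v * (1 - v) + `|p - v|) by rewrite ler_wpM2l.
lra.
Qed.

Context (P : probability R R) (s : R).
Local Notation F := (dist_fun P).
Hypothesis cF : continuous F.

(** Exponential bounds adapted to the variance: at each of the [n ^ 2 + 1] levels
    the parameter is inversely proportional to the bound on the standard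
    deviation. *)
Lemma rare_grid n (z : R) : 1 <= z -> (0 < n)%N ->
  rare (power_prob P n) [set x | exists2 j, (j < (n ^ 2).+1)%N &
      let p := j%:R / (n ^ 2)%:R in
      2 * z * (1 + Num.sqrt (n%:R * (p * (1 - p)))) <=
        `|hits R (chain P p) x - n%:R * p| ]
    ((n ^ 2).+1%:R * (2 * expR (2^-1 - z))).
Proof.
move=> z1 n0.
have -> : (n ^ 2).+1%:R * (2 * expR (2^-1 - z)) = \sum_(j < (n ^ 2).+1) (2 * expR (2^-1 - z)).
  by rewrite sumr_const card_ord mulr_natl.
apply: (@rare_bigU _ _ _ _ _ (fun j => [set x : n.-tuple R | let p : R := j%:R / (n ^ 2)%:R in
  2 * z * (1 + Num.sqrt (n%:R * (p * (1 - p)))) <= `|hits R (chain P p) x - n%:R * p| ])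
  (fun=> 2 * expR (2^-1 - z))) => j jN.
have N0 : 0 < (n ^ 2)%:R :> R by rewrite ltr0n expn_gt0 n0.
have p01 : 0 <= (j%:R / (n ^ 2)%:R : R) <= 1.
  by rewrite divr_ge0//= ler_pdivrMr// mul1r ler_nat -ltnS.
set p : R := j%:R / (n ^ 2)%:R in p01 *.
have pE : fine (P (chain P p)) = p by rewrite chainE.
have V0 : 0 <= n%:R * (p * (1 - p)).
  by case/andP: p01 => ? ?; rewrite !mulr_ge0// subr_ge0.
set q := Num.sqrt (n%:R * (p * (1 - p))).
have q0 : 0 <= q by exact: sqrtr_ge0.
have q1 : 0 < 1 + q by lra.
pose l := (2 * (1 + q))^-1.
have l01 : 0 <= l <= 2^-1.
  rewrite /l invr_ge0 mulr_ge0 ?(ltW q1)//= lef_pV2 ?posrE ?mulr_gt0//; lra.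
have := rare_hits P n (2 * z * (1 + q)) (measurable_chain P p) l01; rewrite pE.
apply: rareW; rewrite ler_wpM2l// ler_expR.
have -> : l * (2 * z * (1 + q)) = z by rewrite /l; field; rewrite gt_eqF.
rewrite lerD2r.
have h : l ^+ 2 * q ^+ 2 <= 4^-1.
  rewrite -exprMn; have -> : 4^-1 = 2^-1 ^+ 2 :> R by field.
  case/andP: l01 => l0 _; rewrite ler_sqr ?nnegrE ?mulr_ge0//.
  rewrite /l invfM -mulrA ler_piMr// mulrC ler_pdivrMr//; lra.
rewrite [q ^+ 2]sqr_sqrtr// in h.
rewrite -mulrA; lra.
Qed.

(** Neighbouring levels differ by [n ^ (-2)], less than one expected observation. *)
Lemma grid_deviation n (z : R) (x : n.-tuple R) t : 1 <= z -> (0 < n)%N ->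
  0 < F t < 1 ->
  ~ (exists2 j, (j < (n ^ 2).+1)%N &
      let p := j%:R / (n ^ 2)%:R in
      2 * z * (1 + Num.sqrt (n%:R * (p * (1 - p)))) <=
        `|hits R (chain P p) x - n%:R * p|) ->
  `|hits R [set y | y <= t] x - n%:R * F t| <=
    5 * z * (1 + Num.sqrt (n%:R * (F t * (1 - F t)))).
Proof.
move=> z1 n0 /andP[v0 v1] no; set v := F t in v0 v1 *.
have n0R : 0 < n%:R :> R by rewrite ltr0n.
have n1R : 1 <= n%:R :> R by rewrite ler1n.
have N0 : 0 < (n ^ 2)%:R :> R by rewrite ltr0n expn_gt0 n0.
have z0 : 0 <= z by lra.
set q := Num.sqrt (n%:R * (v * (1 - v))).
have q0 : 0 <= q by exact: sqrtr_ge0.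
have vN0 : 0 <= v * (n ^ 2)%:R by rewrite mulr_ge0// ltW.
pose j := Num.truncn (v * (n ^ 2)%:R).
have /andP[j1 j2] : j%:R <= v * (n ^ 2)%:R < j.+1%:R by exact: Num.Theory.truncn_itv.
have jN : (j < n ^ 2)%N.
  rewrite -(ltr_nat R); apply: (le_lt_trans j1).
  by rewrite gtr_pMl.
have nN (e : R) : n%:R * (e / (n ^ 2)%:R) = e / n%:R.
  by rewrite natrX; field; rewrite gt_eqF.
have dev k : (k < (n ^ 2).+1)%N -> n%:R * `|k%:R / (n ^ 2)%:R - v| <= 1 ->
    `|hits R (chain P (k%:R / (n ^ 2)%:R)) x - n%:R * (k%:R / (n ^ 2)%:R)| <=
    2 * z * (2 + q).
  move=> kN kv; rewrite leNgt; apply/negP => h; apply: no; exists k => //=.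
  apply: ltW; apply: le_lt_trans h; apply: sqrt_variance_step => //.
  - by rewrite (ltW v0) (ltW v1).
  - by rewrite divr_ge0//= ler_pdivrMr// mul1r ler_nat -ltnS.
have close k : `|k%:R - v * (n ^ 2)%:R| <= 1 -> n%:R * `|k%:R / (n ^ 2)%:R - v| <= 1.
  move=> h; have -> : k%:R / (n ^ 2)%:R - v = (k%:R - v * (n ^ 2)%:R) / (n ^ 2)%:R.
    by field; rewrite gt_eqF.
  rewrite normrM normfV (gtr0_norm N0) nN ler_pdivrMr// mul1r.
  exact: le_trans n1R.
have cj : `|j%:R - v * (n ^ 2)%:R| <= 1.
  by rewrite -natr1 in j2; rewrite ler_norml; lra.
have cj' : `|j.+1%:R - v * (n ^ 2)%:R| <= 1.
  by rewrite -natr1 in j2 *; rewrite ler_norml; lra.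
have d1 := dev j (ltnW jN) (close j cj); have d2 := dev j.+1 jN (close j.+1 cj').
have c1 := close j cj; have c2 := close j.+1 cj'.
set p := j%:R / (n ^ 2)%:R in d1 c1; set p' := j.+1%:R / (n ^ 2)%:R in d2 c2.
have pv : p <= v by rewrite ler_pdivrMr.
have vp' : v < p' by rewrite ltr_pdivlMr.
have s1 : hits R (chain P p) x <= hits R [set y | y <= t] x.
  by apply: hits_le; apply: chain_sub_halfline => //; exact: le_lt_trans v1.
have s2 : hits R [set y | y <= t] x <= hits R (chain P p') x.
  by apply: hits_le; exact: halfline_sub_chain.
rewrite !ler_norml in d1 d2 *.
rewrite (ler0_norm (_ : p - v <= 0)) ?subr_le0// in c1.
rewrite (gtr0_norm (_ : 0 < p' - v)) ?subr_gt0// in c2.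
have zq : 0 <= z * q by rewrite mulr_ge0.
case/andP: d1 => d1 _; case/andP: d2 => _ d2.
apply/andP; split; lra.
Qed.

End null_bound.

Section null_statistic.
Context (R : realType) (P : probability R R) (s : R).
Local Notation F := (dist_fun P).
Hypothesis cF : continuous F.

Lemma variance_range_ge (w v : R) : w <= v -> v <= 1 - w -> 0 <= w ->
  w / 2 <= v * (1 - v).
Proof.
move=> wv vw w0.
have h : 0 <= (v - w) * (1 - w - v) by apply: mulr_ge0; lra.
have h2 : 0 <= w * (1 - 2 * w) by apply: mulr_ge0; lra.
lra.
Qed.

Lemma rare_extreme n (w : R) : 0 < w <= 1 -> rare (power_prob P n)
  [set x : n.-tuple R | exists i, F (tnth x i) < w \/ 1 - w <= F (tnth x i)]
  (n%:R * w + n%:R * w).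
Proof.
move=> /andP[w0 w1].
have p1 : fine (P (chain P w)) = w by rewrite chainE ?(ltW w0).
have w01 : 0 <= 1 - w <= 1 by lra.
have p2 : fine (P (~` chain P (1 - w))) = w.
  rewrite probability_setC; last exact: measurable_chain.
  by rewrite (chainE cF w01) -EFinB/= opprB addrC subrK.
have r1 := rare_hit P n (measurable_chain P w); rewrite p1 in r1.
have r2 := rare_hit P n (measurableC (measurable_chain P (1 - w))); rewrite p2 in r2.
apply: rareS (rareU r1 r2) => x [i [h|h]]; [left|right]; exists i.
  by rewrite /chain; case: ifP.
rewrite /setC/= /chain; case: leP => [|_ /=]; first by lra.
by apply/negP; rewrite -leNgt.
Qed.

(** With probability close to 1 no observation is extreme and the empirical
    distribution function is uniformly close to [F] relative to its standard
    deviation, so that all chi-square distances are of order [B ^ 2 / n]. *)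
Lemma null_rare n (z : R) : 1 <= z -> (0 < n)%N ->
  let B := 15 * z ^+ 2 in
  rare (power_prob P n) [set x : n.-tuple R | exists c, exceeds P s setT c x /\
      (2 + B ^+ 2) `^ `|s - 2| / 2 * (B ^+ 2 / n%:R) <= c]
    (2 / z + (n ^ 2).+1%:R * (2 * expR (2^-1 - z))).
Proof.
move=> z1 n0 B.
have n0R : 0 < n%:R :> R by rewrite ltr0n.
have n1R : 1 <= n%:R :> R by rewrite ler1n.
have z0 : 0 < z by lra.
pose w := (n%:R * z)^-1.
have w0 : 0 < w by rewrite invr_gt0 mulr_gt0.
have w1 : w <= 1 by rewrite invf_le1 ?mulr_gt0// -[leLHS]mulr1 ler_pM.
have nw : n%:R * w = z^-1 by rewrite /w; field; rewrite !gt_eqF.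
have w01 : 0 < w <= 1 by rewrite w0.
have := rareU (rare_extreme n w01) (rare_grid cF z1 n0).
rewrite nw (_ : z^-1 + z^-1 = 2 / z); last by rewrite mulr_natl mulr2n.
apply: rareS => x [c [[t [_ lo hi cK]] bc]].
apply: contrapT => /not_orP[no1 no2].
have nv i : w <= F (tnth x i) /\ F (tnth x i) < 1 - w.
  by split; [rewrite leNgt|rewrite ltNge]; apply/negP => h; apply: no1; exists i; [left|right].
have /andP[u1 u2] := emp_range_bounds lo hi.
set u := emp_dist_fun x t in cK u1 u2.
have wv : w <= F t by case: lo => i hi'; apply: (le_trans (nv i).1); exact: dist_fun_le.
have vw : F t < 1 - w.
  by case: hi => i hi'; apply: le_lt_trans (nv i).2; apply: dist_fun_le; exact: ltW.
have v01 : 0 < F t < 1 by rewrite (lt_le_trans w0)//= (lt_trans vw)// gtrBl.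
have dev := grid_deviation z1 n0 v01 no2.
have hu : hits R [set y | y <= t] x = n%:R * u.
  by rewrite /u emp_dist_funE mulrA mulfV ?mul1r// gt_eqF.
rewrite hu in dev; clearbody u; set v := F t in wv vw v01 dev cK.
clearbody v; move: no1 no2 nv lo hi => _ _ _ _ _.
have Vw := variance_range_ge wv (ltW vw) (ltW w0).
have nV : z^-1 / 2 <= n%:R * (v * (1 - v)).
  by rewrite -nw -mulrA ler_wpM2l// ltW.
set q := Num.sqrt (n%:R * (v * (1 - v))) in dev.
have q0 : 0 <= q by exact: sqrtr_ge0.
have V0 : 0 <= n%:R * (v * (1 - v)) by apply: le_trans nV; rewrite divr_ge0// invr_ge0 ltW.
have q2 : q ^+ 2 = n%:R * (v * (1 - v)) by rewrite sqr_sqrtr.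
have q1 : 1 <= 2 * z * q.
  rewrite -(@ler_pXn2r _ 2) ?nnegrE ?mulr_ge0 ?(ltW z0)// expr1n exprMn q2.
  have : (2 * z) ^+ 2 * (z^-1 / 2) <= (2 * z) ^+ 2 * (n%:R * (v * (1 - v))).
    by rewrite ler_wpM2l// sqr_ge0.
  apply: le_trans; have -> : (2 * z) ^+ 2 * (z^-1 / 2) = 2 * z by field; rewrite gt_eqF.
  lra.
have {}dev : `|n%:R * u - n%:R * v| <= B * q.
  apply: (le_trans dev).
  have h1 : 5 * z * (1 + q) <= 5 * z * (2 * z * q + q).
    by rewrite ler_wpM2l ?mulr_ge0 ?(ltW z0)// lerD2r.
  apply: (le_trans h1).
  have h2 : 5 * z * q <= 5 * z * q * z by rewrite ler_peMr// !mulr_ge0 ?(ltW z0).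
  rewrite /B; lra.
have z2 : z <= z ^+ 2 by rewrite expr2 ler_peMl// ltW.
have B1 : 1 <= B by rewrite /B; lra.
have Bz : z <= B ^+ 2.
  by apply: (@le_trans _ _ B); [rewrite /B; lra|rewrite expr2 ler_peMl// (le_trans ler01)].
clearbody B.
have B0 : 0 <= B by exact: le_trans B1.
have [v0 v1] : 0 < v /\ 0 < 1 - v by rewrite subr_gt0; case/andP: v01.
have Bw (y : R) : w <= y -> 1 <= B ^+ 2 * (n%:R * y).
  move=> wy; have : z * (n%:R * w) <= B ^+ 2 * (n%:R * y).
    by apply: ler_pM => //; rewrite ?mulr_ge0 ?(ltW z0) ?(ltW n0R) ?(ltW w0)// ler_wpM2l// ltW.
  by rewrite nw mulfV ?gt_eqF.
have w1v : w <= 1 - v by rewrite lerBrDr -lerBrDl ltW.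
have qle (y : R) : 0 <= y -> v * (1 - v) <= y -> B * q <= B * Num.sqrt (n%:R * y).
  by move=> y0 hy; rewrite ler_wpM2l// ler_sqrt ?mulr_ge0// ler_wpM2l// ltW.
have v1le : v <= 1 by rewrite -subr_ge0 ltW.
have nu1 : 1 <= n%:R * u by rewrite -ler_pdivrMl// mulr1.
have nu2 : 1 <= n%:R * (1 - u).
  by rewrite -ler_pdivrMl// mulr1 lerBrDr -lerBrDl.
have [r1 r2] : n%:R * u <= (2 + B ^+ 2) * (n%:R * v) /\ n%:R * v <= (2 + B ^+ 2) * (n%:R * u).
  apply: deviation_ratio => //; [exact: mulr_gt0|exact: Bw|].
  by apply: (le_trans dev); apply: qle; [exact: ltW|rewrite ler_piMr ?(ltW v0)// gerBl ltW].
have [r3 r4] : n%:R * (1 - u) <= (2 + B ^+ 2) * (n%:R * (1 - v)) /\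
    n%:R * (1 - v) <= (2 + B ^+ 2) * (n%:R * (1 - u)).
  apply: deviation_ratio => //; [exact: mulr_gt0|exact: Bw|].
  have -> : n%:R * (1 - u) - n%:R * (1 - v) = - (n%:R * u - n%:R * v) by ring.
  by rewrite normrN; apply: (le_trans dev); apply: qle; [exact: ltW|rewrite ler_piMl// ltW].
rewrite ![_ * (n%:R * _)]mulrCA !ler_pM2l// in r1 r2 r3 r4.
have u01 : 0 < u < 1.
  rewrite (lt_le_trans _ u1) ?invr_gt0//= (le_lt_trans u2)// gtrBl invr_gt0//.
have c1 : 1 <= 2 + B ^+ 2 by have := sqr_ge0 B; lra.
have [k Ek /andP[_ k2]] := K_div_bounds s u01 v01 c1 r1 r2 r3 r4.
rewrite Ek lte_fin in cK.
have : c < c; last by rewrite ltxx.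
apply: (lt_le_trans cK); apply: (le_trans k2); apply: le_trans bc.
rewrite ler_wpM2l ?divr_ge0 ?powR_ge0//.
rewrite ler_pdivrMr ?mulr_gt0// mulrAC ler_pdivlMr//.
rewrite -(ler_pM2l n0R).
have -> : n%:R * ((u - v) ^+ 2 * n%:R) = `|n%:R * u - n%:R * v| ^+ 2.
  by rewrite real_normK ?num_real//; ring.
have -> : n%:R * (B ^+ 2 * (v * (1 - v))) = (B * q) ^+ 2 by rewrite exprMn q2; ring.
by rewrite ler_sqr ?nnegrE ?mulr_ge0.
Qed.

End null_statistic.

Section separation.
Context (R : realType) (P : probability R R) (s : R).
Local Notation F := (dist_fun P).
Hypothesis cF : continuous F.

Lemma nat_powR_ge (r K : R) : 0 < r -> \forall n \near \oo, K <= n%:R `^ r.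
Proof.
move=> r0; have K0 : 0 < `|K| + 1 by rewrite ltr_wpDl.
near=> n.
have n0 : 0 < n%:R `^ r :> R.
  by rewrite powR_gt0// ltr0n; near: n; exact: nbhs_infty_gt.
have : n%:R `^ (- r) <= (`|K| + 1)^-1.
  near: n; apply: cvgr_le; first exact: cvg_nat_powR.
  by rewrite invr_gt0.
rewrite powRN lef_pV2 ?posrE//; apply: le_trans.
by rewrite (le_trans (ler_norm K))// lerDl.
Unshelve. all: by end_near. Qed.

Lemma nat_powRD (n : nat) (x y : R) : (0 < n)%N ->
  n%:R `^ (x + y) = n%:R `^ x * n%:R `^ y :> R.
Proof. by move=> n0; rewrite powRD// pnatr_eq0 -lt0n n0 implybT. Qed.

Lemma expR_sub_le (z : R) k : 0 < z -> expR (2^-1 - z) <= 2 * (k.+1`!%:R / z ^+ k.+1).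
Proof.
move=> z0; rewrite expRD.
have h1 : expR 2^-1 <= 2 :> R.
  have : 1 + - 2^-1 <= expR (- 2^-1) :> R by exact: expR_ge1Dx.
  rewrite expRN => h.
  have h' : 2^-1 <= (expR 2^-1 : R)^-1 by lra.
  by rewrite lef_pV2 ?posrE ?expR_gt0 in h'.
apply: ler_pM => //; rewrite ?expR_ge0// expRN -[leRHS]invrK lef_pV2 ?posrE ?expR_gt0//.
  rewrite invf_div; apply: le_trans (expR_ge1Dxn k (ltW z0)).
  by rewrite lerDr.
by rewrite invr_gt0 divr_gt0 ?exprn_gt0// ltr0n fact_gt0.
Qed.

(** In [null_rare], [z] may be a small power of [n]: the probability then vanishes
    faster than the number of grid points grows. *)
Lemma null_statistic_small (kap e : R) : 0 < kap -> 0 < e ->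
  \forall n \near \oo, rare (power_prob P n)
    [set x : n.-tuple R | exceeds P s setT (n%:R `^ (kap - 1)) x] e.
Proof.
move=> kap0 e0; pose A := `|s - 2|.
have A0 : 0 <= A by exact: normr_ge0.
have A1 : 0 < A + 1 by rewrite ltr_wpDl.
(* With [z = n ^ eta] the bound of [null_rare] is of order [z ^ (4 * (A + 1)) / n],
   that is [n ^ (kap / 2 - 1)]. *)
pose eta := kap / (8 * (A + 1)).
have eta0 : 0 < eta by rewrite divr_gt0// mulr_gt0.
pose k := Num.truncn (3 / eta).
have hk : 3 <= eta * k.+1%:R.
  rewrite mulrC -ler_pdivrMr// ltW//; exact: Num.Theory.truncnS_gt.
have kap2 : 0 < kap / 2 by rewrite divr_gt0.
have [K hK] : exists K : R, K = 227 by exists 227.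
have K0 : 0 < K by lra.
near=> n.
have n0 : (0 < n)%N by near: n; exact: nbhs_infty_gt.
have n0R : 0 < n%:R :> R by rewrite ltr0n.
have n1R : 1 <= n%:R :> R by rewrite ler1n.
pose z : R := n%:R `^ eta.
have z1 : 1 <= z.
  apply: (@le_trans _ _ (n%:R `^ 0)); first by rewrite powRr0.
  by apply: ler_powR => //; exact: ltW.
have z4e : 4 / e <= n%:R `^ eta by near: n; exact: nat_powR_ge.
rewrite -/z in z4e.
have z0 : 0 < z by lra.
have := null_rare s cF z1 n0; set B := 15 * z ^+ 2 => /= hB.
have e1 : 2 / z <= e / 2.
  rewrite ler_pdivrMr//; move: z4e; rewrite ler_pdivrMr//; lra.
have e2 : (n ^ 2).+1%:R * (2 * expR (2^-1 - z)) <= e / 2.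
  have h1 := expR_sub_le k z0.
  have h2 : n%:R ^+ 3 <= z ^+ k.+1.
    rewrite -(powR_mulrn 3 (ltW n0R)) -(powR_mulrn k.+1 (ltW z0)).
    by rewrite /z -powRrM; apply: ler_powR.
  have h3 : (k.+1`!)%:R / z ^+ k.+1 <= (k.+1`!)%:R / n%:R ^+ 3.
    by rewrite ler_wpM2l// lef_pV2 ?posrE ?exprn_gt0.
  have h4 : (n ^ 2).+1%:R <= 2 * n%:R ^+ 2 :> R.
    rewrite -natr1 natrX; have : 1 <= n%:R ^+ 2 :> R by rewrite exprn_ege1.
    lra.
  have h5 : 16 * (k.+1`!)%:R / e <= n%:R.
    have : 16 * (k.+1`!)%:R / e <= n%:R `^ 1 by near: n; exact: nat_powR_ge.
    by rewrite powRr1.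
  apply: (@le_trans _ _ (2 * n%:R ^+ 2 * (2 * (2 * ((k.+1`!)%:R / n%:R ^+ 3))))).
    have h6 : 0 <= 2 * expR (2^-1 - z) by rewrite mulr_ge0// expR_ge0.
    apply: ler_pM => //.
    by rewrite ler_pM2l// (le_trans h1)// ler_pM2l.
  have -> : 2 * n%:R ^+ 2 * (2 * (2 * ((k.+1`!)%:R / n%:R ^+ 3))) =
      8 * (k.+1`!)%:R / n%:R :> R by field; rewrite gt_eqF.
  rewrite ler_pdivrMr//; move: h5; rewrite ler_pdivrMr//; lra.
have e3 : (2 + B ^+ 2) `^ A / 2 * (B ^+ 2 / n%:R) <= n%:R `^ (kap - 1).
  pose X := K * z ^+ 4.
  have z41 : 1 <= z ^+ 4 by exact: exprn_ege1.
  have B4 : B ^+ 2 = 225 * z ^+ 4 by rewrite /B; ring.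
  have BX : 2 + B ^+ 2 <= X by rewrite B4 /X hK; lra.
  have BX' : B ^+ 2 / 2 <= X by rewrite B4 /X hK; lra.
  have X0 : 0 <= X by rewrite mulr_ge0 ?exprn_ge0 ?(ltW K0) ?(ltW z0).
  have h1 : (2 + B ^+ 2) `^ A <= X `^ A.
    by apply: ge0_ler_powR => //; rewrite nnegrE// addr_ge0// sqr_ge0.
  have -> : (2 + B ^+ 2) `^ A / 2 * (B ^+ 2 / n%:R) =
      (2 + B ^+ 2) `^ A * (B ^+ 2 / 2) / n%:R by field; rewrite gt_eqF.
  have -> : n%:R `^ (kap - 1) = n%:R `^ kap / n%:R :> R.
    by rewrite nat_powRD// powR_inv1.
  rewrite ler_pM2r ?invr_gt0//.
  apply: (@le_trans _ _ (X `^ A * X)).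
    by apply: ler_pM => //; rewrite ?powR_ge0// divr_ge0// sqr_ge0.
  have -> : X `^ A * X = X `^ (A + 1).
    rewrite powRD ?powRr1//; apply/implyP => _.
    by rewrite gt_eqF ?mulr_gt0 ?exprn_gt0.
  rewrite /X powRM ?exprn_ge0 ?(ltW z0) ?(ltW K0)//.
  have -> : (z ^+ 4) `^ (A + 1) = n%:R `^ (kap / 2).
    rewrite -(powR_mulrn 4 (ltW z0)).
    by rewrite /z -!powRrM /eta; congr powR; field; rewrite gt_eqF.
  have -> : n%:R `^ kap = n%:R `^ (kap / 2) * n%:R `^ (kap / 2) :> R.
    by rewrite -nat_powRD//; congr powR; field.
  rewrite ler_wpM2r ?powR_ge0//.
  by near: n; exact: nat_powR_ge.
have e12 : 2 / z + (n ^ 2).+1%:R * (2 * expR (2^-1 - z)) <= e by lra.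
apply: (rareW e12); apply: rareS hB => x hx.
by exists (n%:R `^ (kap - 1)).
Unshelve. all: by end_near. Qed.

Lemma mean_null (h : R -> R) (A : set R) m : measurable_fun setT h -> measurable A ->
  P A = 0%E -> has_mean P (fun x => h x * \1_A x) m -> m = 0.
Proof.
move=> mh mA PA [_ hm]; apply: EFin_inj; rewrite -hm.
transitivity (\int[P]_(x in A) (h x)%:E)%E.
  rewrite [RHS]integral_mkcond; apply: eq_integral => x _.
  by rewrite patchE indicE; case: (_ \in _); rewrite ?mulr1 ?mulr0.
by rewrite null_set_integral//; apply: measurable_funTS; exact/measurable_EFinP.
Qed.

Lemma quarter_le (X A U B : R) :
  A <= U + B -> B * 4 <= X -> X / 2 <= A -> X / 4 <= U.
Proof. lra. Qed.

Context (Q : nat -> probability R R).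
Context (a : nat -> R) (G : nat -> R -> R) (h D : R -> R) (d sg2 : R).
Hypothesis la : local_alternatives P Q a G h D d sg2.

(** Under the alternatives the empirical distribution function at a single
    well-chosen point is already too far from [F]. *)
Lemma alternative_statistic_large (kap e : R) : 0 < sg2 -> 0 < kap < 2^-1 ->
  (\forall n \near \oo, a n = n%:R `^ (kap - 2^-1)) -> 0 < e ->
  \forall n \near \oo, rare (power_prob (Q n) n)
    [set x : n.-tuple R | ~ exceeds P s setT (n%:R `^ (kap - 1)) x] e.
Proof.
move=> sg0 /andP[kap0 kap1] ha e0.
have h0 := local_limit_centered la.
have mh := has_mean_measurable h0.
have [t0 [m [hm m0]]] := halfline_mean_neq0 h0 (local_variance la) sg0.
have mA := measurable_halfline t0; set A := [set y | y <= t0] in hm mA.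
have [m' hm' [m_ hm_ mm]] := local_mean la mA.
have {hm'} em : m' = m := has_mean_uniq hm' hm; rewrite {}em in mm.
have v0 : 0 < F t0.
  rewrite lt_neqAle dist_fun_ge0 andbT eq_sym; apply/eqP => v0.
  move/eqP: m0; apply; apply: (mean_null mh mA _ hm).
  by rewrite /A dist_funE v0.
have v1 : F t0 < 1.
  rewrite lt_neqAle dist_fun_le1 andbT; apply/eqP => v1.
  move/eqP: m0; apply.
  have hC : has_mean P (fun x => h x * \1_(~` A) x) (0 - m).
    apply: (has_mean_eq (has_meanB h0 hm)) => // x.
    by rewrite !indicE in_setC; case: (_ \in _); rewrite /= ?mulr1 ?mulr0 ?subrr ?subr0.
  have PC : P (~` A) = 0%E.
    by rewrite probability_setC// /A dist_funE v1 subee.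
  have := mean_null mh (measurableC mA) PC hC; lra.
set v := F t0 in v0 v1.
have v01 : 0 < v < 1 by rewrite v0.
have am0 : 0 < `|m| by rewrite normr_gt0.
pose w := Num.min (v / 2) ((1 - v) / 2).
have w0 : 0 < w by rewrite lt_min !divr_gt0// subr_gt0.
pose L : R := 2 `^ `|s - 2|.
have L0 : 0 < L by exact: powR_gt0.
have kap2 : 0 < kap / 2 by rewrite divr_gt0.
have ca : n%:R `^ (kap - 2^-1) @[n --> \oo] --> (0 : R).
  by rewrite -[kap - _]opprB; apply: cvg_nat_powR; rewrite subr_gt0.
near=> n.
have n0 : (0 < n)%N by near: n; exact: nbhs_infty_gt.
have n4 : (4 <= n)%N by near: n; exact: nbhs_infty_ge.
have n0R : 0 < n%:R :> R by rewrite ltr0n.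
have an : a n = n%:R `^ (kap - 2^-1) by near: n.
have aw : n%:R `^ (kap - 2^-1) <= w / (`|m| + 2).
  near: n; apply: cvgr_le; first exact: ca.
  by rewrite divr_gt0// ltr_wpDl.
have D1 : 1 <= n%:R `^ (kap / 2) by near: n; exact: nat_powR_ge.
have D2 : 4 / `|m| <= n%:R `^ (kap / 2) by near: n; exact: nat_powR_ge.
have D3 : 64 * L / `|m| ^+ 2 <= n%:R `^ (kap / 2) by near: n; exact: nat_powR_ge.
have D4 : 2 - ln (e / 2) <= n%:R `^ (kap / 2) by near: n; exact: nat_powR_ge.
pose D' : R := n%:R `^ (kap / 2).
rewrite -/D' in D1 D2 D3 D4.
have mn1 : `|m| / 2 <= `|m_ n|.
  near: n; apply: cvgr_ge; first exact: cvg_norm mm.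
  by rewrite ltr_pdivrMr// mulr_natr mulr2n ltrDl.
have mn2 : `|m_ n| <= `|m| + 1.
  near: n; apply: cvgr_le; first exact: cvg_norm mm.
  by rewrite ltrDl.
pose sq : R := Num.sqrt n%:R.
have sq0 : 0 < sq by rewrite sqrtr_gt0.
have sq2 : sq * sq = n%:R by rewrite -expr2 sqr_sqrtr// ltW.
have D'2 : n%:R `^ kap = D' * D' by rewrite -nat_powRD//; congr powR; field.
have aE : a n = D' * D' / sq.
  by rewrite an nat_powRD// powRN powR12_sqrt ?ler0n// D'2.
have cE : n%:R `^ (kap - 1) = D' * D' / n%:R.
  by rewrite nat_powRD// powR_inv1// D'2.
clearbody D' sq.
have QA : fine (Q n A) = v + a n * m_ n.
  have [_ hq] : has_mean P (fun x => (1 + a n * G n x) * \1_A x) (v + a n * m_ n).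
    apply: (has_mean_eq (has_meanD (has_mean_indic P mA) (has_meanZ (a n) (hm_ n)))).
      by move=> x; ring.
    by rewrite /A dist_funE.
  have <- : (\int[Q n]_x (\1_A x : R)%:E = Q n A)%E by rewrite integral_indic// setIT.
  rewrite (local_density la).
  - by under eq_integral do rewrite -EFinM; rewrite hq.
  - by apply/measurable_EFinP; exact: measurable_indic.
  - by move=> x; rewrite lee_fin.
have l01 : 0 <= sq^-1 <= 2^-1.
  rewrite invr_ge0 (ltW sq0)/= lef_pV2 ?posrE//.
  rewrite -(@ler_pXn2r _ 2) ?nnegrE// ?(ltW sq0)// !expr2 sq2 -natrM ler_nat.
  exact: n4.
have := rare_hits (Q n) n (sq * D') mA l01; rewrite /= QA.
set p := v + _; move=> rr.
have p01 : 0 <= p <= 1.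
  by rewrite /p -QA fine_ge0//= -lee_fin fineK ?fin_num_measure// probability_le1.
have re : 2 * expR (2 * sq^-1 ^+ 2 * (n%:R * (p * (1 - p))) - sq^-1 * (sq * D')) <= e.
  rewrite mulrC -ler_pdivlMr// -[leRHS]lnK ?posrE ?divr_gt0// ler_expR.
  rewrite mulKf ?gt_eqF//.
  have -> : 2 * sq^-1 ^+ 2 * (n%:R * (p * (1 - p))) = 2 * (p * (1 - p)).
    by rewrite -sq2; field; rewrite gt_eqF.
  have p2 : 2 * (p * (1 - p)) <= 2.
    by case/andP: p01 => p0 p1; rewrite ler_piMr// mulr_ile1 ?subr_ge0// gerBl.
  by rewrite (le_trans (lerB p2 D4))// opprB addrCA subrr addr0.
apply: (rareW re); apply: rareS rr => x nex.
rewrite /= leNgt; apply/negP => dev; apply: nex.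
pose u := emp_dist_fun x t0.
have hu : hits R A x = sq * sq * u.
  by rewrite sq2 /u emp_dist_funE mulrA mulfV ?mul1r// gt_eqF.
have {}dev : `|u - v - a n * m_ n| < D' / sq.
  rewrite -(ltr_pM2l (mulr_gt0 sq0 sq0)).
  have -> : sq * sq * (D' / sq) = sq * D' by field; rewrite gt_eqF.
  move: dev; rewrite hu -sq2 -[X in X * `|_|]gtr0_norm ?mulr_gt0// -normrM => dev.
  by apply: le_lt_trans dev; rewrite le_eqVlt; apply/orP; left; apply/eqP; congr `|_|; rewrite /p; ring.
have Dsq : D' / sq <= a n.
  by rewrite aE ler_pM2r ?invr_gt0// ler_peMl// (le_trans ler01).
have a0 : 0 <= a n by exact: local_rate_ge0 la n.
have up : `|u - v| <= w.
  have -> : u - v = (u - v - a n * m_ n) + a n * m_ n by rewrite subrK.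
  rewrite (le_trans (ler_normD _ _))// normrM (ger0_norm a0).
  have h1 : a n * `|m_ n| <= a n * (`|m| + 1) by rewrite ler_wpM2l.
  have h2 : a n * (`|m| + 2) <= w by rewrite an -ler_pdivlMr// ltr_wpDl.
  apply: le_trans h2; rewrite (_ : a n * (`|m| + 2) = a n + a n * (`|m| + 1)); last by ring.
  by apply: lerD => //; exact: le_trans (ltW dev) Dsq.
(* The shift [a n * m_ n] dominates the random deviation. *)
have lowb : D' * D' * `|m| / (4 * sq) <= `|u - v|.
  have h1 : a n * `|m_ n| <= `|u - v| + D' / sq.
    rewrite -(ger0_norm a0) -normrM.
    have -> : a n * m_ n = (u - v) - (u - v - a n * m_ n) by rewrite opprB addrC subrK.
    by rewrite (le_trans (ler_normB _ _))// lerD2l ltW.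
  have h2 : D' / sq * 4 <= D' * D' * `|m| / sq.
    rewrite mulrAC ler_pM2r ?invr_gt0// -mulrA ler_wpM2l ?(le_trans ler01)//.
    by rewrite -ler_pdivrMr.
  have h3 : D' * D' * `|m| / sq / 2 <= a n * `|m_ n|.
    rewrite aE; have -> : D' * D' * `|m| / sq / 2 = D' * D' / sq * (`|m| / 2) by field; rewrite gt_eqF.
    by rewrite ler_wpM2l// divr_ge0 ?(ltW sq0)// mulr_ge0// (le_trans ler01).
  have -> : D' * D' * `|m| / (4 * sq) = D' * D' * `|m| / sq / 4 by field; rewrite gt_eqF.
  exact: quarter_le h1 h2 h3.
have up1 : `|u - v| <= v / 2 by apply: (le_trans up); rewrite ge_min lexx.
have up2 : `|u - v| <= (1 - v) / 2 by apply: (le_trans up); rewrite ge_min lexx orbT.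
have [u01 [k Ek /andP[k1 _]]] := K_div_close s v01 up1 up2.
have [lo hi] := emp_range u01.
exists t0; split => //.
rewrite -/u -/v Ek lte_fin cE; apply: (lt_le_trans _ k1); rewrite -/L.
have V1 : v * (1 - v) <= 1 by rewrite mulr_ile1 ?(ltW v0) ?subr_ge0 ?(ltW v1)// gerBl ltW.
have V0 : 0 < v * (1 - v) by rewrite mulr_gt0// subr_gt0.
apply: (@lt_le_trans _ _ (L^-1 / 2 * (D' * D' * `|m| / (4 * sq)) ^+ 2)); last first.
  rewrite ler_pM2l ?divr_gt0 ?invr_gt0//.
  rewrite ler_pdivlMr//; apply: (@le_trans _ _ ((D' * D' * `|m| / (4 * sq)) ^+ 2)).
    by rewrite ler_piMr// sqr_ge0.
  rewrite -[leRHS]real_normK ?num_real// ler_sqr ?nnegrE//.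
  by rewrite divr_ge0 ?mulr_ge0 ?(le_trans ler01 D1) ?(ltW sq0).
have -> : L^-1 / 2 * (D' * D' * `|m| / (4 * sq)) ^+ 2 =
    D' * D' / n%:R * (D' * D' * `|m| ^+ 2 / (32 * L)).
  by rewrite -sq2; field; rewrite !gt_eqF.
have D0 : 0 < D' by exact: lt_le_trans D1.
rewrite ltr_pMr; last by rewrite divr_gt0// mulr_gt0.
rewrite ltr_pdivlMr ?mulr_gt0// mul1r.
move: D3; rewrite ler_pdivrMr ?exprn_gt0// => D3.
have DD : D' * `|m| ^+ 2 <= D' * D' * `|m| ^+ 2.
  by rewrite ler_wpM2r ?sqr_ge0// ler_peMl// ltW.
apply: lt_le_trans DD; apply: lt_le_trans D3.
by rewrite ltr_pM2r// ltr_nat.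
Unshelve. all: by end_near. Qed.

Theorem S_test_separates (kap : R) : 0 < sg2 -> 0 < kap < 2^-1 ->
  (\forall n \near \oo, a n = n%:R `^ (kap - 2^-1)) ->
  completely_separates P Q (S_test P s (fun n => n%:R `^ (kap - 1))).
Proof.
move=> sg0 kap01 ha; have /andP[kap0 _] := kap01.
apply: eclose_cvg => e e0.
have e2 : 0 < e / 2 by rewrite divr_gt0.
near=> n.
have r1 : rare (power_prob P n)
    [set x : n.-tuple R | exceeds P s setT (n%:R `^ (kap - 1)) x] (e / 2).
  by near: n; exact: null_statistic_small.
have r2 : rare (power_prob (Q n) n)
    [set x : n.-tuple R | ~ exceeds P s setT (n%:R `^ (kap - 1)) x] (e / 2).
  by near: n; exact: alternative_statistic_large.
have mA : measurable [set x : n.-tuple R | exceeds P s setT (n%:R `^ (kap - 1)) x].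
  exact: measurable_exceeds.
have := error_sum_indic mA r1 r2; rewrite -splitr -(S_test_exceeds P s (fun n => n%:R `^ (kap - 1))).
move=> le_e; split; first by rewrite add0e.
rewrite adde_ge0// ?lee_fin ?(ltW e0)// error_sumE.
have [_ t01] := S_test_test_sequence P s (fun n => n%:R `^ (kap - 1)) n.
by apply: adde_ge0; apply: integral_ge0 => x _; rewrite lee_fin ?subr_ge0; case/andP: (t01 x).
Unshelve. all: by end_near. Qed.

End separation.

(** * The detection boundary *)

Theorem theorem4p6 (R : realType) (P : R -> probability R R) (C T : R -> R)
    (beta : R)
    (family : is_exponential_family P C T)
    (T_L2 : T \in Lfun (P 0) 2%:E)
    (var_pos : (0 < 'V_(P 0%R)[T])%E)
    (beta_range : 0 < beta < 2^-1) :
  let Q := signal_alternative P beta in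
  let rho := 2^-1 - beta in
  is_detection_boundary (P 0) Q rho /\
  forall s r : R, 0 < r ->
  [/\ r < rho ->
        exists c : nat -> R, test_sequence (S_test (P 0) s c) /\
          completely_separates (P 0) (Q r) (S_test (P 0) s c),
      r = rho ->
        ereal_inf [set error_sum (P 0) (Q r n) f |
                   f in [set f : n.-tuple R -> R | is_test f]] @[n --> \oo]
          --> (2%:E * normal_prob 0 1
                 `](2^-1 * Num.sqrt (fine 'V_(P 0)[T]))%R, +oo[%classic)%E /\
        forall c : nat -> R, test_sequence (S_test (P 0) s c) /\
          cannot_distinguish (P 0) (Q r) (S_test (P 0) s c) &
      rho < r ->
        forall f : forall n, n.-tuple R -> R, test_sequence f ->
          cannot_distinguish (P 0) (Q r) f].
Proof.
move=> Q rho; have /andP[b0 b2] := beta_range.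
have cF : continuous (dist_fun (P 0)).
  by case: family => _ /(_ 0 (lexx 0)) cF _ _ _.
have sg0 : 0 < fine 'V_(P 0)[T].
  by apply: fine_gt0; rewrite var_pos/= ltey_eq variance_fin_num.
have rateE r : \forall n \near \oo,
    n%:R `^ (- beta) * n%:R `^ (- r) = n%:R `^ (rho - r - 2^-1) :> R.
  near=> n; have n0 : (0 < n)%N by near: n; exact: nbhs_infty_gt.
  by rewrite -nat_powRD//; congr powR; rewrite /rho; ring.
have rate2E r : \forall n \near \oo,
    n%:R * (n%:R `^ (- beta) * n%:R `^ (- r)) ^+ 2 = n%:R `^ (2 * (rho - r)) :> R.
  near=> n; have n0 : (0 < n)%N by near: n; exact: nbhs_infty_gt.
  have n0R : 0 < n%:R :> R by rewrite ltr0n.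
  rewrite -{1}[n%:R]powRr1 ?(ltW n0R)// -nat_powRD// expr2 -!nat_powRD//.
  by congr powR; rewrite /rho; field.
have separable r s : 0 < r -> r < rho -> completely_separates (P 0) (Q r)
    (S_test (P 0) s (fun n => n%:R `^ (rho - r - 1))).
  move=> r0 rr; have [m [D [d la]]] := exponential_alternatives family T_L2 b0 r0.
  apply: (S_test_separates s cF la sg0); last exact: rateE.
  by rewrite subr_gt0 rr/= /rho; lra.
have inseparable r : 0 < r -> rho < r -> forall f : forall n, n.-tuple R -> R,
    test_sequence f -> cannot_distinguish (P 0) (Q r) f.
  move=> r0 rr f tf; have [m [D [d la]]] := exponential_alternatives family T_L2 b0 r0.
  apply: (indistinguishable la) tf.
  have : n%:R `^ (- (2 * (r - rho))) @[n --> \oo] --> (0 : R).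
    by apply: cvg_nat_powR; rewrite mulr_gt0// subr_gt0.
  apply: cvg_trans; apply: near_eq_cvg; near=> n.
  have -> : - (2 * (r - rho)) = 2 * (rho - r) by ring.
  by apply/esym; near: n; exact: rate2E.
split.
  split => [r r0 rr|r r0 rr f tf]; last exact: inseparable.
  exists (S_test (P 0) 0 (fun n => n%:R `^ (rho - r - 1))).
  by split; [exact: S_test_test_sequence|exact: separable].
move=> s r r0; split; last exact: inseparable.
  move=> rr; exists (fun n => n%:R `^ (rho - r - 1)).
  by split; [exact: S_test_test_sequence|exact: separable].
move=> rr; have [m [D [d la]]] := exponential_alternatives family T_L2 b0 r0.
have rate0 : n%:R `^ (- beta) * n%:R `^ (- r) @[n --> \oo] --> (0 : R).
  have : n%:R `^ (- 2^-1) @[n --> \oo] --> (0 : R) by exact: cvg_nat_powR.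
  apply: cvg_trans; apply: near_eq_cvg; near=> n.
  have -> : - 2^-1 = rho - r - 2^-1 by rewrite rr; ring.
  by apply/esym; near: n; exact: rateE.
have rate1 : n%:R * (n%:R `^ (- beta) * n%:R `^ (- r)) ^+ 2 @[n --> \oo] --> (1 : R).
  apply: cvg_near_cst; near=> n.
  transitivity (n%:R `^ (2 * (rho - r)) : R); last first.
    by rewrite rr subrr mulr0 powRr0.
  by near: n; exact: rate2E.
split; first exact: (local_bayes_risk la).
move=> c; split; first exact: S_test_test_sequence.
exact: (S_test_indistinguishable la cF).
Unshelve. all: by end_near. Qed.
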